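(* Let $T=\{t_n\}_{n\ge1}$ satisfy one of the conditions $\mathbf{Z}$, $\mathbf{\Pi}$ or $\mathbf{A_\gamma}$ (defined in the context). Assume that $F$ is an entire function such that $F=\mathcal{C}_{a,k}/\mathcal{C}_{b,m}$, where $\mathcal{C}_{a,k}$ and $\mathcal{C}_{b,m}$ are regularized Cauchy transforms with poles in $T$ (with $\mathcal{C}_{b,m}\not\equiv 0$). Then $F$ is of finite exponential type. Moreover: (1) in cases $\mathbf{Z}$ and $\mathbf{A_\gamma}$, $F$ is of zero exponential type; (2) in cases $\mathbf{\Pi}$ and $\mathbf{A_\gamma}$, $F$ is of Cartwright class with respect to some line, i.e. there exist $c\in\mathbb{C}$ and $u\in\mathbb{C}$ with $|u|=1$ such that $z\mapsto F(uz+c)$ is of Cartwright class.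
   Context: Standing assumptions: $T=\{t_n\}\subset\mathbb{C}$ consists of pairwise distinct points, $0\notin T$, and $|t_n|\to\infty$. For an integer $k\ge0$ and a complex sequence $a=\{a_n\}$ with $\sum_n |t_n|^{-k-1}|a_n|<\infty$, the regularized Cauchy transform with poles in $T$ is $$\mathcal{C}_{a,k}(z)=\sum_n a_n\Big(\frac{1}{z-t_n}+\frac1{t_n}+\dots+\frac{z^{k-1}}{t_n^k}\Big)=z^k\sum_n\frac{a_n}{t_n^k(z-t_n)}$$ (for $k=0$ this is $\sum_n a_n/(z-t_n)$). An entire function $F$ is of Cartwright class if it is of finite exponential type and $\int_{\mathbb{R}}\frac{\log^+|F(x)|}{1+x^2}dx<\infty$. $T$ has finite convergence exponent if $\sum_n|t_n|^{-K}<\infty$ for some $K>0$; the convergence exponent is the infimum of such $K$. Conditions: $\mathbf{Z}$: $T$ is the zero set of some entire function of zero exponential type. $\mathbf{\Pi}$: $T$ lies in some strip (a set of points at distance at most $h$ from some line, $h>0$) and has finite convergence exponent. $\mathbf{A_\gamma}$ ($0<\gamma<1$): $T$ lies in some angle $\{\theta_0<\arg z<\theta_0+\pi\gamma\}$ and the convergence exponent of $T$ is strictly less than $\gamma^{-1}$. *)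

(* Defs.v *)
From Stdlib Require Import Reals.
Open Scope R_scope.

Definition Cplx : Type := (R * R)%type.
Definition RtoC (x : R) : Cplx := (x, 0).
Definition Cadd (z w : Cplx) : Cplx := (fst z + fst w, snd z + snd w).
Definition Copp (z : Cplx) : Cplx := (- fst z, - snd z).
Definition Csub (z w : Cplx) : Cplx := Cadd z (Copp w).
Definition Cmul (z w : Cplx) : Cplx :=
  (fst z * fst w - snd z * snd w, fst z * snd w + snd z * fst w).
Definition Cnorm2 (z : Cplx) : R := fst z * fst z + snd z * snd z.
Definition Cinv (z : Cplx) : Cplx := (fst z / Cnorm2 z, - snd z / Cnorm2 z).
Definition Cdiv (z w : Cplx) : Cplx := Cmul z (Cinv w).
Definition Cabs (z : Cplx) : R := sqrt (Cnorm2 z).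
Definition Cconj (z : Cplx) : Cplx := (fst z, - snd z).
Fixpoint Cpow (z : Cplx) (n : nat) : Cplx :=
  match n with O => (1, 0) | S n => Cmul z (Cpow z n) end.

Definition Cseries_cv (u : nat -> Cplx) (l : Cplx) : Prop :=
  Un_cv (fun N => sum_f_R0 (fun n => fst (u n)) N) (fst l) /\
  Un_cv (fun N => sum_f_R0 (fun n => snd (u n)) N) (snd l).

Definition Rseries_converges (u : nat -> R) : Prop :=
  exists l, Un_cv (fun N => sum_f_R0 u N) l.

Definition entire (f : Cplx -> Cplx) : Prop :=
  forall z, exists l : Cplx, forall eps, 0 < eps -> exists delta, 0 < delta /\
    forall h : Cplx, 0 < Cabs h < delta ->
      Cabs (Csub (Cdiv (Csub (f (Cadd z h)) (f z)) h) l) < eps.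

Definition finite_exp_type (f : Cplx -> Cplx) : Prop :=
  exists A B, forall z, Cabs (f z) <= A * exp (B * Cabs z).

Definition zero_exp_type (f : Cplx -> Cplx) : Prop :=
  forall eps, 0 < eps -> exists A, forall z, Cabs (f z) <= A * exp (eps * Cabs z).

Definition logplus (x : R) : R := Rmax 0 (ln x).

(** Cartwright class: finite exponential type and
    int_R log^+|f(x)| / (1+x^2) dx < infinity (the integrand is nonnegative,
    so this means the integrals over [-A,A] are uniformly bounded). *)
Definition cartwright (f : Cplx -> Cplx) : Prop :=
  entire f /\ finite_exp_type f /\
  exists M, forall A, 0 < A ->
    exists pr : Riemann_integrable
                  (fun x => logplus (Cabs (f (RtoC x))) / (1 + x * x)) (- A) A,
      RiemannInt pr <= M.

Definition standing (t : nat -> Cplx) : Prop :=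
  (forall n m, t n = t m -> n = m) /\
  (forall n, t n <> (0, 0)) /\
  (forall M, exists N, forall n, (N <= n)%nat -> M < Cabs (t n)).

Definition in_T (t : nat -> Cplx) (z : Cplx) : Prop := exists n, z = t n.

Definition admissible (t : nat -> Cplx) (a : nat -> Cplx) (k : nat) : Prop :=
  Rseries_converges (fun n => Cabs (a n) / (Cabs (t n) ^ (S k))).

Definition cauchy_cv (t : nat -> Cplx) (a : nat -> Cplx) (k : nat) (z w : Cplx) : Prop :=
  Cseries_cv (fun n => Cdiv (Cmul (a n) (Cpow z k))
                            (Cmul (Cpow (t n) k) (Csub z (t n)))) w.

Definition conv_exp_witness (t : nat -> Cplx) (K : R) : Prop :=
  0 < K /\ Rseries_converges (fun n => Rpower (Cabs (t n)) (- K)).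

Definition condZ (t : nat -> Cplx) : Prop :=
  exists G, entire G /\ zero_exp_type G /\ forall z, G z = (0, 0) <-> in_T t z.

(** Condition Pi: T within distance h of the line {p + s u : s real}, |u| = 1,
    and finite convergence exponent. *)
Definition condPi (t : nat -> Cplx) : Prop :=
  (exists (p u : Cplx) (h : R), Cabs u = 1 /\ 0 < h /\
     forall n, Rabs (snd (Cmul (Cconj u) (Csub (t n) p))) <= h) /\
  (exists K, conv_exp_witness t K).

Definition condA (gamma : R) (t : nat -> Cplx) : Prop :=
  0 < gamma < 1 /\
  (exists theta0, forall n, exists phi,
       theta0 < phi < theta0 + PI * gamma /\
       t n = (Cabs (t n) * cos phi, Cabs (t n) * sin phi)) /\
  (exists K, K < / gamma /\ conv_exp_witness t K).

(* Main.v *)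
(* By Jensen's inequality, a quotient f = A/B with |A|, |B| <= 1 on a disc satisfies
   |f(z)| <= exp (c log (1/|B(centre)|)), with a Harnack constant c depending on z.  The poles of the two
   Cauchy transforms are removed by a common factor vanishing on T: in case Z an entire function of
   zero exponential type, which already gives zero type of F; in the other cases a polynomial, which only
   gives finite order of F.  Applied on half planes (case Pi), resp. on the angle complementary to the one
   containing T (case A_gamma), where the transforms grow polynomially, the same estimate bounds log |F| by
   |z|, resp. by |z|^sigma with sigma < 1, away from T, and the Phragmen-Lindelof principle extends the bound
   to the remaining angles.  Jensen's inequality on a half plane gives the logarithmic integral.
   The only input from Cauchy's theory is the maximum principle at the centre of a disc;
   applied to the product of the rotations f(w^j z) over the N-th roots of unity w^j it yields Jensen's
   inequality as N tends to infinity. *)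

Require Import Defs.
From Stdlib Require Import Reals Lra Lia Classical ClassicalEpsilon.
From Coquelicot Require Import Coquelicot.
Open Scope R_scope.

(** * Complex differentiability *)

(** All estimates of a transform go through one inequality, $|t_n|\le X|z-t_n|$ for all $n$, which
    bounds [cauchy a k z] by $X|z|^k$ times a constant. Where poles are present, a multiplier [Q]
    with $|Q(z)||t_n|\le M|z-t_n|$ takes over. It enters as its cube: one factor cancels the pole,
    and the other two make the product flat enough to be differentiable there without a theorem on
    removable singularities. The zeros of $\mathcal{C}_{b,m}$ never have to be located, since the
    denominator enters only through its value at one base point. That point must lie in the region
    considered, so for half planes and angles its existence takes a uniqueness argument. Finite
    order serves to make the Phragmen-Lindelof principle applicable. In case $\mathbf{\Pi}$ the
    angles around the strip may be as narrow as desired; in case $\mathbf{A_\gamma}$ the angle has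
    to contain the poles, and a convergence exponent below $1/\gamma$ is what an opening slightly
    larger than $\pi\gamma$ requires. *)

Definition ccont (f : C -> C) (z : C) : Prop :=
  forall eps, 0 < eps -> exists d, 0 < d /\
    forall w, Cmod (w - z) < d -> Cmod (f w - f z) < eps.

(* Caratheodory's form of complex differentiability: products, compositions and
   inverses then reduce to algebra and continuity. *)
Definition cdiff (f : C -> C) (z : C) : Prop :=
  exists phi, ccont phi z /\ exists d, 0 < d /\
    forall w, Cmod (w - z) < d -> f w = (f z + phi w * (w - z))%C.

Lemma exp_mono (x y : R) : x <= y -> exp x <= exp y.
Proof. intros [H|H]; [left; apply exp_increasing, H | right; rewrite H; reflexivity]. Qed.

Lemma Cmod_minus_sym (z w : C) : Cmod (z - w) = Cmod (w - z).
Proof. rewrite <- Cmod_opp. f_equal. ring. Qed.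

Lemma Cmod_triangle' (z w : C) : Cmod z - Cmod w <= Cmod (z - w).
Proof.
  assert (H := Cmod_triangle (z - w) w).
  replace (z - w + w)%C with z in H by ring. lra.
Qed.

Lemma Cmod_triangle_minus (x y z : C) : Cmod (x - z) <= Cmod (x - y) + Cmod (y - z).
Proof. replace (x - z)%C with ((x - y) + (y - z))%C by ring. apply Cmod_triangle. Qed.

Lemma Cmod_self (z : C) : Cmod (z - z) = 0.
Proof. replace (z - z)%C with (RtoC 0) by ring. apply Cmod_0. Qed.

Lemma Cmod_le_abs (x y : R) : Cmod (x, y) <= Rabs x + Rabs y.
Proof.
  replace ((x, y) : C) with (RtoC x + (0, y))%C by (apply injective_projections; simpl; ring).
  eapply Rle_trans; [apply Cmod_triangle|].
  rewrite Cmod_R. apply Rplus_le_compat_l.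
  unfold Cmod. simpl. replace (0 * (0 * 1) + y * (y * 1)) with (Rsqr y) by (unfold Rsqr; ring).
  rewrite sqrt_Rsqr_abs. lra.
Qed.

Lemma abs_fst_le (z : C) : Rabs (fst z) <= Cmod z.
Proof. eapply Rle_trans; [apply Rmax_l | apply (Rmax_Cmod z)]. Qed.

Lemma abs_snd_le (z : C) : Rabs (snd z) <= Cmod z.
Proof. eapply Rle_trans; [apply Rmax_r | apply (Rmax_Cmod z)]. Qed.

Lemma Cminus_neq0 (z w : C) : z <> w -> (z - w)%C <> 0.
Proof. intros H E. apply H. replace z with ((z - w) + w)%C by ring. rewrite E. ring. Qed.

Lemma ccont_const (c z : C) : ccont (fun _ => c) z.
Proof. intros e He. exists 1. split; [lra|]. intros w _. rewrite Cmod_self. exact He. Qed.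

Lemma ccont_id (z : C) : ccont (fun w => w) z.
Proof. intros e He. exists e. split; auto. Qed.

Lemma ccont_plus (f g : C -> C) (z : C) :
  ccont f z -> ccont g z -> ccont (fun w => f w + g w)%C z.
Proof.
  intros Hf Hg e He.
  destruct (Hf (e / 2)) as [d1 [Hd1 H1]]; [lra|].
  destruct (Hg (e / 2)) as [d2 [Hd2 H2]]; [lra|].
  exists (Rmin d1 d2). split; [apply Rmin_glb_lt; auto|]. intros w Hw.
  assert (Cmod (w - z) < d1) by (eapply Rlt_le_trans; [apply Hw | apply Rmin_l]).
  assert (Cmod (w - z) < d2) by (eapply Rlt_le_trans; [apply Hw | apply Rmin_r]).
  replace (f w + g w - (f z + g z))%C with ((f w - f z) + (g w - g z))%C by ring.
  eapply Rle_lt_trans; [apply Cmod_triangle|].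
  specialize (H1 w H). specialize (H2 w H0). lra.
Qed.

Lemma ccont_mult (f g : C -> C) (z : C) :
  ccont f z -> ccont g z -> ccont (fun w => f w * g w)%C z.
Proof.
  intros Hf Hg e He.
  set (A := Cmod (f z) + 1). set (B := Cmod (g z) + 1).
  assert (HA : 0 < A) by (unfold A; generalize (Cmod_ge_0 (f z)); lra).
  assert (HB : 0 < B) by (unfold B; generalize (Cmod_ge_0 (g z)); lra).
  destruct (Hf (Rmin 1 (e / (2 * B)))) as [d1 [Hd1 H1]].
  { apply Rmin_glb_lt; [lra|]. apply Rdiv_lt_0_compat; lra. }
  destruct (Hg (e / (2 * A))) as [d2 [Hd2 H2]].
  { apply Rdiv_lt_0_compat; lra. }
  exists (Rmin d1 d2). split; [apply Rmin_glb_lt; auto|]. intros w Hw.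
  destruct (Rmin_Rgt_l _ _ _ Hw) as [Hw1 Hw2].
  replace (f w * g w - f z * g z)%C with (f w * (g w - g z) + (f w - f z) * g z)%C by ring.
  eapply Rle_lt_trans; [apply Cmod_triangle|]. rewrite !Cmod_mult.
  specialize (H1 w Hw1). specialize (H2 w Hw2).
  assert (H3 := Rmin_l 1 (e / (2 * B))). assert (H4 := Rmin_r 1 (e / (2 * B))).
  assert (Hfw : Cmod (f w) <= A).
  { unfold A. generalize (Cmod_triangle' (f w) (f z)). lra. }
  assert (Cmod (f w) * Cmod (g w - g z) <= A * Cmod (g w - g z)).
  { apply Rmult_le_compat_r; [apply Cmod_ge_0 | exact Hfw]. }
  assert (A * Cmod (g w - g z) < A * (e / (2 * A))) by (apply Rmult_lt_compat_l; auto).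
  assert (Cmod (f w - f z) * Cmod (g z) <= (e / (2 * B)) * B).
  { apply Rmult_le_compat; try apply Cmod_ge_0; unfold B in *; lra. }
  replace (A * (e / (2 * A))) with (e / 2) in * by (field; lra).
  replace (e / (2 * B) * B) with (e / 2) in * by (field; lra). lra.
Qed.

Lemma ccont_comp (f g : C -> C) (z : C) :
  ccont g z -> ccont f (g z) -> ccont (fun w => f (g w)) z.
Proof.
  intros Hg Hf e He. destruct (Hf e He) as [d1 [Hd1 H1]].
  destruct (Hg d1 Hd1) as [d2 [Hd2 H2]]. exists d2. split; auto.
Qed.

Lemma ccont_ext_loc (f g : C -> C) (z : C) (d : R) : 0 < d ->
  (forall w, Cmod (w - z) < d -> f w = g w) -> ccont f z -> ccont g z.
Proof.
  intros Hd H Hf e He. destruct (Hf e He) as [d1 [Hd1 H1]].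
  exists (Rmin d d1). split; [apply Rmin_glb_lt; auto|]. intros w Hw.
  rewrite <- !H.
  - apply H1. eapply Rlt_le_trans; [apply Hw | apply Rmin_r].
  - rewrite Cmod_self. exact Hd.
  - eapply Rlt_le_trans; [apply Hw | apply Rmin_l].
Qed.

Lemma ccont_bounded_away (f : C -> C) (z : C) : ccont f z -> f z <> 0 ->
  exists d, 0 < d /\ forall w, Cmod (w - z) < d -> Cmod (f z) / 2 < Cmod (f w).
Proof.
  intros Hf H0. apply Cmod_gt_0 in H0.
  destruct (Hf (Cmod (f z) / 2)) as [d [Hd H]]; [lra|].
  exists d. split; [exact Hd|]. intros w Hw. specialize (H w Hw).
  rewrite Cmod_minus_sym in H. generalize (Cmod_triangle' (f z) (f w)). lra.
Qed.

Lemma ccont_Cinv (z : C) : z <> 0 -> ccont Cinv z.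
Proof.
  intros Hz e He.
  assert (H0 : 0 < Cmod z) by (apply Cmod_gt_0; exact Hz).
  exists (Rmin (Cmod z / 2) (e * (Cmod z * Cmod z) / 2)). split.
  { apply Rmin_glb_lt; [lra|]. apply Rdiv_lt_0_compat; [|lra].
    apply Rmult_lt_0_compat; [exact He|]. apply Rmult_lt_0_compat; exact H0. }
  intros w Hw.
  destruct (Rmin_Rgt_l _ _ _ Hw) as [Hw1 Hw2].
  assert (Hwz : Cmod z / 2 < Cmod w).
  { rewrite Cmod_minus_sym in Hw1. generalize (Cmod_triangle' z w). lra. }
  assert (Hw0 : w <> 0).
  { apply Cmod_gt_0. lra. }
  replace (/ w - / z)%C with ((z - w) / (w * z))%C by (field; auto).
  rewrite Cmod_div by (apply Cmult_neq_0; auto).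
  rewrite Cmod_mult, Cmod_minus_sym.
  apply (Rmult_lt_reg_r (Cmod w * Cmod z)); [nra|].
  replace (Cmod (w - z) / (Cmod w * Cmod z) * (Cmod w * Cmod z)) with (Cmod (w - z))
    by (field; lra).
  eapply Rlt_le_trans; [exact Hw2|].
  replace (e * (Cmod z * Cmod z) / 2) with (e * ((Cmod z / 2) * Cmod z)) by field.
  apply Rmult_le_compat_l; [lra|]. apply Rmult_le_compat_r; lra.
Qed.

Lemma cdiff_ccont (f : C -> C) (z : C) : cdiff f z -> ccont f z.
Proof.
  intros [phi [Hp [d [Hd H]]]].
  apply (ccont_ext_loc (fun w => f z + phi w * (w - z))%C f z d Hd).
  - intros w Hw. symmetry. apply H, Hw.
  - apply ccont_plus; [apply ccont_const|]. apply ccont_mult; [exact Hp|].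
    apply (ccont_plus (fun w => w) (fun _ => (- z)%C)); [apply ccont_id | apply ccont_const].
Qed.

Lemma cdiff_ext_loc (f g : C -> C) (z : C) (d : R) : 0 < d ->
  (forall w, Cmod (w - z) < d -> f w = g w) -> cdiff f z -> cdiff g z.
Proof.
  intros Hd H [phi [Hp [d1 [Hd1 H1]]]]. exists phi. split; [exact Hp|].
  exists (Rmin d d1). split; [apply Rmin_glb_lt; auto|]. intros w Hw.
  rewrite <- !H.
  - apply H1. eapply Rlt_le_trans; [apply Hw | apply Rmin_r].
  - rewrite Cmod_self. exact Hd.
  - eapply Rlt_le_trans; [apply Hw | apply Rmin_l].
Qed.

Lemma cdiff_ext (f g : C -> C) (z : C) : (forall w, f w = g w) -> cdiff f z -> cdiff g z.
Proof. intros H. apply (cdiff_ext_loc f g z 1); [lra|]. intros; apply H. Qed.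

Lemma cdiff_const (c z : C) : cdiff (fun _ => c) z.
Proof.
  exists (fun _ => RtoC 0). split; [apply ccont_const|]. exists 1. split; [lra|].
  intros w _. ring.
Qed.

Lemma cdiff_id (z : C) : cdiff (fun w => w) z.
Proof.
  exists (fun _ => RtoC 1). split; [apply ccont_const|]. exists 1. split; [lra|].
  intros w _. ring.
Qed.

Lemma cdiff_plus (f g : C -> C) (z : C) :
  cdiff f z -> cdiff g z -> cdiff (fun w => f w + g w)%C z.
Proof.
  intros [p [Hp [d1 [Hd1 H1]]]] [q [Hq [d2 [Hd2 H2]]]].
  exists (fun w => p w + q w)%C. split; [apply ccont_plus; auto|].
  exists (Rmin d1 d2). split; [apply Rmin_glb_lt; auto|]. intros w Hw.
  rewrite (H1 w), (H2 w). ring.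
  - eapply Rlt_le_trans; [apply Hw | apply Rmin_r].
  - eapply Rlt_le_trans; [apply Hw | apply Rmin_l].
Qed.

Lemma cdiff_mult (f g : C -> C) (z : C) :
  cdiff f z -> cdiff g z -> cdiff (fun w => f w * g w)%C z.
Proof.
  intros Hf Hg. assert (Hgc := cdiff_ccont g z Hg).
  destruct Hf as [p [Hp [d1 [Hd1 H1]]]]. destruct Hg as [q [Hq [d2 [Hd2 H2]]]].
  exists (fun w => p w * g w + f z * q w)%C. split.
  { apply ccont_plus; apply ccont_mult; auto. apply ccont_const. }
  exists (Rmin d1 d2). split; [apply Rmin_glb_lt; auto|]. intros w Hw.
  rewrite (H1 w). rewrite Cmult_plus_distr_r. rewrite (H2 w) at 1. ring.
  - eapply Rlt_le_trans; [apply Hw | apply Rmin_r].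
  - eapply Rlt_le_trans; [apply Hw | apply Rmin_l].
Qed.

Lemma cdiff_comp (f g : C -> C) (z : C) :
  cdiff g z -> cdiff f (g z) -> cdiff (fun w => f (g w)) z.
Proof.
  intros Hg Hf. assert (Hgc := cdiff_ccont g z Hg).
  destruct Hf as [p [Hp [d1 [Hd1 H1]]]]. destruct Hg as [q [Hq [d2 [Hd2 H2]]]].
  exists (fun w => p (g w) * q w)%C. split.
  { apply ccont_mult; auto. apply ccont_comp; auto. }
  destruct (Hgc d1 Hd1) as [d3 [Hd3 H3]].
  exists (Rmin d2 d3). split; [apply Rmin_glb_lt; auto|]. intros w Hw.
  rewrite (H1 (g w)). rewrite (H2 w) at 2. ring.
  - eapply Rlt_le_trans; [apply Hw | apply Rmin_l].
  - apply H3. eapply Rlt_le_trans; [apply Hw | apply Rmin_r].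
Qed.

Lemma cdiff_Cinv (z : C) : z <> 0 -> cdiff Cinv z.
Proof.
  intros Hz. exists (fun w => - (/ w * / z))%C. split.
  { apply (ccont_ext_loc (fun w => (- / z) * / w)%C _ z 1); [lra | intros; ring|].
    apply ccont_mult; [apply ccont_const | apply ccont_Cinv, Hz]. }
  destruct (ccont_bounded_away (fun w => w) z (ccont_id z) Hz) as [d [Hd H]].
  exists d. split; [exact Hd|]. intros w Hw. specialize (H w Hw).
  assert (w <> 0) by (apply Cmod_gt_0; generalize (Cmod_ge_0 z); lra).
  field. auto.
Qed.

Lemma cdiff_scal (c : C) (f : C -> C) (z : C) : cdiff f z -> cdiff (fun w => c * f w)%C z.
Proof. intros H. apply cdiff_mult; [apply cdiff_const | exact H]. Qed.

Lemma cdiff_minus (f g : C -> C) (z : C) :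
  cdiff f z -> cdiff g z -> cdiff (fun w => f w - g w)%C z.
Proof.
  intros Hf Hg. apply (cdiff_ext (fun w => f w + (- (1)) * g w)%C).
  - intros; ring.
  - apply cdiff_plus; [exact Hf | apply cdiff_scal, Hg].
Qed.

Lemma cdiff_div (f g : C -> C) (z : C) :
  cdiff f z -> cdiff g z -> g z <> 0 -> cdiff (fun w => f w / g w)%C z.
Proof.
  intros Hf Hg H0. apply cdiff_mult; [exact Hf|].
  apply (cdiff_comp Cinv g); [exact Hg | apply cdiff_Cinv, H0].
Qed.

Lemma cdiff_pow (f : C -> C) (n : nat) (z : C) : cdiff f z -> cdiff (fun w => f w ^ n)%C z.
Proof.
  intros H. induction n as [|n IH]; simpl; [apply cdiff_const | apply cdiff_mult; auto].
Qed.

Lemma cdiff_affine (c u z : C) : cdiff (fun w => c + u * w)%C z.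
Proof.
  apply cdiff_plus; [apply cdiff_const | apply cdiff_scal, cdiff_id].
Qed.

Lemma cdiff_of_eps (f : C -> C) (z l : C) :
  (forall eps, 0 < eps -> exists d, 0 < d /\ forall w, Cmod (w - z) < d ->
     Cmod (f w - f z - l * (w - z)) <= eps * Cmod (w - z)) -> cdiff f z.
Proof.
  intros H.
  (* The difference quotient, completed by [l] at [z], is the continuous factor. *)
  exists (fun w => if Ceq_dec w z then l else ((f w - f z) / (w - z))%C). split.
  - intros e He. destruct (H (e / 2)) as [d [Hd H']]; [lra|].
    exists d. split; [exact Hd|]. intros w Hw.
    destruct (Ceq_dec z z) as [_|]; [|congruence].
    destruct (Ceq_dec w z) as [E|E]; [rewrite Cmod_self; exact He|].
    assert (Hn := Cminus_neq0 w z E). assert (Hp := proj1 (Cmod_gt_0 _) Hn).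
    replace ((f w - f z) / (w - z) - l)%C with ((f w - f z - l * (w - z)) / (w - z))%C
      by (field; exact Hn).
    rewrite Cmod_div by exact Hn. apply (Rmult_lt_reg_r (Cmod (w - z))); [exact Hp|].
    unfold Rdiv. rewrite Rmult_assoc, Rinv_l by lra. specialize (H' w Hw). nra.
  - exists 1. split; [lra|]. intros w _. destruct (Ceq_dec w z) as [->|E]; [ring|].
    field. apply Cminus_neq0, E.
Qed.

Lemma cdiff_eps (f : C -> C) (z : C) : cdiff f z -> exists l,
  forall eps, 0 < eps -> exists d, 0 < d /\ forall w, Cmod (w - z) < d ->
     Cmod (f w - f z - l * (w - z)) <= eps * Cmod (w - z).
Proof.
  intros [p [Hp [d1 [Hd1 H1]]]]. exists (p z). intros e He.
  destruct (Hp e He) as [d2 [Hd2 H2]].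
  exists (Rmin d1 d2). split; [apply Rmin_glb_lt; auto|]. intros w Hw.
  rewrite H1 by (eapply Rlt_le_trans; [apply Hw | apply Rmin_l]).
  replace (f z + p w * (w - z) - f z - p z * (w - z))%C with ((p w - p z) * (w - z))%C by ring.
  rewrite Cmod_mult. apply Rmult_le_compat_r; [apply Cmod_ge_0|].
  left. apply H2. eapply Rlt_le_trans; [apply Hw | apply Rmin_r].
Qed.

Lemma cdiff_lipschitz (f : C -> C) (z : C) : cdiff f z ->
  exists L d, 0 < d /\ 0 <= L /\
    forall w, Cmod (w - z) < d -> Cmod (f w - f z) <= L * Cmod (w - z).
Proof.
  intros [p [Hp [d1 [Hd1 H1]]]]. destruct (Hp 1 Rlt_0_1) as [d2 [Hd2 H2]].
  exists (Cmod (p z) + 1), (Rmin d1 d2). split; [apply Rmin_glb_lt; auto|].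
  split; [generalize (Cmod_ge_0 (p z)); lra|]. intros w Hw.
  rewrite H1 by (eapply Rlt_le_trans; [apply Hw | apply Rmin_l]).
  replace (f z + p w * (w - z) - f z)%C with (p w * (w - z))%C by ring.
  rewrite Cmod_mult. apply Rmult_le_compat_r; [apply Cmod_ge_0|].
  assert (Cmod (p w - p z) < 1)
    by (apply H2; eapply Rlt_le_trans; [apply Hw | apply Rmin_r]).
  generalize (Cmod_triangle' (p w) (p z)). lra.
Qed.

(* Stands in for Riemann's removable singularity theorem: singularities are killed by
   multiplying with a sufficiently high power of a function vanishing there. *)
Lemma cdiff_flat (f : C -> C) (z : C) (X d : R) : 0 < d -> f z = 0 ->
  (forall w, Cmod (w - z) < d -> Cmod (f w) <= X * Cmod (w - z) ^ 2) -> cdiff f z.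
Proof.
  intros Hd H0 H. apply (cdiff_of_eps f z 0). intros e He.
  exists (Rmin d (e / (Rabs X + 1))). split.
  { apply Rmin_glb_lt; [exact Hd|]. apply Rdiv_lt_0_compat; [exact He|].
    generalize (Rabs_pos X); lra. }
  intros w Hw. rewrite H0.
  replace (f w - 0 - 0 * (w - z))%C with (f w) by ring.
  destruct (Rmin_Rgt_l _ _ _ Hw) as [Hw1 Hw2].
  eapply Rle_trans; [apply H, Hw1|].
  assert (Hx := Rabs_pos X). assert (Hx2 := Rle_abs X). assert (Hm := Cmod_ge_0 (w - z)).
  apply (Rmult_lt_compat_r (Rabs X + 1)) in Hw2; [|lra].
  unfold Rdiv in Hw2. rewrite Rmult_assoc, Rinv_l in Hw2 by lra.
  simpl. rewrite Rmult_1_r, <- Rmult_assoc. apply Rmult_le_compat_r; [exact Hm|]. nra.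
Qed.

(** * The complex exponential *)

Definition cexp (z : C) : C := (exp (fst z) * cos (snd z), exp (fst z) * sin (snd z)).

Definition cis (x : R) : C := (cos x, sin x).

Lemma cexp_plus (z w : C) : cexp (z + w)%C = (cexp z * cexp w)%C.
Proof.
  unfold cexp. apply injective_projections; simpl.
  - rewrite exp_plus, cos_plus. ring.
  - rewrite exp_plus, sin_plus. ring.
Qed.

Lemma Cmod_cis (x : R) : Cmod (cis x) = 1.
Proof.
  unfold Cmod, cis. simpl.
  replace (cos x * (cos x * 1) + sin x * (sin x * 1)) with 1.
  - apply sqrt_1.
  - generalize (sin2_cos2 x). unfold Rsqr. lra.
Qed.

Lemma cexp_cis (z : C) : cexp z = (exp (fst z) * cis (snd z))%C.
Proof. unfold cexp, cis. apply injective_projections; simpl; ring. Qed.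

Lemma Cmod_cexp (z : C) : Cmod (cexp z) = exp (fst z).
Proof.
  rewrite cexp_cis, Cmod_mult, Cmod_cis, Cmod_R, Rabs_pos_eq by (left; apply exp_pos). ring.
Qed.

Lemma cis_plus (x y : R) : cis (x + y) = (cis x * cis y)%C.
Proof.
  unfold cis. apply injective_projections; simpl; [apply cos_plus | rewrite sin_plus; ring].
Qed.

Lemma Cmod_scaled_cis (r x : R) : 0 <= r -> Cmod (r * cis x) = r.
Proof. intros H. rewrite Cmod_mult, Cmod_cis, Cmod_R, Rabs_pos_eq; lra. Qed.

Lemma cis_0 : cis 0 = 1.
Proof. unfold cis. rewrite cos_0, sin_0. reflexivity. Qed.

Lemma cis_period (x : R) : cis (x + 2 * PI) = cis x.
Proof. unfold cis. rewrite cos_plus, sin_plus, cos_2PI, sin_2PI. f_equal; ring. Qed.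

Lemma cis_PI : cis PI = (- (1))%C.
Proof. unfold cis. rewrite cos_PI, sin_PI. apply injective_projections; simpl; ring. Qed.

Lemma derivable_pt_lim_lin (f : R -> R) (x l : R) : derivable_pt_lim f x l ->
  forall e, 0 < e -> exists d, 0 < d /\ forall h, Rabs h < d ->
    Rabs (f (x + h) - f x - l * h) <= e * Rabs h.
Proof.
  intros H e He. destruct (H e He) as [d Hd]. exists d. split; [apply cond_pos|].
  intros h Hh. destruct (Req_dec h 0) as [->|Hn].
  - replace (x + 0) with x by ring. replace (f x - f x - l * 0) with 0 by ring.
    rewrite Rabs_R0. lra.
  - replace (f (x + h) - f x - l * h) with (((f (x + h) - f x) / h - l) * h) by (field; auto).
    rewrite Rabs_mult. apply Rmult_le_compat_r; [apply Rabs_pos|]. left. apply Hd; auto.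
Qed.

Lemma cexp_lin (e : R) : 0 < e -> exists d, 0 < d /\ forall w, Cmod w < d ->
  Cmod (cexp w - 1 - w) <= e * Cmod w.
Proof.
  (* The remainder is split into four products, bounded by 2, 1, 2 and 1 times [e' * m]; hence the
     6. *)
  intros He0. set (e' := Rmin (e / 6) 1).
  assert (He : 0 < e') by (apply Rmin_glb_lt; lra).
  assert (He6 : e' <= e / 6) by apply Rmin_l.
  assert (He1 : e' <= 1) by apply Rmin_r.
  destruct (derivable_pt_lim_lin exp 0 1 derivable_pt_lim_exp_0 e' He) as [d1 [Hd1 H1]].
  assert (Hs := derivable_pt_lim_sin 0). rewrite cos_0 in Hs.
  destruct (derivable_pt_lim_lin sin 0 1 Hs e' He) as [d2 [Hd2 H2]].
  assert (Hc := derivable_pt_lim_cos 0). rewrite sin_0, Ropp_0 in Hc.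
  destruct (derivable_pt_lim_lin cos 0 0 Hc e' He) as [d3 [Hd3 H3]].
  set (d := Rmin (Rmin d1 d2) (Rmin d3 (e' / 2))).
  exists d. split; [repeat apply Rmin_glb_lt; lra|].
  intros [x y] Hw.
  assert (Hx := abs_fst_le (x, y)). assert (Hy := abs_snd_le (x, y)). simpl in Hx, Hy.
  set (m := Cmod (x, y)) in *.
  assert (B1 : d <= d1) by (unfold d; eapply Rle_trans; [apply Rmin_l | apply Rmin_l]).
  assert (B2 : d <= d2) by (unfold d; eapply Rle_trans; [apply Rmin_l | apply Rmin_r]).
  assert (B3 : d <= d3) by (unfold d; eapply Rle_trans; [apply Rmin_r | apply Rmin_l]).
  assert (B4 : d <= e' / 2) by (unfold d; eapply Rle_trans; [apply Rmin_r | apply Rmin_r]).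
  specialize (H1 x ltac:(lra)). specialize (H2 y ltac:(lra)). specialize (H3 y ltac:(lra)).
  rewrite Rplus_0_l, exp_0 in H1. rewrite Rplus_0_l, sin_0 in H2. rewrite Rplus_0_l, cos_0 in H3.
  set (a := exp x - 1 - 1 * x) in *. set (b := sin y - 0 - 1 * y) in *.
  set (c := cos y - 1 - 0 * y) in *.
  replace (cexp (x, y) - 1 - (x, y))%C with
    ((exp x * c + a, exp x * b + (x + a) * y) : C).
  2:{ unfold cexp, a, b, c. apply injective_projections; simpl; ring. }
  eapply Rle_trans; [apply Cmod_le_abs|].
  assert (Ha : Rabs a <= e' * m) by (eapply Rle_trans; [apply H1|]; apply Rmult_le_compat_l; lra).
  assert (Hb : Rabs b <= e' * m) by (eapply Rle_trans; [apply H2|]; apply Rmult_le_compat_l; lra).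
  assert (Hcc : Rabs c <= e' * m) by (eapply Rle_trans; [apply H3|]; apply Rmult_le_compat_l; lra).
  assert (Hm := Cmod_ge_0 (x, y)). fold m in Hm.
  assert (Hex : 0 < exp x <= 2).
  { split; [apply exp_pos|]. unfold a in Ha. apply Rabs_le_between in Ha.
    apply Rabs_le_between in Hx. nra. }
  eapply Rle_trans; [apply Rplus_le_compat; apply Rabs_triang|].
  rewrite !Rabs_mult. rewrite (Rabs_pos_eq (exp x)) by lra.
  assert (exp x * Rabs c <= 2 * (e' * m)) by (apply Rmult_le_compat; try apply Rabs_pos; lra).
  assert (exp x * Rabs b <= 2 * (e' * m)) by (apply Rmult_le_compat; try apply Rabs_pos; lra).
  assert (Rabs (x + a) * Rabs y <= e' * m).
  { apply Rmult_le_compat; try apply Rabs_pos; [|lra].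
    eapply Rle_trans; [apply Rabs_triang|]. nra. }
  nra.
Qed.

Lemma cdiff_cexp (z : C) : cdiff cexp z.
Proof.
  apply (cdiff_of_eps cexp z (cexp z)). intros e He.
  assert (Hp := exp_pos (fst z)).
  destruct (cexp_lin (e / exp (fst z))) as [d [Hd H]]; [apply Rdiv_lt_0_compat; auto|].
  exists d. split; [exact Hd|]. intros w Hw.
  assert (E : cexp w = (cexp z * cexp (w - z))%C).
  { rewrite <- cexp_plus. f_equal. ring. }
  rewrite E.
  replace (cexp z * cexp (w - z) - cexp z - cexp z * (w - z))%C with
    (cexp z * (cexp (w - z) - 1 - (w - z)))%C by ring.
  rewrite Cmod_mult, Cmod_cexp.
  specialize (H _ Hw).
  apply (Rmult_le_compat_l (exp (fst z))) in H; [|lra].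
  replace (e * Cmod (w - z)) with (exp (fst z) * (e / exp (fst z) * Cmod (w - z)))
    by (field; lra). exact H.
Qed.

Lemma polar (z : C) : exists phi, - PI < phi <= PI /\ z = (Cmod z * cis phi)%C.
Proof.
  destruct (Ceq_dec z 0) as [->|Hz].
  { exists 0. split; [generalize PI_RGT_0; lra|]. rewrite Cmod_0. ring. }
  assert (Hm := proj1 (Cmod_gt_0 z) Hz).
  assert (Hx := abs_fst_le z).
  assert (Hm2 : fst z * fst z + snd z * snd z = Cmod z * Cmod z).
  { generalize (Cmod2_alt z). simpl. unfold Re, Im. lra. }
  set (c := fst z / Cmod z).
  assert (Hc : -1 <= c <= 1).
  { apply Rabs_le_between. unfold c, Rdiv. rewrite Rabs_mult, Rabs_inv, (Rabs_pos_eq (Cmod z)) by lra.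
    apply (Rmult_le_reg_r (Cmod z)); [exact Hm|]. rewrite Rmult_assoc, Rinv_l by lra. lra. }
  assert (Hs : Cmod z * sin (acos c) = Rabs (snd z)).
  { rewrite sin_acos by exact Hc. rewrite <- sqrt_Rsqr_abs.
    rewrite <- (sqrt_Rsqr (Cmod z)) at 1 by lra.
    rewrite <- sqrt_mult_alt by apply Rle_0_sqr. f_equal. unfold Rsqr, c.
    field_simplify; [|lra]. simpl. lra. }
  assert (Hcc : Cmod z * cos (acos c) = fst z).
  { rewrite cos_acos by exact Hc. unfold c. field. lra. }
  assert (Hb := acos_bound c).
  destruct (Rle_dec 0 (snd z)) as [Hy|Hy].
  - exists (acos c). split; [generalize PI_RGT_0; lra|].
    rewrite Rabs_pos_eq in Hs by exact Hy.
    unfold cis. apply injective_projections; simpl; lra.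
  - exists (- acos c). split.
    { split; [|generalize PI_RGT_0; lra].
      destruct (Req_dec (acos c) PI) as [E|]; [|lra].
      exfalso. rewrite E, sin_PI, Rabs_left in Hs by lra. lra. }
    rewrite Rabs_left in Hs by lra.
    unfold cis. rewrite cos_neg, sin_neg. apply injective_projections; simpl; lra.
Qed.

Lemma cis_dist2 (r s x y : R) :
  Cmod (r * cis x - s * cis y) ^ 2 = r * r + s * s - 2 * r * s * cos (x - y).
Proof.
  rewrite Cmod2_alt, cos_minus. unfold Re, Im, cis. simpl.
  generalize (sin2_cos2 x) (sin2_cos2 y). unfold Rsqr. intros.
  replace (cos x * cos x) with (1 - sin x * sin x) by lra. nra.
Qed.

(** * Goursat's theorem *)

Lemma continuous_eps (f : R -> R) (t : R) :
  continuous f t <->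
  forall e, 0 < e -> exists d, 0 < d /\ forall s, Rabs (s - t) < d -> Rabs (f s - f t) < e.
Proof.
  split.
  - intros H e He.
    destruct (proj1 (filterlim_locally f (f t)) H (mkposreal e He)) as [d Hd].
    exists d. split; [apply cond_pos|]. intros s Hs. apply (Hd s). exact Hs.
  - intros H. apply (proj2 (filterlim_locally f (f t))). intros e.
    destruct (H e (cond_pos e)) as [d [Hd H']]. exists (mkposreal d Hd). intros s Hs.
    apply (H' s). exact Hs.
Qed.

Lemma continuous_of_ccont (G : C -> C) (g h : R -> R) (t : R) :
  ccont G (g t, h t) -> continuous g t -> continuous h t ->
  forall e, 0 < e -> exists d, 0 < d /\ forall s, Rabs (s - t) < d ->
    Cmod (G (g s, h s) - G (g t, h t)) < e.
Proof.
  intros HG Hg Hh e He. destruct (HG e He) as [d [Hd H]].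
  destruct (proj1 (continuous_eps g t) Hg (d / 2)) as [d1 [Hd1 H1]]; [lra|].
  destruct (proj1 (continuous_eps h t) Hh (d / 2)) as [d2 [Hd2 H2]]; [lra|].
  exists (Rmin d1 d2). split; [apply Rmin_glb_lt; auto|]. intros s Hs. apply H.
  replace ((g s, h s) - (g t, h t))%C with ((g s - g t, h s - h t) : C)
    by (apply injective_projections; simpl; ring).
  eapply Rle_lt_trans; [apply Cmod_le_abs|].
  assert (Rabs (g s - g t) < d / 2)
    by (apply H1; eapply Rlt_le_trans; [apply Hs | apply Rmin_l]).
  assert (Rabs (h s - h t) < d / 2)
    by (apply H2; eapply Rlt_le_trans; [apply Hs | apply Rmin_r]).
  lra.
Qed.

Lemma continuous_fst_ccont (G : C -> C) (g h : R -> R) (t : R) :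
  ccont G (g t, h t) -> continuous g t -> continuous h t ->
  continuous (fun s => fst (G (g s, h s))) t.
Proof.
  intros HG Hg Hh. apply continuous_eps. intros e He.
  destruct (continuous_of_ccont G g h t HG Hg Hh e He) as [d [Hd H]].
  exists d. split; [exact Hd|]. intros s Hs.
  eapply Rle_lt_trans; [|apply (H s Hs)]. apply (abs_fst_le (G (g s, h s) - G (g t, h t))).
Qed.

Lemma continuous_snd_ccont (G : C -> C) (g h : R -> R) (t : R) :
  ccont G (g t, h t) -> continuous g t -> continuous h t ->
  continuous (fun s => snd (G (g s, h s))) t.
Proof.
  intros HG Hg Hh. apply continuous_eps. intros e He.
  destruct (continuous_of_ccont G g h t HG Hg Hh e He) as [d [Hd H]].
  exists d. split; [exact Hd|]. intros s Hs.
  eapply Rle_lt_trans; [|apply (H s Hs)]. apply (abs_snd_le (G (g s, h s) - G (g t, h t))).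
Qed.

(** Bisection in one form for two uses, Goursat's theorem and the existence of maxima: if the whole
    rectangle failed, some quarter would fail at each stage, and the nested failing quarters shrink
    to a point where the local hypothesis applies. *)
Lemma bisection_2d (P : R -> R -> R -> R -> Prop) (x1 x2 y1 y2 : R) :
  x1 <= x2 -> y1 <= y2 ->
  (forall a b c d, x1 <= a <= b -> b <= x2 -> y1 <= c <= d -> d <= y2 ->
     P a ((a + b) / 2) c ((c + d) / 2) -> P ((a + b) / 2) b c ((c + d) / 2) ->
     P a ((a + b) / 2) ((c + d) / 2) d -> P ((a + b) / 2) b ((c + d) / 2) d ->
     P a b c d) ->
  (forall p q, x1 <= p <= x2 -> y1 <= q <= y2 -> exists delta, 0 < delta /\
     forall a b c d, x1 <= a <= p -> p <= b <= x2 -> y1 <= c <= q -> q <= d <= y2 ->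
       b - a < delta -> d - c < delta -> P a b c d) ->
  P x1 x2 y1 y2.
Proof.
  intros Hx Hy Hsub Hloc. apply NNPP. intros Hbad.
  set (bad := fun s : (R * R) * (R * R) =>
    let a := fst (fst s) in let b := snd (fst s) in
    let c := fst (snd s) in let d := snd (snd s) in
    (x1 <= a <= b /\ b <= x2 /\ y1 <= c <= d /\ d <= y2) /\ ~ P a b c d).
  set (quarter := fun s s' : (R * R) * (R * R) =>
    fst (fst s) <= fst (fst s') /\ snd (fst s') <= snd (fst s) /\
    snd (fst s') - fst (fst s') = (snd (fst s) - fst (fst s)) / 2 /\
    fst (snd s) <= fst (snd s') /\ snd (snd s') <= snd (snd s) /\
    snd (snd s') - fst (snd s') = (snd (snd s) - fst (snd s)) / 2).
  assert (Hstep : forall s : {s | bad s}, exists s' : {s | bad s},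
    quarter (proj1_sig s) (proj1_sig s')).
  { intros [[[a b] [c d]] [Hb Hn]]. unfold quarter. simpl in *.
    assert (Hcases : ~ P a ((a + b) / 2) c ((c + d) / 2) \/ ~ P ((a + b) / 2) b c ((c + d) / 2) \/
      ~ P a ((a + b) / 2) ((c + d) / 2) d \/ ~ P ((a + b) / 2) b ((c + d) / 2) d).
    { apply NNPP. intros Hno. apply Hn. apply Hsub; try tauto. }
    destruct Hcases as [H|[H|[H|H]]].
    - unshelve eexists (exist _ ((a, (a + b) / 2), (c, (c + d) / 2)) _);
        [unfold bad|]; simpl; repeat split; solve [lra | exact H].
    - unshelve eexists (exist _ (((a + b) / 2, b), (c, (c + d) / 2)) _);
        [unfold bad|]; simpl; repeat split; solve [lra | exact H].
    - unshelve eexists (exist _ ((a, (a + b) / 2), ((c + d) / 2, d)) _);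
        [unfold bad|]; simpl; repeat split; solve [lra | exact H].
    - unshelve eexists (exist _ (((a + b) / 2, b), ((c + d) / 2, d)) _);
        [unfold bad|]; simpl; repeat split; solve [lra | exact H]. }
  set (step := fun s => proj1_sig (constructive_indefinite_description _ (Hstep s))).
  assert (Hst : forall s, quarter (proj1_sig s) (proj1_sig (step s))).
  { intros s. apply (proj2_sig (constructive_indefinite_description _ (Hstep s))). }
  assert (H0 : bad ((x1, x2), (y1, y2))) by (unfold bad; simpl; repeat split; (lra || exact Hbad)).
  set (u := fun n => Nat.iter n step (exist _ _ H0)).
  set (a := fun n => fst (fst (proj1_sig (u n)))). set (b := fun n => snd (fst (proj1_sig (u n)))).
  set (c := fun n => fst (snd (proj1_sig (u n)))). set (d := fun n => snd (snd (proj1_sig (u n)))).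
  assert (Hq : forall n, a n <= a (S n) /\ b (S n) <= b n /\ b (S n) - a (S n) = (b n - a n) / 2 /\
     c n <= c (S n) /\ d (S n) <= d n /\ d (S n) - c (S n) = (d n - c n) / 2).
  { intros n. exact (Hst (u n)). }
  assert (Hb : forall n, (x1 <= a n <= b n /\ b n <= x2 /\ y1 <= c n <= d n /\ d n <= y2) /\
     ~ P (a n) (b n) (c n) (d n)).
  { intros n. exact (proj2_sig (u n)). }
  assert (Hmono : forall n k, a n <= a (n + k)%nat /\ b (n + k)%nat <= b n /\
     c n <= c (n + k)%nat /\ d (n + k)%nat <= d n).
  { intros n k. induction k as [|k IH].
    - rewrite Nat.add_0_r. lra.
    - rewrite Nat.add_succ_r. specialize (Hq (n + k)%nat). lra. }
  assert (Hw : forall n, b n - a n = (x2 - x1) / 2 ^ n /\ d n - c n = (y2 - y1) / 2 ^ n).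
  { induction n as [|n IH].
    - unfold a, b, c, d. simpl. lra.
    - specialize (Hq n). assert (0 < 2 ^ n) by (apply pow_lt; lra). simpl.
      destruct IH as [I1 I2]. destruct Hq as (_ & _ & Q1 & _ & _ & Q2).
      rewrite Q1, Q2, I1, I2. split; field; lra. }
  assert (Hlim : forall f g : nat -> R, (forall n, f n <= g n) ->
    (forall n k, f n <= f (n + k)%nat /\ g (n + k)%nat <= g n) ->
    exists p, forall n, f n <= p <= g n).
  { intros f g Hfg Hm.
    assert (Hfg2 : forall n m, f n <= g m).
    { intros n m. destruct (Hm n m) as [K1 _]. destruct (Hm m n) as [_ K2].
      rewrite Nat.add_comm in K2. specialize (Hfg (n + m)%nat). lra. }
    destruct (completeness (fun r => exists n, r = f n)) as [p [Hp1 Hp2]].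
    - exists (g O). intros r [n ->]. apply Hfg2.
    - exists (f O). exists O. reflexivity.
    - exists p. intros n. split.
      + apply Hp1. exists n. reflexivity.
      + apply Hp2. intros r [m ->]. apply Hfg2. }
  destruct (Hlim a b) as [p Hp].
  { intros n. specialize (Hb n). lra. }
  { intros n k. specialize (Hmono n k). lra. }
  destruct (Hlim c d) as [q Hqq].
  { intros n. specialize (Hb n). lra. }
  { intros n k. specialize (Hmono n k). lra. }
  assert (P0 : x1 <= p <= x2) by (specialize (Hp O); specialize (Hb O); lra).
  assert (Q0 : y1 <= q <= y2) by (specialize (Hqq O); specialize (Hb O); lra).
  destruct (Hloc p q P0 Q0) as [delta [Hd H]].
  destruct (pow_lt_1_zero (/ 2) ltac:(rewrite Rabs_pos_eq; lra)
    (delta / (x2 - x1 + (y2 - y1) + 1))) as [n Hn].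
  { apply Rdiv_lt_0_compat; lra. }
  specialize (Hn n (le_n n)). rewrite pow_inv in Hn.
  assert (H2 : 0 < / 2 ^ n) by (apply Rinv_0_lt_compat, pow_lt; lra).
  rewrite Rabs_pos_eq in Hn by lra.
  apply (Rmult_lt_compat_r (x2 - x1 + (y2 - y1) + 1)) in Hn; [|lra].
  unfold Rdiv in Hn. rewrite (Rmult_assoc delta), Rinv_l in Hn by lra.
  destruct (Hb n) as [Hbn Hno]. apply Hno. specialize (Hp n). specialize (Hqq n).
  specialize (Hw n). unfold Rdiv in Hw.
  assert (0 <= (x2 - x1) * / 2 ^ n) by (apply Rmult_le_pos; lra).
  assert (0 <= (y2 - y1) * / 2 ^ n) by (apply Rmult_le_pos; lra).
  apply H; try lra; nra.
Qed.

(* [- Re] of the integral of [G dz] along the boundary of a rectangle. *)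
Definition rect_int (G : C -> C) (x1 x2 y1 y2 : R) : R :=
  RInt (fun x => fst (G (x, y2)) - fst (G (x, y1))) x1 x2 +
  RInt (fun y => snd (G (x2, y)) - snd (G (x1, y))) y1 y2.

Lemma RInt_const_R (a b c : R) : RInt (fun _ => c) a b = (b - a) * c.
Proof. apply (RInt_const a b c). Qed.

Lemma ex_RInt_cont (f : R -> R) (a b : R) : a <= b ->
  (forall x, a <= x <= b -> continuous f x) -> ex_RInt f a b.
Proof.
  intros Hab Hc. apply (ex_RInt_continuous (V := R_CompleteNormedModule)).
  rewrite Rmin_left, Rmax_right by exact Hab. exact Hc.
Qed.

Lemma RInt_abs_le_const (f : R -> R) (a b m : R) : a <= b ->
  (forall x, a <= x <= b -> continuous f x) ->
  (forall x, a <= x <= b -> Rabs (f x) <= m) -> Rabs (RInt f a b) <= (b - a) * m.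
Proof.
  intros Hab Hc Hm.
  apply (abs_RInt_le_const f a b m Hab (ex_RInt_cont f a b Hab Hc) Hm).
Qed.

Lemma RInt_near_const (f : R -> R) (a b k m : R) : a <= b ->
  (forall x, a <= x <= b -> continuous f x) ->
  (forall x, a <= x <= b -> Rabs (f x - k) <= m) ->
  Rabs (RInt f a b - (b - a) * k) <= (b - a) * m.
Proof.
  intros Hab Hc Hm.
  replace (RInt f a b - (b - a) * k) with (RInt (fun x => f x - k) a b).
  - apply RInt_abs_le_const; auto. intros x Hx.
    apply (continuous_minus f (fun _ => k)); [apply Hc, Hx | apply continuous_const].
  - rewrite (RInt_minus f (fun _ => k)).
    + rewrite RInt_const_R. reflexivity.
    + apply ex_RInt_cont; assumption.
    + apply ex_RInt_const.
Qed.

Section Goursat.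
Variables (G : C -> C) (x1 x2 y1 y2 : R).
Hypothesis HG : forall x y, x1 <= x <= x2 -> y1 <= y <= y2 -> cdiff G (x, y).

Lemma rect_cont_u (x y : R) : x1 <= x <= x2 -> y1 <= y <= y2 ->
  continuous (fun s => fst (G (s, y))) x.
Proof.
  intros Hx Hy. apply (continuous_fst_ccont G (fun s => s) (fun _ => y)).
  - apply cdiff_ccont, HG; auto.
  - apply continuous_id.
  - apply continuous_const.
Qed.

Lemma rect_cont_v (x y : R) : x1 <= x <= x2 -> y1 <= y <= y2 ->
  continuous (fun s => snd (G (x, s))) y.
Proof.
  intros Hx Hy. apply (continuous_snd_ccont G (fun _ => x) (fun s => s)).
  - apply cdiff_ccont, HG; auto.
  - apply continuous_const.
  - apply continuous_id.
Qed.

Lemma rect_int_alt (a b c d : R) : x1 <= a <= b -> b <= x2 -> y1 <= c <= d -> d <= y2 ->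
  rect_int G a b c d =
  RInt (fun x => fst (G (x, d))) a b - RInt (fun x => fst (G (x, c))) a b +
  (RInt (fun y => snd (G (b, y))) c d - RInt (fun y => snd (G (a, y))) c d).
Proof.
  intros Ha Hb Hc Hd. unfold rect_int.
  rewrite (RInt_minus (fun x => fst (G (x, d))) (fun x => fst (G (x, c)))).
  rewrite (RInt_minus (fun y => snd (G (b, y))) (fun y => snd (G (a, y)))).
  reflexivity.
  all: apply ex_RInt_cont; [lra|]; intros z Hz; (apply rect_cont_u || apply rect_cont_v); lra.
Qed.

(** The affine part of [G] at [(p, q)] contributes $-\mathrm{Im}\,l\,(d-c)(b-a)$ through the
    horizontal sides and the opposite amount through the vertical ones. What remains is at most
    [e * s] at each boundary point, where [s] bounds the diameter. *)
Lemma goursat_local (e p q : R) : 0 < e -> x1 <= p <= x2 -> y1 <= q <= y2 ->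
  exists delta, 0 < delta /\
  forall a b c d, x1 <= a <= p -> p <= b <= x2 -> y1 <= c <= q -> q <= d <= y2 ->
    b - a < delta -> d - c < delta ->
    Rabs (rect_int G a b c d) <= 2 * e * (b - a + (d - c)) ^ 2.
Proof.
  intros He Hp Hq. destruct (cdiff_eps G (p, q) (HG p q Hp Hq)) as [l Hl].
  destruct (Hl e He) as [dl [Hdl H]]. exists (dl / 2). split; [lra|].
  intros a b c d Ha Hb Hc Hd Hab Hcd.
  set (s := b - a + (d - c)).
  assert (Hs : forall x y, a <= x <= b -> c <= y <= d ->
    Rabs (fst (G (x, y)) - fst (G (p, q)) - (fst l * (x - p) - snd l * (y - q))) <= e * s /\
    Rabs (snd (G (x, y)) - snd (G (p, q)) - (snd l * (x - p) + fst l * (y - q))) <= e * s).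
  { intros x y Hx Hy.
    assert (Hn : Cmod ((x, y) - (p, q)) <= s).
    { replace ((x, y) - (p, q))%C with ((x - p, y - q) : C)
        by (apply injective_projections; simpl; ring).
      eapply Rle_trans; [apply Cmod_le_abs|]. unfold s.
      apply Rplus_le_compat; apply Rabs_le; lra. }
    assert (Hn' : Cmod ((x, y) - (p, q)) < dl) by (unfold s in Hn; lra).
    specialize (H (x, y) Hn').
    assert (Hm : Cmod (G (x, y) - G (p, q) - l * ((x, y) - (p, q))) <= e * s).
    { eapply Rle_trans; [apply H|]. apply Rmult_le_compat_l; lra. }
    split; eapply Rle_trans; try apply Hm.
    - eapply Rle_trans; [|apply abs_fst_le]. right. apply f_equal. simpl. ring.
    - eapply Rle_trans; [|apply abs_snd_le]. right. apply f_equal. simpl. ring. }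
  unfold rect_int.
  assert (I1 := RInt_near_const (fun x => fst (G (x, d)) - fst (G (x, c))) a b
    (- snd l * (d - c)) (2 * (e * s)) ltac:(lra)).
  assert (I2 := RInt_near_const (fun y => snd (G (b, y)) - snd (G (a, y))) c d
    (snd l * (b - a)) (2 * (e * s)) ltac:(lra)).
  match type of I1 with ?A -> ?B -> _ => assert (A1 : A); [|assert (B1 : B); [|specialize (I1 A1 B1)]] end.
  { intros x Hx. apply (continuous_minus (fun x => fst (G (x, d))) (fun x => fst (G (x, c))));
      apply rect_cont_u; lra. }
  { intros x Hx. destruct (Hs x d Hx ltac:(lra)) as [K1 _]. destruct (Hs x c Hx ltac:(lra)) as [K2 _].
    apply Rabs_le_between in K1. apply Rabs_le_between in K2. apply Rabs_le. lra. }
  match type of I2 with ?A -> ?B -> _ => assert (A2 : A); [|assert (B2 : B); [|specialize (I2 A2 B2)]] end.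
  { intros y Hy. apply (continuous_minus (fun y => snd (G (b, y))) (fun y => snd (G (a, y))));
      apply rect_cont_v; lra. }
  { intros y Hy. destruct (Hs b y ltac:(lra) Hy) as [_ K1]. destruct (Hs a y ltac:(lra) Hy) as [_ K2].
    apply Rabs_le_between in K1. apply Rabs_le_between in K2. apply Rabs_le. lra. }
  apply Rabs_le_between in I1. apply Rabs_le_between in I2. apply Rabs_le.
  replace (2 * e * s ^ 2) with ((b - a) * (2 * (e * s)) + (d - c) * (2 * (e * s)))
    by (unfold s; ring).
  lra.
Qed.

(** The bound of [goursat_local] is stable under quartering: the four boundary integrals add up, and
    each quarter has half the side lengths, so that four times a quarter of the square results. It
    therefore holds for the whole rectangle with every [e]. *)
Lemma goursat : x1 <= x2 -> y1 <= y2 -> rect_int G x1 x2 y1 y2 = 0.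
Proof.
  intros Hx Hy.
  assert (H : forall e, 0 < e ->
    Rabs (rect_int G x1 x2 y1 y2) <= 2 * e * (x2 - x1 + (y2 - y1)) ^ 2).
  { intros e He.
    apply (bisection_2d (fun a b c d =>
      Rabs (rect_int G a b c d) <= 2 * e * (b - a + (d - c)) ^ 2)); auto.
    - intros a b c d Ha Hb Hc Hd H1 H2 H3 H4.
      set (m := (a + b) / 2) in *. set (n := (c + d) / 2) in *.
      assert (Hm : m - a = (b - a) / 2 /\ b - m = (b - a) / 2 /\ n - c = (d - c) / 2 /\
        d - n = (d - c) / 2) by (unfold m, n; lra).
      assert (E : rect_int G a b c d = rect_int G a m c n + rect_int G m b c n +
        rect_int G a m n d + rect_int G m b n d).
      { rewrite !rect_int_alt by lra.
        assert (CU : forall y, y1 <= y <= y2 -> RInt (fun x => fst (G (x, y))) a b =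
          RInt (fun x => fst (G (x, y))) a m + RInt (fun x => fst (G (x, y))) m b).
        { intros y Hyy. symmetry.
          apply (RInt_Chasles (fun x => fst (G (x, y)))); apply ex_RInt_cont; try lra;
            intros z Hz; apply rect_cont_u; lra. }
        assert (CV : forall x, x1 <= x <= x2 -> RInt (fun y => snd (G (x, y))) c d =
          RInt (fun y => snd (G (x, y))) c n + RInt (fun y => snd (G (x, y))) n d).
        { intros x Hxx. symmetry.
          apply (RInt_Chasles (fun y => snd (G (x, y)))); apply ex_RInt_cont; try lra;
            intros z Hz; apply rect_cont_v; lra. }
        rewrite (CU d), (CU c), (CV a), (CV b) by lra. ring. }
      rewrite E. destruct Hm as (M1 & M2 & M3 & M4).
      rewrite M1, M3 in H1. rewrite M2, M3 in H2. rewrite M1, M4 in H3. rewrite M2, M4 in H4.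
      replace (2 * e * (b - a + (d - c)) ^ 2) with
        (4 * (2 * e * ((b - a) / 2 + (d - c) / 2) ^ 2)) by field.
      apply Rabs_le_between in H1. apply Rabs_le_between in H2.
      apply Rabs_le_between in H3. apply Rabs_le_between in H4. apply Rabs_le. lra.
    - intros p q Hp Hq. apply goursat_local; auto. }
  apply NNPP. intros Hn.
  assert (Hp := Rabs_pos_lt _ Hn).
  set (K := (x2 - x1 + (y2 - y1)) ^ 2) in *. set (r := Rabs (rect_int G x1 x2 y1 y2)) in *.
  assert (HK : 0 <= K) by (unfold K; apply pow2_ge_0).
  specialize (H (r / (4 * (K + 1)))).
  assert (He : 0 < r / (4 * (K + 1))) by (apply Rdiv_lt_0_compat; lra).
  specialize (H He).
  replace (2 * (r / (4 * (K + 1))) * K) with (r * (K / (K + 1)) / 2) in H by (field; lra).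
  assert (K / (K + 1) <= 1).
  { apply (Rmult_le_reg_r (K + 1)); [lra|]. unfold Rdiv. rewrite Rmult_assoc, Rinv_l by lra. lra. }
  nra.
Qed.
End Goursat.

(* The maximum principle at the centre of the disc: by Goursat's theorem for
   [f o exp], the mean of [Im f] over the circles about [0] does not depend on the radius. *)
Lemma center_bound (f : C -> C) (B : R) :
  (forall z, Cmod z <= 1 -> cdiff f z) ->
  (forall z, Cmod z = 1 -> Cmod (f z) <= B) -> Cmod (f 0) <= B.
Proof.
  intros Hf HB. apply le_epsilon. intros e He.
  destruct (Ceq_dec (f 0) 0) as [E0|E0].
  { rewrite E0, Cmod_0. generalize (HB 1 Cmod_1) (Cmod_ge_0 (f 1)). lra. }
  assert (Hm := proj1 (Cmod_gt_0 _) E0).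
  (* A rotation that makes the value at 0 purely imaginary, because the vertical sides in [rect_int]
     carry the imaginary part. *)
  set (k := (Ci * Cmod (f 0) / f 0)%C).
  assert (Hk : Cmod k = 1).
  { unfold k. rewrite Cmod_div, Cmod_mult, Cmod_Ci, Cmod_R, Rabs_pos_eq by (auto; lra).
    field. lra. }
  assert (Hkf : snd (k * f 0)%C = Cmod (f 0)).
  { unfold k. replace (Ci * Cmod (f 0) / f 0 * f 0)%C with (Ci * Cmod (f 0))%C by (field; auto).
    simpl. ring. }
  destruct (cdiff_ccont f 0 (Hf 0 ltac:(rewrite Cmod_0; lra)) e He) as [d [Hd H]].
  (* The left edge of the rectangle: [cexp] maps it to a circle of radius less than [d], on which
     [f] differs from [f 0] by less than [e]. *)
  set (x1 := Rmin (ln (d / 2)) 0).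
  assert (Hx1 : x1 <= 0) by apply Rmin_r.
  assert (Hx1d : exp x1 < d).
  { apply Rle_lt_trans with (exp (ln (d / 2))).
    - apply exp_mono, Rmin_l.
    - rewrite exp_ln; lra. }
  set (G := fun z : C => (k * f (cexp z))%C).
  assert (HG : forall x y, x1 <= x <= 0 -> - PI <= y <= PI -> cdiff G (x, y)).
  { intros x y Hx Hy. unfold G. apply cdiff_scal. apply (cdiff_comp f cexp).
    - apply cdiff_cexp.
    - apply Hf. rewrite Cmod_cexp. simpl. rewrite <- exp_0.
      apply exp_mono, Hx. }
  assert (Hpi := PI_RGT_0).
  assert (Hgo := goursat G x1 0 (- PI) PI HG Hx1 ltac:(lra)).
  rewrite (rect_int_alt G x1 0 (- PI) PI HG) in Hgo by lra.
  (* The horizontal sides cancel by periodicity of the exponential, which leaves the two circle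
     means. *)
  assert (Eper : RInt (fun x => fst (G (x, PI))) x1 0 = RInt (fun x => fst (G (x, - PI))) x1 0).
  { apply RInt_ext. intros x _. f_equal. unfold G. do 2 f_equal. unfold cexp. simpl.
    rewrite cos_neg, sin_neg, sin_PI. f_equal. ring. }
  rewrite Eper in Hgo.
  assert (Hex : forall x, x1 <= x <= 0 -> ex_RInt (fun y => snd (G (x, y))) (- PI) PI).
  { intros x Hx. apply ex_RInt_cont; [lra|]. intros z Hz. apply (rect_cont_v G x1 0 (- PI) PI HG); lra. }
  assert (I1 : RInt (fun y => snd (G (0, y))) (- PI) PI <= RInt (fun _ => B) (- PI) PI).
  { apply RInt_le; try lra; [apply Hex; lra | apply ex_RInt_const|].
    intros y Hy. eapply Rle_trans; [apply Rle_abs|]. eapply Rle_trans; [apply abs_snd_le|].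
    unfold G. rewrite Cmod_mult, Hk, Rmult_1_l. apply HB. rewrite Cmod_cexp. simpl. apply exp_0. }
  assert (I2 : RInt (fun _ => Cmod (f 0) - e) (- PI) PI <= RInt (fun y => snd (G (x1, y))) (- PI) PI).
  { apply RInt_le; try lra; [apply ex_RInt_const | apply Hex; lra |].
    intros y Hy. rewrite <- Hkf.
    assert (Hdist : Cmod (f (cexp (x1, y)) - f 0) < e).
    { apply H. replace (cexp (x1, y) - 0)%C with (cexp (x1, y)) by ring.
      rewrite Cmod_cexp. exact Hx1d. }
    assert (K : Rabs (snd (G (x1, y) - k * f 0)%C) <= e).
    { eapply Rle_trans; [apply abs_snd_le|]. unfold G.
      replace (k * f (cexp (x1, y)) - k * f 0)%C with (k * (f (cexp (x1, y)) - f 0))%C by ring.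
      rewrite Cmod_mult, Hk. lra. }
    apply Rabs_le_between in K.
    replace (snd (G (x1, y) - k * f 0)%C) with (snd (G (x1, y)) - snd (k * f 0)%C) in K
      by (simpl; ring). lra. }
  rewrite RInt_const_R in I1, I2.
  nra.
Qed.

(** * Jensen's inequality *)

Fixpoint Cprod (n : nat) (f : nat -> C) : C :=
  match n with O => 1 | S n => (Cprod n f * f n)%C end.

Fixpoint Rprod (n : nat) (f : nat -> R) : R :=
  match n with O => 1 | S n => Rprod n f * f n end.

Lemma Cmod_Cprod (n : nat) (f : nat -> C) : Cmod (Cprod n f) = Rprod n (fun j => Cmod (f j)).
Proof. induction n as [|n IH]; simpl; [apply Cmod_1 | rewrite Cmod_mult, IH; reflexivity]. Qed.

Lemma Rprod_le (n : nat) (f g : nat -> R) :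
  (forall j, (j < n)%nat -> 0 <= f j <= g j) -> 0 <= Rprod n f <= Rprod n g.
Proof.
  induction n as [|n IH]; simpl; intros H; [lra|].
  assert (H1 := IH ltac:(intros; apply H; lia)). assert (H2 := H n ltac:(lia)).
  split; [apply Rmult_le_pos; lra | apply Rmult_le_compat; lra].
Qed.

Lemma Rprod_ext (n : nat) (f g : nat -> R) : (forall j, f j = g j) -> Rprod n f = Rprod n g.
Proof. intros H. induction n as [|n IH]; simpl; [reflexivity | rewrite IH, H; reflexivity]. Qed.

Lemma Rprod_const (n : nat) (c : R) : Rprod n (fun _ => c) = c ^ n.
Proof. induction n as [|n IH]; simpl; [reflexivity | rewrite IH; ring]. Qed.

Lemma Rprod_one_small (n : nat) (f : nat -> R) (M m : R) (i : nat) : 0 <= m ->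
  (forall j, (j < S n)%nat -> 0 <= f j <= M) -> (i < S n)%nat -> f i <= m ->
  Rprod (S n) f <= M ^ n * m.
Proof.
  intros Hm. induction n as [|n IH]; intros H Hi Hfi.
  - replace i with O in Hfi by lia. simpl. lra.
  - assert (H0 := H (S n) ltac:(lia)).
    change (Rprod (S n) f * f (S n) <= M ^ S n * m).
    assert (HM : 0 <= M ^ n) by (apply pow_le; lra).
    destruct (Nat.eq_dec i (S n)) as [->|Hne].
    + assert (Hp := Rprod_le (S n) f (fun _ => M) ltac:(intros; apply H; lia)).
      rewrite Rprod_const in Hp. apply Rmult_le_compat; lra.
    + assert (Hp := IH ltac:(intros; apply H; lia) ltac:(lia) Hfi).
      assert (Hp0 := Rprod_le (S n) f (fun _ => M) ltac:(intros; apply H; lia)).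
      replace (M ^ S n * m) with ((M ^ n * m) * M) by (simpl; ring).
      apply Rmult_le_compat; lra.
Qed.

Lemma cdiff_Cprod (n : nat) (f : nat -> C -> C) (z : C) :
  (forall j, (j < n)%nat -> cdiff (f j) z) -> cdiff (fun w => Cprod n (fun j => f j w)) z.
Proof.
  induction n as [|n IH]; simpl; intros H; [apply cdiff_const|].
  apply cdiff_mult; [apply IH; intros; apply H; lia | apply H; lia].
Qed.

Lemma cdiff_rotate (f : C -> C) (c z : C) : cdiff f (c * z)%C -> cdiff (fun w => f (c * w)%C) z.
Proof. intros H. apply (cdiff_comp f (fun w => c * w)%C); [apply cdiff_scal, cdiff_id | exact H]. Qed.

(* Apply the maximum principle to the product of the [N] rotations of [f]. *)
Lemma geometric_mean_bound (f : C -> C) (N : nat) (B : R) :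
  (forall z, Cmod z <= 1 -> cdiff f z) ->
  (forall x, - PI < x <= PI ->
     Rprod N (fun j => Cmod (f (cis (x + 2 * PI * INR j / INR N)))) <= B) ->
  Cmod (f 0) ^ N <= B.
Proof.
  intros Hf HB.
  assert (H := center_bound (fun z => Cprod N (fun j => f (cis (2 * PI * INR j / INR N) * z)%C)) B).
  assert (E : Cmod (Cprod N (fun j => f (cis (2 * PI * INR j / INR N) * 0)%C)) = Cmod (f 0) ^ N).
  { rewrite Cmod_Cprod, <- Rprod_const. apply Rprod_ext. intros j. do 2 f_equal. ring. }
  rewrite <- E. apply H.
  - intros z Hz. apply (cdiff_Cprod N (fun j w => f (cis (2 * PI * INR j / INR N) * w)%C)).
    intros j _. apply cdiff_rotate, Hf. rewrite Cmod_mult, Cmod_cis. lra.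
  - intros z Hz. destruct (polar z) as [x [Hx Ez]]. rewrite Hz in Ez.
    rewrite Cmod_Cprod. eapply Rle_trans; [|apply (HB x Hx)]. right.
    apply Rprod_ext. intros j. rewrite Ez, Rplus_comm, cis_plus. do 2 f_equal. ring.
Qed.

(** Once the step $2\pi/N$ is smaller than [d], one of the [N] rotated points always falls into the
    arc, and the product has a small factor. This replaces the strict maximum principle when [m] is
    less than [M], and the uniqueness theorem when [m] is 0. *)
Lemma arc_bound_aux (f : C -> C) (M m d : R) : 0 < d -> 0 <= m ->
  (forall z, Cmod z <= 1 -> cdiff f z) ->
  (forall z, Cmod z = 1 -> Cmod (f z) <= M) ->
  (forall x, PI - d < x <= PI -> Cmod (f (cis x)) <= m) ->
  exists n : nat, Cmod (f 0) ^ S n <= M ^ n * m.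
Proof.
  intros Hd Hm Hf HM Harc. assert (Hpi := PI_RGT_0).
  destruct (nfloor_ex (2 * PI / d)) as [n [_ Hn]].
  { left. apply Rdiv_lt_0_compat; lra. }
  exists n. apply geometric_mean_bound; [exact Hf|]. intros x Hx.
  assert (HS : INR (S n) = INR n + 1) by apply S_INR.
  assert (HS0 : 0 < INR (S n)) by (rewrite HS; generalize (pos_INR n); lra).
  assert (Hh : 2 * PI / INR (S n) < d).
  { rewrite HS. apply (Rmult_lt_reg_r (INR n + 1)); [lra|].
    unfold Rdiv. rewrite Rmult_assoc, Rinv_l by lra.
    rewrite <- HS in *. apply (Rmult_lt_compat_r d) in Hn; [|exact Hd].
    unfold Rdiv in Hn. rewrite Rmult_assoc, Rinv_l in Hn by lra. lra. }
  (* [j] is the last index whose sample point does not pass $\pi$; it is closer to $\pi$ than one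
     step. *)
  destruct (nfloor_ex ((PI - x) * INR (S n) / (2 * PI))) as [j [Hj1 Hj2]].
  { apply Rmult_le_pos; [apply Rmult_le_pos; lra | left; apply Rinv_0_lt_compat; lra]. }
  apply Rprod_one_small with (i := j); [exact Hm | | |].
  - intros i _. split; [apply Cmod_ge_0 | apply HM, Cmod_cis].
  - apply INR_lt. eapply Rle_lt_trans; [apply Hj1|].
    apply (Rmult_lt_reg_r (2 * PI)); [lra|]. unfold Rdiv. rewrite Rmult_assoc, Rinv_l by lra. nra.
  - apply Harc.
    apply (Rmult_le_compat_r (2 * PI / INR (S n))) in Hj1.
    2:{ left. apply Rdiv_lt_0_compat; lra. }
    apply (Rmult_lt_compat_r (2 * PI / INR (S n))) in Hj2.
    2:{ apply Rdiv_lt_0_compat; lra. }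
    replace ((PI - x) * INR (S n) / (2 * PI) * (2 * PI / INR (S n))) with (PI - x) in Hj1, Hj2
      by (field; lra).
    replace (2 * PI * INR j / INR (S n)) with (INR j * (2 * PI / INR (S n))) by (field; lra).
    rewrite Rmult_plus_distr_r in Hj2. lra.
Qed.

Lemma arc_bound (f : C -> C) (c : C) (r a d M m : R) : 0 < d -> 0 <= m -> 0 <= r ->
  (forall z, Cmod (z - c) <= r -> cdiff f z) ->
  (forall z, Cmod (z - c) = r -> Cmod (f z) <= M) ->
  (forall x, a - d < x <= a -> Cmod (f (c + r * cis x)%C) <= m) ->
  exists n : nat, Cmod (f c) ^ S n <= M ^ n * m.
Proof.
  intros Hd Hm Hr Hf HM Harc.
  set (u := (r * cis (a - PI))%C).
  assert (Hu : Cmod u = r) by (unfold u; apply Cmod_scaled_cis; lra).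
  destruct (arc_bound_aux (fun z => f (c + u * z)%C) M m d Hd Hm) as [n Hn].
  - intros z Hz. apply (cdiff_comp f (fun w => c + u * w)%C); [apply cdiff_affine|].
    apply Hf. replace (c + u * z - c)%C with (u * z)%C by ring.
    rewrite Cmod_mult, Hu. generalize (Cmod_ge_0 z). nra.
  - intros z Hz. apply HM. replace (c + u * z - c)%C with (u * z)%C by ring.
    rewrite Cmod_mult, Hu, Hz. ring.
  - intros x Hx. replace (c + u * cis x)%C with (c + r * cis (a - PI + x))%C.
    + apply Harc. lra.
    + unfold u. rewrite cis_plus. ring.
  - exists n. replace (c + u * 0)%C with c in Hn by ring. exact Hn.
Qed.

Lemma RInt_period (b : R -> R) (x : R) : (forall y, continuous b y) ->
  (forall y, b (y + 2 * PI) = b y) ->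
  RInt b x (x + 2 * PI) = RInt b (- PI) PI.
Proof.
  intros Hc Hp.
  assert (Hex : forall u v, ex_RInt b u v).
  { intros u v. apply (ex_RInt_continuous (V := R_CompleteNormedModule)). intros; apply Hc. }
  assert (E1 : RInt b x PI + RInt b PI (x + 2 * PI) = RInt b x (x + 2 * PI))
    by (apply (RInt_Chasles b); auto).
  assert (E2 : RInt b (- PI) x + RInt b x PI = RInt b (- PI) PI)
    by (apply (RInt_Chasles b); auto).
  assert (E3 := RInt_comp_lin b 1 (2 * PI) (- PI) x (Hex _ _)).
  replace (1 * - PI + 2 * PI) with PI in E3 by ring.
  replace (1 * x + 2 * PI) with (x + 2 * PI) in E3 by ring.
  rewrite <- E1, <- E3, <- E2, (RInt_ext (fun y => scal 1 (b (1 * y + 2 * PI))) b).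
  - apply Rplus_comm.
  - intros y _. change (1 * b (1 * y + 2 * PI) = b y). rewrite Rmult_1_l, Rmult_1_l. apply Hp.
Qed.

(** The product of the bounds at [N] equally spaced points is the exponential of a Riemann sum of
    [b]. Uniform continuity compares it with the integral; the error [e] per point becomes a single
    [e] after the [N]-th root, and then tends to 0. *)
Lemma jensen_bound (f : C -> C) (b : R -> R) :
  (forall z, Cmod z <= 1 -> cdiff f z) -> (forall y, continuous b y) ->
  (forall y, b (y + 2 * PI) = b y) -> (forall x, Cmod (f (cis x)) <= exp (b x)) ->
  Cmod (f 0) <= exp (RInt b (- PI) PI / (2 * PI)).
Proof.
  intros Hf Hb Hper Hfb. assert (Hpi := PI_RGT_0).
  assert (Hex : forall u v, ex_RInt b u v).
  { intros u v. apply (ex_RInt_continuous (V := R_CompleteNormedModule)). intros; apply Hb. }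
  set (I := RInt b (- PI) PI / (2 * PI)).
  assert (Key : forall e, 0 < e -> Cmod (f 0) <= exp (I + e)).
  { intros e He.
    (* Sampling starts anywhere in $(-\pi,\pi]$ and runs through one period, hence the interval up
       to $3\pi$. *)
    assert (Hcp : forall x, - PI <= x <= 3 * PI -> continuity_pt b x).
    { intros x _. apply continuity_pt_filterlim, Hb. }
    destruct (Heine_cor2 Hcp (mkposreal e He)) as [dl Hdl].
    simpl in Hdl. assert (Hd0 := cond_pos dl).
    destruct (nfloor_ex (2 * PI / dl)) as [n [_ Hn]].
    { left. apply Rdiv_lt_0_compat; lra. }
    set (N := S n).
    assert (HS : INR N = INR n + 1) by apply S_INR.
    assert (HN : 0 < INR N) by (rewrite HS; generalize (pos_INR n); lra).
    set (h := 2 * PI / INR N).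
    assert (Hh0 : 0 < h) by (apply Rdiv_lt_0_compat; lra).
    assert (HhN : h * INR N = 2 * PI) by (unfold h; field; lra).
    assert (Hh : h < dl).
    { rewrite <- HS in Hn. apply (Rmult_lt_compat_r dl) in Hn; [|exact Hd0].
      unfold Rdiv in Hn. rewrite Rmult_assoc, Rinv_l in Hn by lra. nra. }
    assert (HP : Cmod (f 0) ^ N <= exp (I + e) ^ N).
    { apply geometric_mean_bound; [exact Hf|]. intros x Hx.
      (* Each factor [exp (b y)] is absorbed, up to [e], by the integral of [b] over the step of
         length [h] that starts at [y]. *)
      assert (Ind : forall k, (k <= N)%nat ->
        0 <= Rprod k (fun j => Cmod (f (cis (x + 2 * PI * INR j / INR N)))) <=
        exp (RInt b x (x + INR k * h) / h + INR k * e)).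
      { induction k as [|k IH]; intros Hk.
        - simpl. replace (x + 0 * h) with x by ring. rewrite RInt_point.
          change zero with 0. replace (0 / h + 0 * e) with 0 by (field; lra). rewrite exp_0. lra.
        - assert (HkN : INR k + 1 <= INR N) by (rewrite <- S_INR; apply le_INR; lia).
          assert (Hk0 := pos_INR k).
          specialize (IH ltac:(lia)). cbn [Rprod]. rewrite S_INR.
          set (y := x + INR k * h) in *.
          replace (x + 2 * PI * INR k / INR N) with y by (unfold y, h; field; lra).
          assert (Hy : - PI <= y /\ y + h <= 3 * PI).
          { unfold y. split; [nra|].
            assert (INR k * h + h <= h * INR N) by nra. lra. }
          assert (E : RInt b x (x + (INR k + 1) * h) = RInt b x y + RInt b y (y + h)).
          { replace (x + (INR k + 1) * h) with (y + h) by (unfold y; ring).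
            symmetry. apply (RInt_Chasles b); auto. }
          assert (Hseg : h * (b y - e) <= RInt b y (y + h)).
          { assert (Ec : h * (b y - e) = RInt (fun _ : R => b y - e) y (y + h))
              by (rewrite RInt_const_R; f_equal; ring).
            rewrite Ec.
            apply RInt_le; [lra | apply ex_RInt_const | apply Hex |].
            intros t Ht. assert (Hab : Rabs (b t - b y) < e).
            { apply Hdl; try lra. rewrite Rabs_pos_eq; lra. }
            apply Rabs_lt_between in Hab. lra. }
          rewrite E.
          replace ((RInt b x y + RInt b y (y + h)) / h + (INR k + 1) * e) with
            ((RInt b x y / h + INR k * e) + (RInt b y (y + h) / h + e)) by (field; lra).
          rewrite exp_plus. split.
          + apply Rmult_le_pos; [apply IH | apply Cmod_ge_0].
          + apply Rmult_le_compat; [apply IH | apply Cmod_ge_0 | apply IH |].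
            eapply Rle_trans; [apply Hfb|].
            assert (Hle : b y <= RInt b y (y + h) / h + e).
            { apply (Rmult_le_reg_l h); [exact Hh0|].
              replace (h * (RInt b y (y + h) / h + e)) with (RInt b y (y + h) + h * e) by (field; lra).
              lra. }
            apply exp_mono, Hle. }
      specialize (Ind N (le_n N)).
      replace (x + INR N * h) with (x + 2 * PI) in Ind by lra.
      rewrite (RInt_period b x Hb Hper) in Ind.
      eapply Rle_trans; [apply Ind|]. right.
      replace (RInt b (- PI) PI / h + INR N * e) with (INR N * (I + e)) by (unfold I, h; field; lra).
      generalize (I + e). clear. intros r. induction N as [|N IH].
      - simpl. rewrite Rmult_0_l. apply exp_0.
      - rewrite S_INR, Rmult_plus_distr_r, exp_plus, IH. simpl. rewrite Rmult_1_l. ring. }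
    apply Rnot_lt_le. intros Hlt.
    assert (Hp : exp (I + e) ^ N < Cmod (f 0) ^ N); [|lra].
    assert (Hpos := exp_pos (I + e)). unfold N. clear - Hlt Hpos.
    induction n as [|n IH]; simpl in *; [lra|].
    assert (0 < exp (I + e) ^ n) by (apply pow_lt; lra).
    apply Rmult_gt_0_lt_compat; try lra. apply Rmult_gt_0_compat; lra. }
  destruct (Req_dec (Cmod (f 0)) 0) as [E|E]; [rewrite E; left; apply exp_pos|].
  assert (Hp : 0 < Cmod (f 0)) by (generalize (Cmod_ge_0 (f 0)); lra).
  rewrite <- (exp_ln _ Hp).
  assert (Hl : ln (Cmod (f 0)) <= I).
  { apply le_epsilon. intros e He. rewrite <- (ln_exp (I + e)). apply ln_le; auto. }
  apply exp_mono, Hl.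
Qed.

(** The rational parametrization of the circle. It describes the boundary values both of a disc
    automorphism and of the Cayley map. *)
Lemma cis_2atan (q : R) : cis (2 * atan q) = ((1 - q * q) / (1 + q * q), 2 * q / (1 + q * q)).
Proof.
  assert (Hq : 0 < 1 + q * q) by nra.
  assert (Hs : sqrt (1 + q²) * sqrt (1 + q²) = 1 + q * q) by (rewrite sqrt_sqrt; unfold Rsqr; lra).
  assert (Hs0 : 0 < sqrt (1 + q²)) by (apply sqrt_lt_R0; unfold Rsqr; lra).
  unfold cis. rewrite cos_2a_cos, sin_2a, cos_atan, sin_atan.
  set (s := sqrt (1 + q²)) in *. rewrite <- Hs. f_equal.
  - replace (2 * (1 / s) * (1 / s) - 1) with ((2 - s * s) / (s * s)) by (field; lra).
    rewrite Hs. f_equal. lra.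
  - field. lra.
Qed.

(** The cut-off at [e] keeps logarithms of moduli continuous at zeros, so that they can be
    integrated. *)
Lemma continuous_ln_max (f : R -> R) (e x : R) : 0 < e -> continuous f x ->
  continuous (fun t => ln (Rmax (f t) e)) x.
Proof.
  intros He Hf. apply (continuous_comp (fun t => Rmax (f t) e) ln).
  - apply continuous_eps. intros d Hd.
    destruct (proj1 (continuous_eps f x) Hf d Hd) as [dl [Hdl H]].
    exists dl. split; [exact Hdl|]. intros s Hs. specialize (H s Hs).
    apply Rabs_lt_between in H. apply Rabs_lt_between.
    unfold Rmax. destruct (Rle_dec (f s) e), (Rle_dec (f x) e); lra.
  - apply continuity_pt_filterlim, derivable_continuous_pt.
    exists (/ Rmax (f x) e). apply derivable_pt_lim_ln.
    eapply Rlt_le_trans; [exact He | apply Rmax_r].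
Qed.

Lemma continuous_cos' (x : R) : continuous cos x.
Proof. apply continuity_pt_filterlim, continuity_cos. Qed.

Lemma continuous_sin' (x : R) : continuous sin x.
Proof. apply continuity_pt_filterlim, continuity_sin. Qed.

Lemma continuous_Cmod_ccont (G : C -> C) (g h : R -> R) (t : R) :
  ccont G (g t, h t) -> continuous g t -> continuous h t ->
  continuous (fun s => Cmod (G (g s, h s))) t.
Proof.
  intros HG Hg Hh. apply continuous_eps. intros e He.
  destruct (continuous_of_ccont G g h t HG Hg Hh e He) as [d [Hd H]].
  exists d. split; [exact Hd|]. intros s Hs.
  eapply Rle_lt_trans; [|apply (H s Hs)].
  assert (K1 := Cmod_triangle' (G (g s, h s)) (G (g t, h t))).
  assert (K2 := Cmod_triangle' (G (g t, h t)) (G (g s, h s))).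
  rewrite Cmod_minus_sym in K2. apply Rabs_le. lra.
Qed.

Lemma continuous_Cmod_cis (f : C -> C) (x : R) : cdiff f (cis x) ->
  continuous (fun t => Cmod (f (cis t))) x.
Proof.
  intros H. apply (continuous_Cmod_ccont f cos sin).
  - apply cdiff_ccont, H.
  - apply continuous_cos'.
  - apply continuous_sin'.
Qed.

Lemma bounded_on_circle (f : C -> C) : (forall z, Cmod z = 1 -> cdiff f z) ->
  exists M, forall x, Cmod (f (cis x)) <= M.
Proof.
  intros Hf. assert (Hpi := PI_RGT_0).
  destruct (continuity_ab_maj (fun t => Cmod (f (cis t))) (- PI) PI) as [x0 [H0 _]]; [lra| |].
  { intros t _. apply continuity_pt_filterlim, (continuous_Cmod_cis f), Hf, Cmod_cis. }
  exists (Cmod (f (cis x0))). intros x. destruct (polar (cis x)) as [y [Hy E]].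
  rewrite Cmod_cis, Cmult_1_l in E. rewrite E. apply (H0 y). lra.
Qed.

Lemma ln_nonpos (x : R) : 0 < x <= 1 -> ln x <= 0.
Proof. intros H. rewrite <- ln_1. apply ln_le; lra. Qed.

(* Jensen's formula supplies a majorant [b] of [ln |f|] on the circle whose mean is controlled
   by [B 0]; the mean against the Poisson kernel of [a] is at most (1+a)/(1-a) times larger. *)
Lemma division_bound_real (f B : C -> C) (a : R) : 0 <= a < 1 ->
  (forall z, Cmod z <= 1 -> cdiff f z) -> (forall z, Cmod z <= 1 -> cdiff B z) ->
  (forall z, Cmod z = 1 -> Cmod (B z) <= 1) ->
  (forall z, Cmod z = 1 -> Cmod (f z) * Cmod (B z) <= 1) -> B 0 <> 0 ->
  Cmod (f a) <= exp ((1 + a) / (1 - a) * - ln (Cmod (B 0))).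
Proof.
  intros Ha Hf HB HB1 HfB HB0. assert (Hpi := PI_RGT_0).
  destruct (bounded_on_circle f) as [M HM]; [intros z Hz; apply Hf; lra|].
  set (M' := Rmax M 1).
  assert (HM1 : 1 <= M') by apply Rmax_r.
  assert (HM' : forall x, Cmod (f (cis x)) <= M')
    by (intros x; eapply Rle_trans; [apply HM | apply Rmax_l]).
  (* Where $|B|<e$ the crude bound $|f|\le M'=1/e$ takes over, so $|f|\le1/\max(|B|,e)$ on the whole
     circle and [b] stays continuous at zeros of [B]. *)
  set (e := / M').
  assert (He : 0 < e <= 1).
  { unfold e. split; [apply Rinv_0_lt_compat; lra|]. rewrite <- Rinv_1. apply Rinv_le_contravar; lra. }
  assert (HeM : e * M' = 1) by (unfold e; field; lra).
  set (mx := fun x => Rmax (Cmod (B (cis x))) e).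
  assert (Hmx : forall x, 0 < mx x <= 1).
  { intros x. unfold mx. split; [eapply Rlt_le_trans; [apply (proj1 He) | apply Rmax_r]|].
    apply Rmax_lub; [apply HB1, Cmod_cis | lra]. }
  set (b := fun x => - ln (mx x)).
  assert (Hbc : forall x, continuous b x).
  { intros x. apply (continuous_opp (fun t => ln (mx t))). apply continuous_ln_max; [lra|].
    apply continuous_Cmod_cis, HB. rewrite Cmod_cis. lra. }
  assert (Hbp : forall x, b (x + 2 * PI) = b x).
  { intros x. unfold b, mx. rewrite cis_period. reflexivity. }
  assert (Hb0 : forall x, 0 <= b x).
  { intros x. unfold b. generalize (ln_nonpos _ (Hmx x)). lra. }
  assert (Hfb : forall x, Cmod (f (cis x)) <= exp (b x)).
  { intros x. unfold b. rewrite exp_Ropp, exp_ln by apply Hmx.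
    apply (Rmult_le_reg_r (mx x)); [apply Hmx|]. rewrite Rinv_l by (generalize (Hmx x); lra).
    unfold mx, Rmax. destruct (Rle_dec (Cmod (B (cis x))) e).
    - rewrite <- HeM, (Rmult_comm e). apply Rmult_le_compat_r; [lra | apply HM'].
    - apply HfB, Cmod_cis. }
  assert (Hex : forall u v, ex_RInt b u v).
  { intros u v. apply (ex_RInt_continuous (V := R_CompleteNormedModule)). intros; apply Hbc. }
  set (I := RInt b (- PI) PI).
  assert (HI : I <= 2 * PI * - ln (Cmod (B 0))).
  { assert (J := jensen_bound B (fun x => - b x) HB).
    assert (J1 : Cmod (B 0) <= exp (RInt (fun x => - b x) (- PI) PI / (2 * PI))).
    { apply J.
      - intros y. apply (continuous_opp b), Hbc.
      - intros y. rewrite Hbp. reflexivity.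
      - intros x. unfold b. rewrite Ropp_involutive, exp_ln by apply Hmx. apply Rmax_l. }
    assert (E : RInt (fun x => - b x) (- PI) PI = - I) by apply (RInt_opp b _ _ (Hex _ _)).
    rewrite E in J1. apply Cmod_gt_0 in HB0.
    apply ln_le in J1; [|exact HB0]. rewrite ln_exp in J1.
    apply (Rmult_le_compat_l (2 * PI)) in J1; [|lra].
    replace (2 * PI * (- I / (2 * PI))) with (- I) in J1 by (field; lra). lra. }
  (* [Th] is a continuous argument of the boundary values of the automorphism
     $z\mapsto(z+a)/(1+az)$, which sends 0 to [a]. Its derivative [dTh] is a Poisson kernel, at
     least $(1-a)/(1+a)$. *)
  set (q := fun t => a * sin t / (1 + a * cos t)).
  set (Th := fun t => t - 2 * atan (q t)).
  set (dTh := fun t => (1 - a * a) / (1 + 2 * a * cos t + a * a)).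
  assert (Hc : forall t, 0 < 1 + a * cos t /\ (1 - a) * (1 - a) <= 1 + 2 * a * cos t + a * a <= (1 + a) * (1 + a)).
  { intros t. generalize (COS_bound t). nra. }
  assert (Hd : forall t, is_derive Th t (dTh t)).
  { intros t. specialize (Hc t). unfold Th, q, dTh. auto_derive; [lra|].
    generalize (sin2_cos2 t). unfold Rsqr. intros E2.
    assert (E4 : sin t * sin t = 1 - cos t * cos t) by lra.
    set (w := 1 + a * cos t) in *.
    assert (E3 : 1 + a * sin t * / w * (a * sin t * / w * 1) =
      (1 + 2 * a * cos t + a * a) / (w * w)).
    { transitivity ((w * w + a * a * (sin t * sin t)) / (w * w)); [field; lra|].
      rewrite E4. unfold w. f_equal. ring. }
    assert (E5 : a * (1 * cos t) * / w + a * sin t * (- (a * (1 * - sin t)) * / (w * w)) =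
      (a * cos t + a * a) / (w * w)).
    { transitivity ((a * cos t * w + a * a * (sin t * sin t)) / (w * w)); [field; lra|].
      rewrite E4. unfold w. f_equal. ring. }
    rewrite E3, E5. unfold Rdiv. field. nra. }
  assert (HdTh : forall t, 1 <= (1 + a) / (1 - a) * dTh t).
  { intros t. unfold dTh. specialize (Hc t).
    replace ((1 + a) / (1 - a) * ((1 - a * a) / (1 + 2 * a * cos t + a * a))) with
      ((1 + a) * (1 + a) / (1 + 2 * a * cos t + a * a)) by (field; nra).
    set (D := 1 + 2 * a * cos t + a * a) in *.
    apply (Rmult_le_reg_r D); [nra|]. unfold Rdiv. rewrite Rmult_assoc, Rinv_l by nra. lra. }
  assert (HThp : forall t, Th (t + 2 * PI) = Th t + 2 * PI).
  { intros t. unfold Th, q. rewrite cos_plus, sin_plus, cos_2PI, sin_2PI.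
    rewrite !Rmult_0_r, !Rmult_1_r, Rminus_0_r, Rplus_0_r. ring. }
  assert (HThc : forall t, continuous Th t).
  { intros t. apply (ex_derive_continuous (K := R_AbsRing) (V := R_NormedModule) Th t). exists (dTh t). apply Hd. }
  assert (HdThc : forall t, continuous dTh t).
  { intros t. apply (ex_derive_continuous (K := R_AbsRing) (V := R_NormedModule) dTh t).
    unfold dTh. auto_derive. specialize (Hc t). nra. }
  assert (Hphi : forall t, cis (Th t) = ((cis t + a) / (1 + a * cis t))%C).
  { intros t. specialize (Hc t).
    assert (Hw : (1 + a * cis t)%C <> 0).
    { intros E. apply (f_equal fst) in E. simpl in E. lra. }
    assert (E1 : (cis (Th t) * (1 + a * cis t))%C = (cis t + a)%C).
    { unfold Th. replace (t - 2 * atan (q t)) with (t + 2 * atan (- q t)) by (rewrite atan_opp; ring).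
      rewrite cis_plus, cis_2atan. unfold q.
      generalize (sin2_cos2 t). unfold Rsqr. intros E2.
      assert (Hs2 : sin t * sin t = 1 - cos t * cos t) by lra.
      transitivity (cis t * ((1 + a * cos t)%R, (- (a * sin t))%R))%C.
      - rewrite <- Cmult_assoc. f_equal. unfold cis.
        assert (0 < (1 + a * cos t) * (1 + a * cos t) + (a * sin t) * (a * sin t)) by nra.
        apply injective_projections; simpl; field; split; nra.
      - unfold cis. apply injective_projections; simpl; nra. }
    rewrite <- E1. field. exact Hw. }
  assert (Hphi1 : forall z, Cmod z <= 1 -> Cmod ((z + a) / (1 + a * z)) <= 1 /\ (1 + a * z)%C <> 0).
  { intros z Hz.
    assert (Hw : (1 + a * z)%C <> 0).
    { intros E. assert (E' : (a * z)%C = (- (1))%C).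
      { replace (a * z)%C with ((1 + a * z) - 1)%C by ring. rewrite E. ring. }
      assert (Em : Cmod (a * z) = 1) by (rewrite E'; apply Cmod_m1).
      rewrite Cmod_mult, Cmod_R, Rabs_pos_eq in Em by lra. generalize (Cmod_ge_0 z). nra. }
    split; [|exact Hw].
    assert (Hp := proj1 (Cmod_gt_0 _) Hw).
    rewrite Cmod_div by exact Hw. apply (Rmult_le_reg_r (Cmod (1 + a * z))); [exact Hp|].
    unfold Rdiv. rewrite Rmult_assoc, Rinv_l, Rmult_1_l, Rmult_1_r by lra.
    apply Rsqr_incr_0_var; [|lra]. unfold Rsqr.
    assert (K1 := Cmod2_alt (z + a)). assert (K2 := Cmod2_alt (1 + a * z)). assert (K3 := Cmod2_alt z).
    assert (K4 := Cmod_ge_0 z). set (m := Cmod z) in *.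
    assert (K5 : 0 <= (1 - a * a) * (1 - m * m)) by (apply Rmult_le_pos; nra).
    unfold Re, Im in *. simpl in *.
    set (m1 := Cmod (z + a)) in *. set (m2 := Cmod (1 + a * z)) in *. clear - K1 K2 K3 K5.
    replace (m1 * (m1 * 1)) with (m1 * m1) in K1 by ring.
    replace (m2 * (m2 * 1)) with (m2 * m2) in K2 by ring.
    replace (m * (m * 1)) with (m * m) in K3 by ring. rewrite K1, K2. rewrite K3 in K5. lra. }
  assert (J2 : Cmod (f ((0 + a) / (1 + a * 0))%C) <=
    exp (RInt (fun t => b (Th t)) (- PI) PI / (2 * PI))).
  { apply (jensen_bound (fun z => f ((z + a) / (1 + a * z))%C)).
    - intros z Hz. destruct (Hphi1 z Hz) as [P1 P2].
      apply (cdiff_comp f (fun z => (z + a) / (1 + a * z))%C); [|apply Hf, P1].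
      apply cdiff_div; [apply cdiff_plus; [apply cdiff_id | apply cdiff_const] | apply cdiff_affine | exact P2].
    - intros y. apply (continuous_comp Th b); [apply HThc | apply Hbc].
    - intros y. rewrite HThp. apply Hbp.
    - intros x. rewrite <- Hphi. apply Hfb. }
  replace ((0 + a) / (1 + a * 0))%C with (RtoC a) in J2 by (field; apply C1_nz).
  eapply Rle_trans; [apply J2|]. apply exp_mono.
  (* With the factor [dTh] the mean of [b] along [Th] is the mean of [b] itself; since [b] is
     nonnegative, omitting that factor costs at most $(1+a)/(1-a)$. *)
  assert (Hsub : RInt (fun t => dTh t * b (Th t)) (- PI) PI = I).
  { assert (E := RInt_comp b Th dTh (- PI) PI).
    assert (T1 : Th (- PI) = - PI).
    { unfold Th, q. rewrite sin_neg, sin_PI.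
      replace (a * - 0 / (1 + a * cos (- PI))) with 0 by (unfold Rdiv; ring).
      rewrite atan_0. ring. }
    assert (T2 : Th PI = PI).
    { unfold Th, q. rewrite sin_PI.
      replace (a * 0 / (1 + a * cos PI)) with 0 by (unfold Rdiv; ring).
      rewrite atan_0. ring. }
    rewrite T1, T2 in E. apply E; [intros; apply Hbc | intros; split; [apply Hd | apply HdThc]]. }
  assert (Hex2 : ex_RInt (fun t => b (Th t)) (- PI) PI).
  { apply ex_RInt_cont; [lra|]. intros t _. apply (continuous_comp Th b); [apply HThc | apply Hbc]. }
  assert (Hex3 : ex_RInt (fun t => dTh t * b (Th t)) (- PI) PI).
  { apply ex_RInt_cont; [lra|]. intros t _.
    apply (continuous_mult dTh (fun t => b (Th t))); [apply HdThc|].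
    apply (continuous_comp Th b); [apply HThc | apply Hbc]. }
  assert (Hle : RInt (fun t => b (Th t)) (- PI) PI <= (1 + a) / (1 - a) * I).
  { rewrite <- Hsub.
    assert (E := RInt_scal (fun t => dTh t * b (Th t)) (- PI) PI ((1 + a) / (1 - a)) Hex3).
    eapply Rle_trans; [|right; apply E].
    apply RInt_le; [lra | exact Hex2 | apply (ex_RInt_scal (fun t => dTh t * b (Th t))); exact Hex3 |].
    intros t _. change (b (Th t) <= (1 + a) / (1 - a) * (dTh t * b (Th t))).
    specialize (HdTh t). specialize (Hb0 (Th t)). nra. }
  assert (HK : 0 < (1 + a) / (1 - a)) by (apply Rdiv_lt_0_compat; lra).
  apply (Rmult_le_reg_r (2 * PI)); [lra|]. unfold Rdiv at 1. rewrite Rmult_assoc, Rinv_l by lra.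
  rewrite Rmult_1_r. eapply Rle_trans; [apply Hle|].
  rewrite Rmult_assoc. apply Rmult_le_compat_l; lra.
Qed.

(** The hypotheses concern only the open disc, so the real case is applied on the circle of radius
    [s], halfway between $m=|z-c|$ and [r]. Its factor becomes $(r+3m)/(r-m)$, at most
    $4r/(r-m)$. *)
Lemma division_bound (f B : C -> C) (c : C) (r : R) (z : C) : 0 < r ->
  (forall z, Cmod (z - c) < r -> cdiff f z) -> (forall z, Cmod (z - c) < r -> cdiff B z) ->
  (forall z, Cmod (z - c) < r -> Cmod (B z) <= 1) ->
  (forall z, Cmod (z - c) < r -> Cmod (f z) * Cmod (B z) <= 1) -> B c <> 0 ->
  Cmod (z - c) < r ->
  Cmod (f z) <= exp (4 * r / (r - Cmod (z - c)) * - ln (Cmod (B c))).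
Proof.
  intros Hr Hf HB HB1 HfB HBc Hz.
  destruct (polar (z - c)) as [t [_ Et]].
  set (m := Cmod (z - c)) in *. assert (Hm : 0 <= m) by apply Cmod_ge_0.
  set (s := (r + m) / 2). set (a := m / s).
  assert (Hs : 0 < s) by (unfold s; lra). assert (Hsr : s < r) by (unfold s; lra).
  assert (Has : a * s = m) by (unfold a; field; lra).
  assert (Ha : 0 <= a < 1).
  { split; [apply Rmult_le_pos; [lra | left; apply Rinv_0_lt_compat; lra]|]. unfold s in *. nra. }
  set (u := (s * cis t)%C).
  assert (Hu : Cmod u = s) by (unfold u; apply Cmod_scaled_cis; lra).
  assert (Hin : forall w, Cmod w <= 1 -> Cmod (c + u * w - c) < r).
  { intros w Hw. replace (c + u * w - c)%C with (u * w)%C by ring. rewrite Cmod_mult, Hu.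
    generalize (Cmod_ge_0 w). nra. }
  assert (H := division_bound_real (fun w => f (c + u * w)%C) (fun w => B (c + u * w)%C) a Ha).
  cbv beta in H. replace (c + u * 0)%C with c in H by ring.
  replace (c + u * a)%C with z in H.
  2:{ unfold u. replace z with (c + (z - c))%C at 1 by ring. rewrite Et, <- Has, RtoC_mult. ring. }
  eapply Rle_trans.
  - apply H.
    + intros w Hw. apply (cdiff_comp f (fun w => c + u * w)%C); [apply cdiff_affine | apply Hf, Hin, Hw].
    + intros w Hw. apply (cdiff_comp B (fun w => c + u * w)%C); [apply cdiff_affine | apply HB, Hin, Hw].
    + intros w Hw. apply HB1, Hin. lra.
    + intros w Hw. apply HfB, Hin. lra.
    + exact HBc.
  - apply exp_mono. apply Rmult_le_compat_r.
    + assert (Hc : Cmod (c - c) < r) by (rewrite Cmod_self; exact Hr).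
      assert (K := ln_nonpos _ (conj (proj1 (Cmod_gt_0 _) HBc) (HB1 c Hc))). lra.
    + unfold a, s. replace ((1 + m / ((r + m) / 2)) / (1 - m / ((r + m) / 2))) with ((r + 3 * m) / (r - m)).
      2:{ field. lra. }
      apply Rmult_le_compat_r; [left; apply Rinv_0_lt_compat; lra | lra].
Qed.

(** * The Phragmen-Lindelof principle *)

(** Bisection with the property that a single point dominates the rectangle. Locally, either
    [(p, q)] is itself a maximum point, or a strictly larger value exists and, by continuity,
    dominates a neighbourhood. *)
Lemma Cmod_attains_max (G : C -> C) (x1 x2 y1 y2 : R) : x1 <= x2 -> y1 <= y2 ->
  (forall x y, x1 <= x <= x2 -> y1 <= y <= y2 -> ccont G (x, y)) ->
  exists x0 y0, x1 <= x0 <= x2 /\ y1 <= y0 <= y2 /\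
    forall x y, x1 <= x <= x2 -> y1 <= y <= y2 -> Cmod (G (x, y)) <= Cmod (G (x0, y0)).
Proof.
  intros Hx Hy HG.
  apply (bisection_2d (fun a b c d => exists x0 y0, x1 <= x0 <= x2 /\ y1 <= y0 <= y2 /\
    forall x y, a <= x <= b -> c <= y <= d -> Cmod (G (x, y)) <= Cmod (G (x0, y0)))); auto.
  - assert (Hmerge : forall P Q : R -> R -> Prop,
      (exists x0 y0, x1 <= x0 <= x2 /\ y1 <= y0 <= y2 /\
        forall x y, P x y -> Cmod (G (x, y)) <= Cmod (G (x0, y0))) ->
      (exists x0 y0, x1 <= x0 <= x2 /\ y1 <= y0 <= y2 /\
        forall x y, Q x y -> Cmod (G (x, y)) <= Cmod (G (x0, y0))) ->
      exists x0 y0, x1 <= x0 <= x2 /\ y1 <= y0 <= y2 /\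
        forall x y, P x y \/ Q x y -> Cmod (G (x, y)) <= Cmod (G (x0, y0))).
    { intros P Q [p [q [Hp [Hq H1]]]] [p' [q' [Hp' [Hq' H2]]]].
      destruct (Rle_dec (Cmod (G (p, q))) (Cmod (G (p', q')))) as [Hl|Hl].
      - exists p', q'. do 2 (split; [assumption|]).
        intros x y [K|K]; [specialize (H1 x y K); lra | auto].
      - exists p, q. do 2 (split; [assumption|]).
        intros x y [K|K]; [auto | specialize (H2 x y K); lra]. }
    intros a b c d Ha Hb Hc Hd H1 H2 H3 H4.
    set (R := fun u v w z x y => u <= x <= v /\ w <= y <= z).
    assert (Hr : forall u v w z, (exists x0 y0, x1 <= x0 <= x2 /\ y1 <= y0 <= y2 /\
      forall x y, u <= x <= v -> w <= y <= z -> Cmod (G (x, y)) <= Cmod (G (x0, y0))) ->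
      exists x0 y0, x1 <= x0 <= x2 /\ y1 <= y0 <= y2 /\
      forall x y, R u v w z x y -> Cmod (G (x, y)) <= Cmod (G (x0, y0))).
    { intros u v w z [x0 [y0 [K1 [K2 K3]]]]. exists x0, y0. do 2 (split; [assumption|]).
      intros x y [? ?]. auto. }
    apply Hr in H1. apply Hr in H2. apply Hr in H3. apply Hr in H4.
    destruct (Hmerge _ _ (Hmerge _ _ H1 H2) (Hmerge _ _ H3 H4)) as [x0 [y0 [K1 [K2 K3]]]].
    exists x0, y0. do 2 (split; [assumption|]). intros x y Hxx Hyy. apply K3. unfold R.
    destruct (Rle_dec x ((a + b) / 2)), (Rle_dec y ((c + d) / 2)).
    + left; left; lra.
    + right; left; lra.
    + left; right; lra.
    + right; right; lra.
  - intros p q Hp Hq.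
    destruct (classic (exists s t, x1 <= s <= x2 /\ y1 <= t <= y2 /\
      Cmod (G (p, q)) < Cmod (G (s, t)))) as [[s [t [Hs [Ht Hlt]]]]|Hno].
    + destruct (HG p q Hp Hq (Cmod (G (s, t)) - Cmod (G (p, q)))) as [dl [Hdl H]]; [lra|].
      exists (dl / 2). split; [lra|]. intros a b c d Ha Hb Hc Hd Hab Hcd.
      exists s, t. do 2 (split; [assumption|]). intros x y Hxx Hyy.
      assert (Hn : Cmod ((x, y) - (p, q)) < dl).
      { replace ((x, y) - (p, q))%C with ((x - p, y - q) : C)
          by (apply injective_projections; simpl; ring).
        eapply Rle_lt_trans; [apply Cmod_le_abs|].
        assert (Rabs (x - p) <= b - a) by (apply Rabs_le; lra).
        assert (Rabs (y - q) <= d - c) by (apply Rabs_le; lra). lra. }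
      specialize (H _ Hn). generalize (Cmod_triangle' (G (x, y)) (G (p, q))). lra.
    + exists 1. split; [lra|]. intros a b c d Ha Hb Hc Hd _ _.
      exists p, q. do 2 (split; [assumption|]). intros x y Hxx Hyy.
      apply Rnot_lt_le. intros Hlt. apply Hno. exists x, y. repeat split; lra.
Qed.

(** A maximum $M>1$ would be attained inside. The largest disc around that point within the strip
    touches a side, where the modulus is at most 1, so an arc of its circle has modulus at most
    $(1+M)/2$, and [arc_bound] gives $M^{n+1}\le M^n(1+M)/2$. *)
Lemma strip_max_principle (G : C -> C) (al L : R) : 0 < al -> 0 <= L ->
  (forall z, Rabs (snd z) <= al -> cdiff G z) ->
  (forall z, Rabs (snd z) = al -> Cmod (G z) <= 1) ->
  (forall z, Rabs (snd z) <= al -> L <= Rabs (fst z) -> Cmod (G z) <= 1) ->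
  forall z, Rabs (snd z) <= al -> Cmod (G z) <= 1.
Proof.
  intros Hal HL HG Hside Hfar.
  destruct (Cmod_attains_max G (- L) L (- al) al) as [x0 [y0 [Hx0 [Hy0 Hmax]]]]; try lra.
  { intros x y Hx Hy. apply cdiff_ccont, HG. simpl. apply Rabs_le. lra. }
  set (p := ((x0, y0) : C)) in *. set (M := Cmod (G p)).
  assert (Hall : forall z, Rabs (snd z) <= al -> Cmod (G z) <= 1 \/ Cmod (G z) <= M).
  { intros [x y] Hz. simpl in Hz. destruct (Rle_dec L (Rabs x)) as [K|K].
    - left. apply Hfar; assumption.
    - right. apply Hmax; apply Rabs_le_between; lra. }
  destruct (Rle_dec M 1) as [HM|HM].
  { intros z Hz. destruct (Hall z Hz); lra. }
  exfalso.
  assert (Hall2 : forall z, Rabs (snd z) <= al -> Cmod (G z) <= M)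
    by (intros z Hz; destruct (Hall z Hz); lra).
  assert (Hy : Rabs y0 < al).
  { assert (Hle : Rabs y0 <= al) by (apply Rabs_le; lra).
    destruct Hle as [K|K]; [exact K|]. exfalso. apply HM, (Hside p K). }
  set (r := al - Rabs y0). assert (Hr : 0 < r) by (unfold r; lra).
  assert (Hdisc : forall z, Cmod (z - p) <= r -> Rabs (snd z) <= al).
  { intros z Hz. assert (K := abs_snd_le (z - p)).
    replace (snd (z - p)%C) with (snd z - y0) in K by (simpl; ring).
    assert (K2 := Rabs_triang_inv (snd z) y0). unfold r in Hz. lra. }
  assert (Hang : exists a, Rabs (snd (p + r * cis a)%C) = al).
  { destruct (Rle_dec 0 y0) as [Hs|Hs].
    - exists (PI / 2). unfold cis. rewrite cos_PI2, sin_PI2. simpl. unfold r.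
      rewrite (Rabs_pos_eq y0) by exact Hs. rewrite Rabs_pos_eq; [|lra]. ring.
    - exists (- (PI / 2)). unfold cis. rewrite cos_neg, sin_neg, cos_PI2, sin_PI2. simpl. unfold r.
      rewrite (Rabs_left y0) by lra. rewrite Rabs_left; [|lra]. ring. }
  destruct Hang as [a Ha].
  assert (Hn := Hside _ Ha).
  assert (Hin : forall x, Cmod (p + r * cis x - p) = r).
  { intros x. replace (p + r * cis x - p)%C with (r * cis x)%C by ring.
    apply Cmod_scaled_cis; lra. }
  assert (Hc : continuous (fun t => Cmod (G (p + r * cis t)%C)) a).
  { apply (continuous_Cmod_cis (fun z => G (p + r * z)%C)).
    apply (cdiff_comp G (fun z => p + r * z)%C); [apply cdiff_affine|].
    apply HG. lra. }
  destruct (proj1 (continuous_eps _ a) Hc ((M - 1) / 2)) as [d [Hd Hdd]]; [lra|].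
  destruct (arc_bound G p r a d M ((1 + M) / 2)) as [n Hnn]; try lra.
  - intros z Hz. apply HG, Hdisc, Hz.
  - intros z Hz. apply Hall2, Hdisc. lra.
  - intros x Hx. assert (K : Rabs (x - a) < d) by (apply Rabs_lt_between; lra).
    specialize (Hdd x K). apply Rabs_lt_between in Hdd. lra.
  - fold M in Hnn. simpl in Hnn. assert (0 < M ^ n) by (apply pow_lt; lra). nra.
Qed.

Lemma exp_ge_id (x : R) : x <= exp x.
Proof. generalize (exp_ineq1_le x). lra. Qed.

Lemma cos_ge_on (x a : R) : Rabs x <= a -> a <= PI -> cos a <= cos x.
Proof.
  intros Hx Ha.
  assert (E : cos x = cos (Rabs x)).
  { unfold Rabs. destruct (Rcase_abs x); [rewrite cos_neg|]; reflexivity. }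
  rewrite E. apply cos_decr_1; try lra; generalize (Rabs_pos x); lra.
Qed.

(* The factor exp(-e (e^(kz) + e^(-kz))) decays at both ends of the strip, as k al < PI/2. *)
Lemma phragmen_lindelof_strip (G : C -> C) (al X K k : R) : 0 < al -> 0 <= K < k ->
  k * al < PI / 2 ->
  (forall z, Rabs (snd z) <= al -> cdiff G z) ->
  (forall z, Rabs (snd z) = al -> Cmod (G z) <= 1) ->
  (forall z, Rabs (snd z) <= al -> Cmod (G z) <= exp (X * exp (K * Rabs (fst z)))) ->
  forall z, Rabs (snd z) <= al -> Cmod (G z) <= 1.
Proof.
  intros Hal HK Hkal HG Hside Hgrow z0 Hz0. assert (Hpi := PI_RGT_0).
  set (c := cos (k * al)).
  assert (Hc : 0 < c) by (apply cos_gt_0; nra).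
  set (D := fun e z => (cexp (- (RtoC e) * (cexp (RtoC k * z) + cexp (RtoC (- k) * z))))%C).
  assert (HD : forall e z, 0 < e -> Rabs (snd z) <= al ->
    Cmod (D e z) <= exp (- (e * c * exp (k * Rabs (fst z))))).
  { intros e z He Hz. unfold D. rewrite Cmod_cexp. apply exp_mono.
    assert (E : fst (- (RtoC e) * (cexp (RtoC k * z) + cexp (RtoC (- k) * z)))%C =
      - (e * (cos (k * snd z) * (exp (k * fst z) + exp (- k * fst z))))).
    { unfold cexp. simpl. replace (- k * snd z + 0 * fst z) with (- (k * snd z)) by ring.
      rewrite cos_neg. replace (k * snd z + 0 * fst z) with (k * snd z) by ring.
      replace (k * fst z - 0 * snd z) with (k * fst z) by ring.
      replace (- k * fst z - 0 * snd z) with (- k * fst z) by ring. ring. }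
    rewrite E. apply Ropp_le_contravar. rewrite Rmult_assoc. apply Rmult_le_compat_l; [lra|].
    assert (Hcos : c <= cos (k * snd z)).
    { apply cos_ge_on; [|lra]. rewrite Rabs_mult, Rabs_pos_eq by lra. apply Rmult_le_compat_l; lra. }
    apply Rmult_le_compat; [lra | left; apply exp_pos | exact Hcos |].
    assert (P1 := exp_pos (k * fst z)). assert (P2 := exp_pos (- k * fst z)).
    unfold Rabs. destruct (Rcase_abs (fst z)).
    - replace (k * - fst z) with (- k * fst z) by ring. lra.
    - lra. }
  assert (HDd : forall e z, cdiff (D e) z).
  { intros e z. unfold D. apply (cdiff_comp cexp); [|apply cdiff_cexp].
    apply cdiff_scal. apply cdiff_plus; (apply (cdiff_comp cexp); [apply cdiff_scal, cdiff_id | apply cdiff_cexp]). }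
  assert (Key : forall e, 0 < e -> Cmod (G z0 * D e z0) <= 1).
  { intros e He.
    set (Y := Rabs X + 1).
    (* Beyond [L] the decay exponent [e * c * exp (k * x)] dominates the growth exponent
       [X * exp (K * x)]. *)
    set (L := ln (Rmax 1 (Y / (e * c))) / (k - K)).
    assert (HY : 0 < Y) by (unfold Y; generalize (Rabs_pos X); lra).
    assert (HL : 0 <= L).
    { apply Rmult_le_pos; [|left; apply Rinv_0_lt_compat; lra].
      rewrite <- ln_1. apply ln_le; [lra | apply Rmax_l]. }
    apply (strip_max_principle (fun z => G z * D e z)%C al L); auto.
    - intros z Hz. apply cdiff_mult; auto.
    - intros z Hz. rewrite Cmod_mult. assert (H1 := Hside z Hz). assert (H2 := HD e z He ltac:(lra)).
      assert (H3 : exp (- (e * c * exp (k * Rabs (fst z)))) <= 1).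
      { rewrite <- exp_0. apply exp_mono. assert (0 < e * c * exp (k * Rabs (fst z))); [|lra].
        apply Rmult_lt_0_compat; [nra | apply exp_pos]. }
      generalize (Cmod_ge_0 (G z)) (Cmod_ge_0 (D e z)). nra.
    - intros z Hz Hfar. rewrite Cmod_mult.
      assert (H1 := Hgrow z Hz). assert (H2 := HD e z He Hz).
      eapply Rle_trans; [apply Rmult_le_compat; [apply Cmod_ge_0 | apply Cmod_ge_0 | apply H1 | apply H2]|].
      rewrite <- exp_plus, <- exp_0. apply exp_mono.
      set (x := Rabs (fst z)) in *.
      assert (Hkx : k * x = K * x + (k - K) * x) by ring. rewrite Hkx, exp_plus.
      assert (P := exp_pos (K * x)).
      assert (Hbig : Y <= e * c * exp ((k - K) * x)).
      { apply Rle_trans with (e * c * (Y / (e * c))).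
        - right. field. split; lra.
        - apply Rmult_le_compat_l; [nra|].
          apply Rle_trans with (Rmax 1 (Y / (e * c))); [apply Rmax_r|].
          rewrite <- (exp_ln (Rmax 1 (Y / (e * c)))) by (eapply Rlt_le_trans; [apply Rlt_0_1 | apply Rmax_l]).
          apply exp_mono. apply (Rmult_le_compat_l (k - K)) in Hfar; [|lra].
          replace ((k - K) * L) with (ln (Rmax 1 (Y / (e * c)))) in Hfar by (unfold L; field; lra).
          exact Hfar. }
      assert (X <= Y) by (unfold Y; generalize (Rle_abs X); lra).
      nra. }
  apply le_epsilon. intros eta Heta.
  assert (Hg := Cmod_ge_0 (G z0)).
  set (T := fst (cexp (RtoC k * z0) + cexp (RtoC (- k) * z0))%C).
  assert (HDe : forall e, Cmod (D e z0) = exp (- (e * T))).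
  { intros e. unfold D. rewrite Cmod_cexp. f_equal. unfold T. simpl. ring. }
  apply Rnot_lt_le. intros Hlt.
  (* The estimate holds for every [e]; this one makes the loss [exp (e * T)] at the fixed point [z0]
     at most [1 + eta]. *)
  set (e := ln (1 + eta) / (Rabs T + 1)).
  assert (Hl : 0 < ln (1 + eta)) by (rewrite <- ln_1; apply ln_increasing; lra).
  assert (HT := Rabs_pos T).
  assert (He : 0 < e) by (apply Rdiv_lt_0_compat; lra).
  specialize (Key e He). rewrite Cmod_mult, HDe in Key.
  assert (HeT : e * T <= ln (1 + eta)).
  { replace (ln (1 + eta)) with (e * (Rabs T + 1)) by (unfold e; field; lra).
    apply Rmult_le_compat_l; [lra|]. generalize (Rle_abs T). lra. }
  apply (Rmult_le_compat_r (exp (e * T))) in Key; [|left; apply exp_pos].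
  rewrite Rmult_assoc, <- exp_plus in Key. replace (- (e * T) + e * T) with 0 in Key by ring.
  rewrite exp_0 in Key.
  assert (exp (e * T) <= 1 + eta).
  { rewrite <- (exp_ln (1 + eta)) by lra. apply exp_mono, HeT. }
  lra.
Qed.

Lemma continuity_2d_of_ccont (G : C -> C) (e x y : R) : 0 < e -> ccont G (x, y) ->
  continuity_2d_pt (fun u v => ln (Rmax (Cmod (G (u, v))) e)) x y.
Proof.
  intros He HG eta.
  assert (Hc := continuous_ln_max (fun s => s) e (Cmod (G (x, y))) He (continuous_id _)).
  destruct (proj1 (continuous_eps _ _) Hc eta (cond_pos eta)) as [d [Hd H]].
  destruct (HG d Hd) as [d1 [Hd1 H1]].
  assert (Hd2 : 0 < d1 / 2) by lra.
  exists (mkposreal _ Hd2). simpl. intros u v Hu Hv. apply H.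
  assert (Hn : Cmod ((u, v) - (x, y)) < d1).
  { replace ((u, v) - (x, y))%C with ((u - x, v - y) : C)
      by (apply injective_projections; simpl; ring).
    eapply Rle_lt_trans; [apply Cmod_le_abs | lra]. }
  specialize (H1 _ Hn). apply Rabs_lt_between.
  assert (K1 := Cmod_triangle' (G (u, v)) (G (x, y))).
  assert (K2 := Cmod_triangle' (G (x, y)) (G (u, v))). rewrite Cmod_minus_sym in K2. lra.
Qed.

(* Jensen's inequality on circles of radius close to 1, keeping only an arc that avoids -1. *)
Lemma jensen_half_plane (B : C -> C) (e tau : R) : 0 < e <= 1 -> 0 < tau < PI ->
  (forall w, - 1 < fst w -> cdiff B w) -> (forall w, 0 <= fst w -> Cmod (B w) <= 1) ->
  B 1 <> 0 ->
  RInt (fun x => - ln (Rmax (Cmod (B ((1 - cis x) / (1 + cis x))%C)) e)) (- tau) tau <=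
  2 * PI * (1 - ln (Cmod (B 1))).
Proof.
  intros He Htau HB HB1 HB0. assert (Hpi := PI_RGT_0).
  (* The Cayley map sends the disc to the right half plane, 0 to 1 and -1 to infinity, where nothing
     is known about [B]. *)
  set (cay := fun z : C => ((1 - z) / (1 + z))%C).
  set (D := fun z : C => B (cay z)).
  assert (Hne : forall z, Cmod z <= 1 -> z <> (- (1))%C -> (1 + z)%C <> 0 /\ 0 <= fst (cay z)).
  { intros z Hz Hz1. assert (Hn : (1 + z)%C <> 0).
    { intros E. apply Hz1. replace z with ((1 + z) - 1)%C by ring. rewrite E. ring. }
    split; [exact Hn|]. unfold cay.
    assert (Hn2 := proj1 (Cmod_gt_0 _) Hn). assert (K1 := Cmod2_alt (1 + z)). assert (K2 := Cmod2_alt z).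
    assert (Hz0 := Cmod_ge_0 z).
    destruct z as [x y]. unfold Re, Im in *. simpl in *.
    assert (Hp : 0 < (1 + x) * (1 + x) + (0 + y) * (0 + y)) by nra.
    replace ((1 + - x) * ((1 + x) / ((1 + x) * ((1 + x) * 1) + (0 + y) * ((0 + y) * 1))) -
      (0 + - y) * (- (0 + y) / ((1 + x) * ((1 + x) * 1) + (0 + y) * ((0 + y) * 1)))) with
      ((1 - (x * x + y * y)) / ((1 + x) * (1 + x) + (0 + y) * (0 + y))) by (field; nra).
    apply Rmult_le_pos; [nra | left; apply Rinv_0_lt_compat, Hp]. }
  assert (HD : forall z, Cmod z <= 1 -> z <> (- (1))%C -> cdiff D z).
  { intros z Hz Hz1. destruct (Hne z Hz Hz1) as [H1 H2]. unfold D.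
    apply (cdiff_comp B cay).
    - unfold cay. apply cdiff_div; [| | exact H1].
      + apply cdiff_minus; [apply cdiff_const | apply cdiff_id].
      + apply cdiff_plus; [apply cdiff_const | apply cdiff_id].
    - apply HB. lra. }
  assert (HDb : forall z, Cmod z <= 1 -> z <> (- (1))%C -> Cmod (D z) <= 1).
  { intros z Hz Hz1. apply HB1, Hne; assumption. }
  assert (Hcis : forall x, - tau <= x <= tau -> cis x <> (- (1))%C).
  { intros x Hx E. apply (f_equal fst) in E. simpl in E.
    assert (K : cos tau <= cos x) by (apply cos_ge_on; [apply Rabs_le; lra | lra]).
    assert (K2 : cos PI < cos tau) by (apply cos_decreasing_1; lra).
    rewrite cos_PI in K2. lra. }
  set (g := fun u v => ln (Rmax (Cmod (D (cexp (u, v)))) e)).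
  assert (Hcexp0 : forall v, cexp (0, v) = cis v).
  { intros v. rewrite cexp_cis. simpl. rewrite exp_0. ring. }
  assert (Hg : forall x y, -1 <= x <= 0 -> - tau <= y <= tau -> continuity_2d_pt g x y).
  { intros x y Hx Hy. apply (continuity_2d_of_ccont (fun z => D (cexp z))); [lra|].
    apply cdiff_ccont, (cdiff_comp D cexp); [apply cdiff_cexp|]. apply HD.
    - rewrite Cmod_cexp. simpl. rewrite <- exp_0. apply exp_mono. lra.
    - destruct (proj2 Hx) as [Hl|Hl].
      + intros E. apply (f_equal Cmod) in E. rewrite Cmod_cexp in E. simpl in E.
        rewrite Cmod_m1, <- exp_0 in E. apply exp_inv in E. lra.
      + rewrite Hl, Hcexp0. apply Hcis, Hy. }
  destruct (uniform_continuity_2d g (-1) 0 (- tau) tau Hg (mkposreal 1 Rlt_0_1)) as [dl Hdl].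
  simpl in Hdl. assert (Hdl0 := cond_pos dl).
  (* On the circle of radius [exp x1] the truncated logarithm differs by less than 1 from its value
     in the same direction on the unit arc; this is the term 1 in the bound. *)
  set (x1 := - Rmin (dl / 2) 1).
  assert (Hx1 : -1 <= x1 < 0 /\ - dl < x1).
  { unfold x1. generalize (Rmin_l (dl / 2) 1) (Rmin_r (dl / 2) 1).
    assert (0 < Rmin (dl / 2) 1) by (apply Rmin_glb_lt; lra). lra. }
  set (rho := exp x1).
  assert (Hrho : 0 < rho < 1).
  { unfold rho. split; [apply exp_pos|]. rewrite <- exp_0. apply exp_increasing. lra. }
  assert (Hin : forall z, Cmod z <= 1 -> Cmod (rho * z) <= 1 /\ (rho * z)%C <> (- (1))%C).
  { intros z Hz. assert (Hm : Cmod (rho * z) < 1).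
    { rewrite Cmod_mult, Cmod_R, Rabs_pos_eq by lra. generalize (Cmod_ge_0 z). nra. }
    split; [lra|]. intros E. rewrite E in Hm.
    rewrite Cmod_m1 in Hm. lra. }
  set (b := fun x => ln (Rmax (Cmod (D (rho * cis x)%C)) e)).
  assert (Hbe : forall x, b x = g x1 x).
  { intros x. unfold b, g. rewrite cexp_cis. reflexivity. }
  assert (Hmx : forall r, r <= 1 -> ln (Rmax r e) <= 0).
  { intros r Hr. apply ln_nonpos. split.
    - eapply Rlt_le_trans; [apply (proj1 He) | apply Rmax_r].
    - apply Rmax_lub; lra. }
  assert (Hrc : forall z, Cmod z <= 1 -> cdiff (fun w => D (rho * w)%C) z).
  { intros z Hz. destruct (Hin z Hz). apply cdiff_rotate, HD; assumption. }
  assert (Hbc : forall x, continuous b x).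
  { intros x. apply continuous_ln_max; [lra|].
    apply (continuous_Cmod_cis (fun w => D (rho * w)%C)). apply Hrc. rewrite Cmod_cis. lra. }
  assert (Hb0 : forall x, b x <= 0).
  { intros x. apply Hmx. destruct (Hin (cis x)); [rewrite Cmod_cis; lra|]. apply HDb; assumption. }
  assert (J : Cmod (D (rho * 0)%C) <= exp (RInt b (- PI) PI / (2 * PI))).
  { apply (jensen_bound (fun z => D (rho * z)%C)).
    - exact Hrc.
    - exact Hbc.
    - intros y. unfold b. rewrite cis_period. reflexivity.
    - intros x. unfold b. rewrite exp_ln by (eapply Rlt_le_trans; [apply (proj1 He) | apply Rmax_r]).
      apply Rmax_l. }
  replace (D (rho * 0)%C) with (B 1) in J.
  2:{ unfold D, cay. f_equal. replace (rho * 0)%C with (RtoC 0) by ring. field. }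
  apply Cmod_gt_0 in HB0. apply ln_le in J; [|exact HB0]. rewrite ln_exp in J.
  assert (Hgen : forall l v : R, l <= v / (2 * PI) -> 2 * PI * l <= v).
  { intros l v Hlv. apply (Rmult_le_compat_l (2 * PI)) in Hlv; [|lra].
    replace (2 * PI * (v / (2 * PI))) with v in Hlv by (field; lra). exact Hlv. }
  apply Hgen in J.
  assert (Hex : forall u v, ex_RInt b u v).
  { intros u v. apply (ex_RInt_continuous (V := R_CompleteNormedModule)). intros; apply Hbc. }
  assert (Hneg : forall u v, u <= v -> RInt b u v <= 0).
  { intros u v Huv. replace 0 with ((v - u) * 0) by ring. rewrite <- RInt_const_R.
    apply RInt_le; [exact Huv | apply Hex | apply ex_RInt_const | intros; apply Hb0]. }
  assert (E1 : RInt b (- PI) (- tau) + RInt b (- tau) PI = RInt b (- PI) PI)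
    by (apply (RInt_Chasles b); auto).
  assert (E2 : RInt b (- tau) tau + RInt b tau PI = RInt b (- tau) PI)
    by (apply (RInt_Chasles b); auto).
  (* The discarded arcs contribute nonpositive amounts, because $|B|\le1$. *)
  assert (N1 := Hneg (- PI) (- tau) ltac:(lra)). assert (N2 := Hneg tau PI ltac:(lra)).
  assert (Hcl : forall x, - tau <= x <= tau ->
    continuous (fun x => - ln (Rmax (Cmod (D (cis x))) e)) x).
  { intros x Hx. apply (continuous_opp (fun x => ln (Rmax (Cmod (D (cis x))) e))).
    apply continuous_ln_max; [lra|]. apply continuous_Cmod_cis, HD; [rewrite Cmod_cis; lra | apply Hcis, Hx]. }
  assert (Hfin : RInt (fun x => - ln (Rmax (Cmod (D (cis x))) e)) (- tau) tau <=
    RInt (fun x => 1 + - b x) (- tau) tau).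
  { apply RInt_le; [lra | apply ex_RInt_cont; [lra | exact Hcl] | |].
    - apply ex_RInt_cont; [lra|]. intros x _.
      apply (continuous_plus (fun _ => 1) (fun x => - b x)); [apply continuous_const|].
      apply (continuous_opp b), Hbc.
    - intros x Hx. rewrite Hbe.
      assert (K : Rabs (g x1 x - g 0 x) < 1).
      { apply (Hdl 0 x x1 x); try lra; apply Rabs_lt_between; lra. }
      apply Rabs_lt_between in K.
      assert (Eg : g 0 x = ln (Rmax (Cmod (D (cis x))) e)) by (unfold g; rewrite Hcexp0; reflexivity).
      rewrite <- Eg. lra. }
  assert (E3 : RInt (fun x => 1 + - b x) (- tau) tau = 2 * tau - RInt b (- tau) tau).
  { assert (Hexo : ex_RInt (fun x => - b x) (- tau) tau) by apply (ex_RInt_opp b), Hex.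
    assert (Ep := RInt_plus (fun _ => 1) (fun x => - b x) (- tau) tau (ex_RInt_const _ _ _) Hexo).
    assert (Eo := RInt_opp b (- tau) tau (Hex _ _)).
    etransitivity; [apply Ep|]. rewrite RInt_const_R.
    etransitivity; [apply (f_equal (fun v => (tau - - tau) * 1 + v)), Eo|].
    assert (Hring : forall v : R, (tau - - tau) * 1 + - v = 2 * tau - v) by (intros; ring).
    apply Hring. }
  rewrite E3 in Hfin. eapply Rle_trans; [apply Hfin|]. lra.
Qed.

(** * Auxiliary estimates and the logarithm on the right half plane *)

Lemma exp_ge_1 (x : R) : 0 <= x -> 1 <= exp x.
Proof. intros H. rewrite <- exp_0. apply exp_mono, H. Qed.

Lemma exp_le_1 (x : R) : x <= 0 -> exp x <= 1.
Proof. intros H. rewrite <- exp_0. apply exp_mono, H. Qed.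

Lemma ln_le_id (x : R) : 0 < x -> ln x <= x.
Proof.
  intros Hx. generalize (exp_ge_id (ln x)). rewrite exp_ln by exact Hx. auto.
Qed.

Lemma ln_le_Rpower (x K : R) : 0 < K -> 0 < x -> ln x <= Rpower x K / K.
Proof.
  intros HK Hx. apply (Rmult_le_reg_l K); [exact HK|].
  replace (K * (Rpower x K / K)) with (Rpower x K) by (field; lra).
  unfold Rpower. apply exp_ge_id.
Qed.

Lemma ln_le_eps (x d : R) : 0 < d -> 0 < x -> ln x <= d * x - ln d.
Proof.
  intros Hd Hx. generalize (ln_le_id (d * x) ltac:(nra)). rewrite ln_mult by assumption. lra.
Qed.

Lemma ln_nonneg (x : R) : 1 <= x -> 0 <= ln x.
Proof. intros H. rewrite <- ln_1. apply ln_le; lra. Qed.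

Lemma Rpower_ge_1 (x K : R) : 0 <= K -> 1 <= x -> 1 <= Rpower x K.
Proof.
  intros HK Hx. unfold Rpower. apply exp_ge_1.
  apply Rmult_le_pos; [exact HK | apply ln_nonneg, Hx].
Qed.

(* The maximum principle for [G^3/(w - s)]; the cube absorbs the singularity at [s]. *)
Lemma cube_near_zero (G : C -> C) (z s : C) (M : R) :
  (forall w, cdiff G w) -> G s = 0 -> Cmod (z - s) <= / 2 ->
  (forall w, Cmod (w - z) <= 1 -> Cmod (G w) <= M) ->
  Cmod (G z) ^ 3 <= 2 * M ^ 3 * Cmod (z - s).
Proof.
  intros HG Hs Hzs HM.
  destruct (Ceq_dec z s) as [->|Hne].
  { rewrite Hs, Cmod_0, Cmod_self. simpl. lra. }
  assert (Hp := proj1 (Cmod_gt_0 _) (Cminus_neq0 z s Hne)).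
  set (v := (s - z)%C).
  assert (Hv : Cmod v = Cmod (z - s)) by apply Cmod_minus_sym.
  assert (Hv0 : v <> 0) by (apply Cminus_neq0; auto).
  assert (Hshift : forall x, cdiff (fun x => G (z + x)%C) x).
  { intros x. apply (cdiff_comp G (fun x => z + x)%C); [|apply HG].
    apply cdiff_plus; [apply cdiff_const | apply cdiff_id]. }
  assert (H := center_bound (fun x => G (z + x) ^ 3 / (x - v))%C (2 * M ^ 3)).
  assert (H0 : Cmod (G (z + 0)%C ^ 3 / (0 - v)) <= 2 * M ^ 3).
  { apply H.
    - intros x Hx. destruct (Ceq_dec x v) as [->|Hxv].
      + destruct (cdiff_lipschitz _ v (Hshift v)) as [L [d [Hd [HL Hlip]]]].
        assert (Ev : G (z + v)%C = 0) by (unfold v; replace (z + (s - z))%C with s by ring; exact Hs).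
        (* Since $G(z+x)$ is $O(|x-v|)$ at [v], the quotient is $O(|x-v|^2)$: the exponent 3 is the
           smallest that leaves the order 2 needed here. *)
        apply (cdiff_flat _ v (L ^ 3) d Hd).
        * rewrite Ev. unfold Cdiv. replace (0 ^ 3)%C with (RtoC 0) by (simpl; ring). ring.
        * intros w Hw. specialize (Hlip w Hw). rewrite Ev in Hlip.
          replace (G (z + w) - 0)%C with (G (z + w)%C) in Hlip by ring.
          destruct (Ceq_dec w v) as [->|Hwv].
          -- rewrite Ev. unfold Cdiv. replace (0 ^ 3 * / (v - v))%C with (RtoC 0) by (simpl; ring).
             rewrite Cmod_0, Cmod_self. simpl. lra.
          -- assert (Hn := Cminus_neq0 w v Hwv). assert (Hn' := proj1 (Cmod_gt_0 _) Hn).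
             rewrite Cmod_div, Cmod_pow by exact Hn.
             apply (Rmult_le_reg_r (Cmod (w - v))); [exact Hn'|].
             unfold Rdiv. rewrite Rmult_assoc, Rinv_l, Rmult_1_r by lra.
             apply Rle_trans with ((L * Cmod (w - v)) ^ 3); [|right; ring].
             apply pow_incr. split; [apply Cmod_ge_0 | exact Hlip].
      + apply cdiff_div; [apply cdiff_pow, Hshift | | apply Cminus_neq0, Hxv].
        apply cdiff_minus; [apply cdiff_id | apply cdiff_const].
    - intros x Hx.
      assert (Hxv : / 2 <= Cmod (x - v)) by (generalize (Cmod_triangle' x v); lra).
      assert (Hn : (x - v)%C <> 0) by (apply Cmod_gt_0; lra).
      rewrite Cmod_div, Cmod_pow by exact Hn.
      assert (HMx : Cmod (G (z + x)%C) <= M).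
      { apply HM. replace (z + x - z)%C with x by ring. lra. }
      apply (Rmult_le_reg_r (Cmod (x - v))); [lra|].
      unfold Rdiv. rewrite Rmult_assoc, Rinv_l, Rmult_1_r by lra.
      assert (Cmod (G (z + x)%C) ^ 3 <= M ^ 3) by (apply pow_incr; split; [apply Cmod_ge_0 | exact HMx]).
      assert (0 <= Cmod (G (z + x)%C) ^ 3) by (apply pow_le, Cmod_ge_0). nra. }
  replace (z + 0)%C with z in H0 by ring. replace (0 - v)%C with (- v)%C in H0 by ring.
  unfold Cdiv in H0. rewrite Cmod_mult, Cmod_pow, Cmod_inv, Cmod_opp, Hv in H0.
  2:{ intros E. apply Hv0. replace v with (- - v)%C by ring. rewrite E. ring. }
  apply (Rmult_le_compat_r (Cmod (z - s))) in H0; [|lra].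
  rewrite Rmult_assoc, Rinv_l, Rmult_1_r in H0 by lra. exact H0.
Qed.

Fixpoint Rsum (n : nat) (u : nat -> R) : R :=
  match n with O => 0 | S n => Rsum n u + u n end.

Lemma Rsum_le_Series (u : nat -> R) (n : nat) : (forall i, 0 <= u i) -> ex_series u ->
  0 <= Rsum n u <= Series u.
Proof.
  intros Hu He.
  assert (H0 : forall n, 0 <= Rsum n u).
  { intros k. induction k as [|k IH]; simpl; [lra | specialize (Hu k); lra]. }
  split; [apply H0|].
  assert (Es : forall n, sum_n u n = Rsum (S n) u).
  { intros k. induction k as [|k IH].
    - rewrite sum_O. simpl. ring.
    - rewrite sum_Sn, IH. reflexivity. }
  assert (Hle : Rsum (S n) u <= Series u).
  { rewrite <- Es. apply (is_lim_seq_incr_compare (sum_n u)).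
    - apply (Series_correct u He).
    - intros k. rewrite !Es. simpl. specialize (Hu (S k)). lra. }
  simpl in Hle. specialize (Hu n). lra.
Qed.

(* Meaningful on the right half plane [0 < fst w] only. *)
Definition clog (w : C) : C := (ln (Cmod w), atan (snd w / fst w)).

Lemma cexp_clog (w : C) : 0 < fst w -> cexp (clog w) = w.
Proof.
  intros Hw. destruct w as [x y]. simpl in Hw. unfold cexp, clog. simpl.
  assert (Hm : 0 < Cmod (x, y)).
  { apply Cmod_gt_0. intros E. apply (f_equal fst) in E. simpl in E. lra. }
  rewrite exp_ln by exact Hm. rewrite cos_atan, sin_atan.
  assert (E : Cmod (x, y) = x * sqrt (1 + (y / x)²)).
  { unfold Cmod. simpl. rewrite <- (sqrt_Rsqr x) at 3 by lra.
    rewrite <- sqrt_mult_alt by apply Rle_0_sqr. f_equal. unfold Rsqr. field. lra. }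
  assert (Hs : 0 < sqrt (1 + (y / x)²)) by (apply sqrt_lt_R0; generalize (Rle_0_sqr (y / x)); lra).
  rewrite E. f_equal; field; lra.
Qed.

Lemma clog_cis (rho phi : R) : 0 < rho -> - (PI / 2) < phi < PI / 2 ->
  clog (rho * cis phi)%C = (ln rho, phi).
Proof.
  intros Hr Hphi. unfold clog. f_equal.
  - rewrite Cmod_mult, Cmod_cis, Cmod_R, Rabs_pos_eq by lra. f_equal. ring.
  - rewrite <- (atan_tan phi) at 3 by exact Hphi. f_equal. unfold tan. simpl.
    assert (0 < cos phi) by (apply cos_gt_0; lra). field. lra.
Qed.

Lemma ccont_clog (w0 : C) : 0 < fst w0 -> ccont clog w0.
Proof.
  intros Hw0 e He.
  assert (Hm : 0 < Cmod w0).
  { apply Cmod_gt_0. intros E. apply (f_equal fst) in E. simpl in E. lra. }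
  assert (Hl : continuous ln (Cmod w0)).
  { apply continuity_pt_filterlim, derivable_continuous_pt.
    exists (/ Cmod w0). apply derivable_pt_lim_ln, Hm. }
  assert (Ha : continuous atan (snd w0 / fst w0)).
  { apply continuity_pt_filterlim, derivable_continuous_pt, derivable_pt_atan. }
  destruct (proj1 (continuous_eps _ _) Hl (e / 2)) as [d1 [Hd1 H1]]; [lra|].
  destruct (proj1 (continuous_eps _ _) Ha (e / 2)) as [d2 [Hd2 H2]]; [lra|].
  destruct w0 as [x0 y0]. simpl in *.
  (* A Lipschitz constant at [(x0, y0)] of the quotient [y / x], valid while $x>x_0/2$. *)
  set (Y := 2 * (x0 + Rabs y0) / (x0 * x0)).
  assert (Hy0 := Rabs_pos y0).
  assert (HY : 0 < Y) by (apply Rdiv_lt_0_compat; nra).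
  exists (Rmin d1 (Rmin (x0 / 2) (d2 / Y))).
  split; [repeat apply Rmin_glb_lt; try lra; apply Rdiv_lt_0_compat; lra|].
  intros [x y] Hw.
  assert (W1 : Cmod ((x, y) - (x0, y0)) < d1) by (eapply Rlt_le_trans; [apply Hw | apply Rmin_l]).
  assert (W2 : Cmod ((x, y) - (x0, y0)) < x0 / 2)
    by (eapply Rlt_le_trans; [apply Hw | eapply Rle_trans; [apply Rmin_r | apply Rmin_l]]).
  assert (W3 : Cmod ((x, y) - (x0, y0)) < d2 / Y)
    by (eapply Rlt_le_trans; [apply Hw | eapply Rle_trans; [apply Rmin_r | apply Rmin_r]]).
  assert (Fx : Rabs (x - x0) <= Cmod ((x, y) - (x0, y0))) by apply (abs_fst_le ((x, y) - (x0, y0))).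
  assert (Fy : Rabs (y - y0) <= Cmod ((x, y) - (x0, y0))) by apply (abs_snd_le ((x, y) - (x0, y0))).
  set (r := Cmod ((x, y) - (x0, y0))) in *.
  assert (Hx : x0 / 2 < x) by (assert (Rabs (x - x0) < x0 / 2) by lra; apply Rabs_lt_between in H; lra).
  replace (clog (x, y) - clog (x0, y0))%C with
    ((ln (Cmod (x, y)) - ln (Cmod (x0, y0)), atan (y / x) - atan (y0 / x0)) : C)
    by (unfold clog; apply injective_projections; simpl; ring).
  eapply Rle_lt_trans; [apply Cmod_le_abs|].
  assert (B1 : Rabs (ln (Cmod (x, y)) - ln (Cmod (x0, y0))) < e / 2).
  { apply H1. assert (K1 := Cmod_triangle' (x, y) (x0, y0)).
    assert (K2 := Cmod_triangle' (x0, y0) (x, y)). rewrite (Cmod_minus_sym (x0, y0)) in K2.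
    fold r in K1, K2. apply Rabs_lt_between. lra. }
  assert (B2 : Rabs (atan (y / x) - atan (y0 / x0)) < e / 2).
  { apply H2. replace (y / x - y0 / x0) with (((y - y0) * x0 + - y0 * (x - x0)) / (x * x0)) by (field; lra).
    unfold Rdiv. rewrite Rabs_mult, Rabs_inv, (Rabs_pos_eq (x * x0)) by nra.
    apply Rle_lt_trans with (Y * r).
    - unfold Y. apply (Rmult_le_reg_r (x * x0)); [nra|].
      rewrite Rmult_assoc, Rinv_l, Rmult_1_r by nra.
      eapply Rle_trans; [apply Rabs_triang|]. rewrite !Rabs_mult, Rabs_Ropp, (Rabs_pos_eq x0) by lra.
      apply Rle_trans with ((x0 + Rabs y0) * r); [nra|].
      replace (2 * (x0 + Rabs y0) / (x0 * x0) * r * (x * x0)) with ((x0 + Rabs y0) * r * (2 * x / x0))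
        by (field; lra).
      assert (1 <= 2 * x / x0).
      { apply (Rmult_le_reg_r x0); [lra|]. unfold Rdiv. rewrite Rmult_assoc, Rinv_l by lra. lra. }
      assert (0 <= (x0 + Rabs y0) * r) by (apply Rmult_le_pos; [lra | apply Cmod_ge_0]). nra.
    - apply (Rmult_lt_compat_l Y) in W3; [|exact HY].
      replace (Y * (d2 / Y)) with d2 in W3 by (field; lra). exact W3. }
  lra.
Qed.

(** Inverse function argument: with [v = clog w - clog w0] one has $w=w_0e^v$, and $|e^v-1-v|\le
    e'|v|$ with $e'\le1/2$ gives $|v|\le2|e^v-1|$, which turns the error into a small multiple of
    $|w-w_0|$. *)
Lemma cdiff_clog (w0 : C) : 0 < fst w0 -> cdiff clog w0.
Proof.
  intros Hw0.
  assert (Hn : w0 <> 0) by (intros E; apply (f_equal fst) in E; simpl in E; lra).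
  assert (Hm := proj1 (Cmod_gt_0 _) Hn).
  apply (cdiff_of_eps clog w0 (/ w0)). intros e He.
  set (e' := Rmin (/ 2) (e * Cmod w0 / 2)).
  assert (He' : 0 < e') by (apply Rmin_glb_lt; [lra | assert (0 < e * Cmod w0) by nra; lra]).
  assert (He1 : e' <= / 2) by apply Rmin_l.
  assert (He2 : e' <= e * Cmod w0 / 2) by apply Rmin_r.
  destruct (cexp_lin e' He') as [d1 [Hd1 H1]].
  destruct (ccont_clog w0 Hw0 d1 Hd1) as [d2 [Hd2 H2]].
  exists (Rmin d2 (fst w0)). split; [apply Rmin_glb_lt; assumption|]. intros w Hw.
  destruct (Rmin_Rgt_l _ _ _ Hw) as [W1 W2].
  assert (Hf : 0 < fst w).
  { assert (K : Rabs (fst w - fst w0) <= Cmod (w - w0)) by apply (abs_fst_le (w - w0)).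
    apply Rabs_le_between in K. lra. }
  set (v := (clog w - clog w0)%C).
  assert (Ew : w = (w0 * cexp v)%C).
  { rewrite <- (cexp_clog w0 Hw0) at 1. rewrite <- cexp_plus. unfold v.
    replace (clog w0 + (clog w - clog w0))%C with (clog w) by ring. symmetry. apply cexp_clog, Hf. }
  specialize (H1 v (H2 w W1)).
  assert (E2 : (/ w0 * (w - w0))%C = (cexp v - 1)%C).
  { rewrite Ew at 1. field. exact Hn. }
  assert (Hvv : Cmod (v - (cexp v - 1)) <= e' * Cmod v).
  { rewrite Cmod_minus_sym. replace (cexp v - 1 - v)%C with (cexp v - 1 - v)%C by ring. exact H1. }
  assert (Hv : Cmod v <= 2 * Cmod (cexp v - 1)).
  { assert (K := Cmod_triangle' v (cexp v - 1)). generalize (Cmod_ge_0 v). nra. }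
  assert (Hc : Cmod (cexp v - 1) * Cmod w0 = Cmod (w - w0)).
  { rewrite <- E2, Cmod_mult, Cmod_inv by exact Hn. field. lra. }
  rewrite E2. eapply Rle_trans; [apply Hvv|]. rewrite <- Hc.
  apply Rle_trans with (e * Cmod w0 / 2 * (2 * Cmod (cexp v - 1))).
  - apply Rmult_le_compat; try lra. apply Cmod_ge_0.
  - right. field.
Qed.

(** * Growth in sectors *)

Lemma Rpower_exp (r s : R) : 0 < r -> exp (s * ln r) = Rpower r s.
Proof. reflexivity. Qed.

(** The map $z\mapsto p+e\exp z$ turns the strip into the sector, and order [K] into the growth
    $\exp(Xe^{K|x|})$ that the principle for strips permits. [F] is divided by $\exp(C'(1+e^{\sigma
    z}))$; since $\cos\sigma y\ge c>0$ in the strip, $C'=C_s/c$ absorbs the bound on the sides. *)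
Lemma sector_phragmen_lindelof (F : C -> C) (A K : R) (p e : C) (al sigma Cs : R) :
  (forall z, cdiff F z) -> 0 <= A -> 0 <= K ->
  (forall z, Cmod (F z) <= exp (A * Rpower (1 + Cmod z) K)) ->
  Cmod e = 1 -> 0 < al -> 0 < sigma -> sigma * al < PI / 2 -> K * al < PI / 2 -> 0 <= Cs ->
  (forall r phi, 0 < r -> Rabs phi = al ->
     Cmod (F (p + e * (r * cis phi))%C) <= exp (Cs * (1 + Rpower r sigma))) ->
  exists C', 0 <= C' /\ forall r phi, 0 < r -> Rabs phi <= al ->
     Cmod (F (p + e * (r * cis phi))%C) <= exp (C' * (1 + Rpower r sigma)).
Proof.
  intros HF HA HK Hgrow He Hal Hsig Hsal HKal HCs Hside. assert (Hpi := PI_RGT_0).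
  set (c := cos (sigma * al)).
  assert (Hc : 0 < c <= 1).
  { split; [apply cos_gt_0; nra | apply COS_bound]. }
  set (C' := Cs / c).
  assert (HC' : Cs <= C' * c) by (unfold C'; right; field; lra).
  assert (HC0 : 0 <= C') by (apply Rmult_le_pos; [exact HCs | left; apply Rinv_0_lt_compat; lra]).
  assert (HCC : Cs <= C') by nra.
  exists C'. split; [exact HC0|].
  set (E := fun z => cexp (- RtoC C' * (1 + cexp (RtoC sigma * z)))%C).
  assert (HE : forall x y, Cmod (E (x, y)) = exp (- (C' * (1 + exp (sigma * x) * cos (sigma * y))))).
  { intros x y. unfold E. rewrite Cmod_cexp. f_equal. simpl.
    replace (sigma * x - 0 * y) with (sigma * x) by ring.
    replace (sigma * y + 0 * x) with (sigma * y) by ring. ring. }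
  set (G := fun z => (F (p + e * cexp z) * E z)%C).
  assert (Hcos : forall y, Rabs y <= al -> c <= cos (sigma * y)).
  { intros y Hy. apply cos_ge_on; [|nra]. rewrite Rabs_mult, Rabs_pos_eq by lra.
    apply Rmult_le_compat_l; lra. }
  assert (Hcis : forall x y, cexp (x, y) = (exp x * cis y)%C) by (intros; apply cexp_cis).
  (* The principle needs an exponent strictly between [K] and [PI / (2 * al)]; this is their
     midpoint. *)
  set (k := (K + PI / (2 * al)) / 2).
  assert (HKp : K < PI / (2 * al)).
  { apply (Rmult_lt_reg_r al); [exact Hal|].
    replace (PI / (2 * al) * al) with (PI / 2) by (field; lra). exact HKal. }
  assert (HG : forall z, Rabs (snd z) <= al -> Cmod (G z) <= 1).
  { apply (phragmen_lindelof_strip G al (A * Rpower (2 + Cmod p) K) K k); try assumption.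
    - unfold k. lra.
    - unfold k. apply Rlt_le_trans with (PI / (2 * al) * al); [|right; field; lra].
      apply Rmult_lt_compat_r; lra.
    - intros z _. unfold G, E. apply cdiff_mult.
      + apply (cdiff_comp F (fun z => p + e * cexp z)%C); [|apply HF].
        apply cdiff_plus; [apply cdiff_const | apply cdiff_scal, cdiff_cexp].
      + apply (cdiff_comp cexp); [|apply cdiff_cexp]. apply cdiff_scal.
        apply cdiff_plus; [apply cdiff_const|].
        apply (cdiff_comp cexp); [apply cdiff_scal, cdiff_id | apply cdiff_cexp].
    - intros [x y] Hz. simpl in Hz. unfold G. rewrite Cmod_mult, HE, Hcis.
      assert (H1 := Hside (exp x) y (exp_pos x) Hz).
      replace (Rpower (exp x) sigma) with (exp (sigma * x)) in H1 by (unfold Rpower; rewrite ln_exp; reflexivity).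
      apply Rle_trans with (exp (Cs * (1 + exp (sigma * x))) * exp (- (C' * (1 + exp (sigma * x) * cos (sigma * y))))).
      + apply Rmult_le_compat_r; [left; apply exp_pos | exact H1].
      + rewrite <- exp_plus. apply exp_le_1.
        assert (H2 := Hcos y ltac:(lra)). assert (H3 := exp_pos (sigma * x)).
        assert (Cs * exp (sigma * x) <= C' * (exp (sigma * x) * cos (sigma * y))); [|lra].
        apply Rle_trans with (C' * c * exp (sigma * x)); [apply Rmult_le_compat_r; lra|].
        rewrite Rmult_assoc. apply Rmult_le_compat_l; [exact HC0|]. nra.
    - intros [x y] Hz. simpl in Hz. unfold G. simpl fst. rewrite Cmod_mult, HE, Hcis.
      apply Rle_trans with (exp (A * Rpower (2 + Cmod p) K * exp (K * Rabs x)) * 1).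
      + apply Rmult_le_compat; [apply Cmod_ge_0 | left; apply exp_pos | |].
        * eapply Rle_trans; [apply Hgrow|]. apply exp_mono. rewrite Rmult_assoc.
          apply Rmult_le_compat_l; [exact HA|].
          replace (exp (K * Rabs x)) with (Rpower (exp (Rabs x)) K) by (unfold Rpower; rewrite ln_exp; reflexivity).
          assert (Hp := Cmod_ge_0 p). assert (Hx := exp_pos (Rabs x)).
          rewrite Rpower_mult_distr by lra.
          assert (Hmz : Cmod (p + e * (exp x * cis y)) <= Cmod p + exp x).
          { eapply Rle_trans; [apply Cmod_triangle|]. rewrite !Cmod_mult, He, Cmod_cis, Cmod_R.
            rewrite Rabs_pos_eq by (left; apply exp_pos). lra. }
          apply Rle_Rpower_l; [exact HK|].
          assert (Hxx := exp_mono _ _ (Rle_abs x)). assert (Hx1 := exp_ge_1 _ (Rabs_pos x)).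
          generalize (Cmod_ge_0 (p + e * (exp x * cis y))). nra.
        * apply exp_le_1.
          assert (H2 := Hcos y ltac:(lra)). assert (H3 := exp_pos (sigma * x)).
          assert (0 <= C' * (1 + exp (sigma * x) * cos (sigma * y))); [|lra].
          apply Rmult_le_pos; [exact HC0 | nra].
      + lra. }
  intros r phi Hr Hphi.
  assert (H := HG (ln r, phi) Hphi). unfold G in H. rewrite Cmod_mult, HE, Hcis, exp_ln in H by exact Hr.
  assert (Hcs := COS_bound (sigma * phi)).
  set (T := C' * (1 + exp (sigma * ln r) * cos (sigma * phi))) in *.
  apply (Rmult_le_compat_r (exp T)) in H; [|left; apply exp_pos].
  rewrite Rmult_assoc, <- exp_plus in H. replace (- T + T) with 0 in H by ring.
  rewrite exp_0 in H. rewrite Rmult_1_l, Rmult_1_r in H.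
  eapply Rle_trans; [apply H|]. apply exp_mono. unfold T. rewrite Rpower_exp by exact Hr.
  apply Rmult_le_compat_l; [exact HC0|]. generalize (exp_pos (sigma * ln r)). rewrite Rpower_exp by exact Hr. nra.
Qed.

Lemma growth_of_polar_growth (F : C -> C) (p e : C) (sigma Cs : R) : Cmod e = 1 -> 0 <= sigma -> 0 <= Cs ->
  (forall r phi, 0 < r -> - PI < phi <= PI ->
     Cmod (F (p + e * (r * cis phi))%C) <= exp (Cs * (1 + Rpower r sigma))) ->
  exists C', 0 <= C' /\ forall z, Cmod (F z) <= exp (C' * Rpower (1 + Cmod z) sigma).
Proof.
  intros He Hs HCs H.
  set (P := Rpower (1 + Cmod p) sigma). assert (Hp := Cmod_ge_0 p).
  assert (HP : 1 <= P) by (apply Rpower_ge_1; lra).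
  (* For [z = p] only, which polar coordinates with [0 < r] leave out. *)
  set (C1 := Rmax 0 (ln (Cmod (F p)))).
  assert (HC1 : 0 <= C1) by apply Rmax_l.
  exists (Cs * (1 + P) + C1). split; [apply Rplus_le_le_0_compat; [apply Rmult_le_pos; lra | exact HC1]|].
  intros z. assert (Hz := Cmod_ge_0 z).
  assert (H1 : 1 <= Rpower (1 + Cmod z) sigma) by (apply Rpower_ge_1; lra).
  set (Y := Rpower (1 + Cmod z) sigma) in *.
  assert (He0 : e <> 0) by (apply Cmod_gt_0; lra).
  destruct (Ceq_dec z p) as [->|Hne].
  - apply Rle_trans with (exp C1).
    + destruct (Req_dec (Cmod (F p)) 0) as [E|E]; [rewrite E; left; apply exp_pos|].
      rewrite <- (exp_ln (Cmod (F p))) by (generalize (Cmod_ge_0 (F p)); lra).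
      apply exp_mono, Rmax_r.
    + apply exp_mono. assert (0 <= Cs * (1 + P)) by (apply Rmult_le_pos; lra). nra.
  - destruct (polar ((z - p) / e)) as [phi [Hphi E]].
    set (r := Cmod ((z - p) / e)) in *.
    assert (Er : r = Cmod (z - p)) by (unfold r; rewrite Cmod_div, He by exact He0; field).
    assert (Hr : 0 < r) by (rewrite Er; apply Cmod_gt_0, Cminus_neq0, Hne).
    assert (Hzr : z = (p + e * (r * cis phi))%C) by (rewrite <- E; field; exact He0).
    rewrite Hzr at 1. eapply Rle_trans; [apply (H r phi Hr Hphi)|]. apply exp_mono.
    assert (Hpow : Rpower r sigma <= P * Y).
    { unfold P, Y. rewrite Rpower_mult_distr by lra. apply Rle_Rpower_l; [exact Hs|].
      split; [exact Hr|]. rewrite Er. eapply Rle_trans; [apply Cmod_triangle|].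
      rewrite Cmod_opp. nra. }
    assert (Cs * Rpower r sigma <= Cs * (P * Y)) by (apply Rmult_le_compat_l; assumption).
    assert (Cs <= Cs * Y) by nra. assert (0 <= C1 * Y) by nra. nra.
Qed.

Lemma sublinear_Rpower (sigma eps : R) : 0 < sigma < 1 -> 0 < eps ->
  exists A, forall x, 1 <= x -> Rpower x sigma <= A + eps * x.
Proof.
  intros Hs He.
  (* The point where $x^{\sigma-1}=\varepsilon$; beyond it the power is at most [eps * x]. *)
  set (x0 := Rpower eps (- / (1 - sigma))).
  exists (Rpower x0 sigma). intros x Hx.
  assert (Hx0 : 0 < x0) by apply exp_pos.
  destruct (Rle_dec x x0) as [Hle|Hle].
  - assert (Rpower x sigma <= Rpower x0 sigma) by (apply Rle_Rpower_l; lra).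
    assert (0 < eps * x) by nra. lra.
  - assert (E : Rpower x sigma = Rpower x (sigma - 1) * x).
    { rewrite <- (Rpower_1 x) at 3 by lra. rewrite <- Rpower_plus. f_equal. ring. }
    assert (Hd : Rpower x (sigma - 1) <= eps).
    { replace (sigma - 1) with (- (1 - sigma)) by ring. rewrite Rpower_Ropp.
      assert (K : Rpower x0 (1 - sigma) <= Rpower x (1 - sigma)) by (apply Rle_Rpower_l; lra).
      unfold x0 in K at 1. rewrite Rpower_mult in K.
      replace (- / (1 - sigma) * (1 - sigma)) with (- (1)) in K by (field; lra).
      rewrite Rpower_Ropp, Rpower_1 in K by exact He.
      rewrite <- (Rinv_inv eps). apply Rinv_le_contravar; [apply Rinv_0_lt_compat, He | exact K]. }
    rewrite E. assert (0 < Rpower x0 sigma) by apply exp_pos. nra.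
Qed.

(** The squared distance is at least $r^2+s^2-2rs\cos d=(r-s\cos d)^2+s^2\sin^2d$, that is, the
    point [s * cis y] sees every point of the ray at distance at least $s\sin d$. *)
Lemma sector_separation (r s x y d : R) : 0 <= r -> 0 <= s -> 0 < d < PI ->
  cos (x - y) <= cos d -> s <= / sin d * Cmod (r * cis x - s * cis y).
Proof.
  intros Hr Hs Hd Hcos.
  assert (Hsd : 0 < sin d) by (apply sin_gt_0; lra).
  apply (Rmult_le_reg_l (sin d)); [exact Hsd|].
  rewrite <- Rmult_assoc, Rinv_r, Rmult_1_l by lra.
  apply Rsqr_incr_0_var; [|apply Cmod_ge_0]. unfold Rsqr.
  assert (E := cis_dist2 r s x y). simpl in E. rewrite Rmult_1_r in E. rewrite E.
  assert (E2 := sin2_cos2 d). unfold Rsqr in E2.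
  assert (Hsq := Rle_0_sqr (r - s * cos d)). unfold Rsqr in Hsq.
  assert (0 <= (r * s) * (cos d - cos (x - y))) by (apply Rmult_le_pos; [apply Rmult_le_pos; assumption | lra]).
  assert (Es : sin d * sin d = 1 - cos d * cos d) by lra.
  replace (sin d * s * (sin d * s)) with ((sin d * sin d) * (s * s)) by ring. rewrite Es. lra.
Qed.

Lemma cis_PI2 : cis (PI / 2) = Ci.
Proof. unfold cis. rewrite cos_PI2, sin_PI2. reflexivity. Qed.

Lemma sin_ge_on (x al : R) : 0 <= al <= PI / 2 -> al <= x <= PI - al -> sin al <= sin x.
Proof.
  intros Hal Hx. rewrite <- (cos_shift al), <- (cos_shift x).
  apply cos_ge_on; [apply Rabs_le; lra | lra].
Qed.

(** * Regularized Cauchy transforms *)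

Definition csummable (u : nat -> C) : Prop := ex_series (fun n => Cmod (u n)).

(** To be read as a sum under [csummable] only; [Series] assigns some value to every sequence. *)
Definition Cser (u : nat -> C) : C := (Series (fun n => fst (u n)), Series (fun n => snd (u n))).

Lemma csummable_le (u : nat -> C) (v : nat -> R) :
  (forall n, Cmod (u n) <= v n) -> ex_series v -> csummable u.
Proof.
  intros H Hv. apply (ex_series_le (V := R_CompleteNormedModule) _ v); [|exact Hv].
  intros n. change (Rabs (Cmod (u n)) <= v n). rewrite Rabs_pos_eq by apply Cmod_ge_0. apply H.
Qed.

Lemma csummable_fst (u : nat -> C) : csummable u -> ex_series (fun n => fst (u n)).
Proof.
  intros H. apply (ex_series_le (V := R_CompleteNormedModule) _ (fun n => Cmod (u n))); [|exact H].
  intros n. apply abs_fst_le.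
Qed.

Lemma csummable_snd (u : nat -> C) : csummable u -> ex_series (fun n => snd (u n)).
Proof.
  intros H. apply (ex_series_le (V := R_CompleteNormedModule) _ (fun n => Cmod (u n))); [|exact H].
  intros n. apply abs_snd_le.
Qed.

Lemma Cser_ext (u v : nat -> C) : (forall n, u n = v n) -> Cser u = Cser v.
Proof. intros H. unfold Cser. f_equal; apply Series_ext; intros n; rewrite H; reflexivity. Qed.

Lemma Cser_plus (u v : nat -> C) : csummable u -> csummable v ->
  Cser (fun n => u n + v n)%C = (Cser u + Cser v)%C.
Proof.
  intros Hu Hv. unfold Cser. apply injective_projections; simpl.
  - apply (Series_plus (fun n => fst (u n)) (fun n => fst (v n))); apply csummable_fst; assumption.
  - apply (Series_plus (fun n => snd (u n)) (fun n => snd (v n))); apply csummable_snd; assumption.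
Qed.

Lemma csummable_plus (u v : nat -> C) : csummable u -> csummable v ->
  csummable (fun n => u n + v n)%C.
Proof.
  intros Hu Hv. apply csummable_le with (fun n => Cmod (u n) + Cmod (v n)).
  - intros n. apply Cmod_triangle.
  - apply (ex_series_plus _ _ Hu Hv).
Qed.

Lemma csummable_scal (c : C) (u : nat -> C) : csummable u -> csummable (fun n => c * u n)%C.
Proof.
  intros Hu. apply csummable_le with (fun n => Cmod c * Cmod (u n)).
  - intros n. rewrite Cmod_mult. lra.
  - apply (ex_series_scal (Cmod c) _ Hu).
Qed.

Lemma Cser_scal (c : C) (u : nat -> C) : csummable u ->
  Cser (fun n => c * u n)%C = (c * Cser u)%C.
Proof.
  intros Hu. assert (Hf := csummable_fst u Hu). assert (Hs := csummable_snd u Hu).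
  unfold Cser. apply injective_projections; simpl.
  - rewrite <- !Series_scal_l. rewrite <- Series_minus; [reflexivity | |].
    + apply (ex_series_scal (fst c) _ Hf).
    + apply (ex_series_scal (snd c) _ Hs).
  - rewrite <- !Series_scal_l. rewrite <- Series_plus; [reflexivity | |].
    + apply (ex_series_scal (fst c) _ Hs).
    + apply (ex_series_scal (snd c) _ Hf).
Qed.

(** The sum is rotated onto the positive axis, so that the triangle inequality for a real series
    suffices. *)
Lemma Cmod_Cser_le (u : nat -> C) : csummable u -> Cmod (Cser u) <= Series (fun n => Cmod (u n)).
Proof.
  intros Hu. destruct (Ceq_dec (Cser u) 0) as [E|E].
  - rewrite E, Cmod_0. replace 0 with (0 * Series (fun n => Cmod (u n))) by ring.
    rewrite <- Series_scal_l. apply Series_le; [|exact Hu].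
    intros n. generalize (Cmod_ge_0 (u n)). lra.
  - assert (Hm := proj1 (Cmod_gt_0 _) E).
    set (k := (Cmod (Cser u) / Cser u)%C).
    assert (Hk : Cmod k = 1).
    { unfold k. rewrite Cmod_div, Cmod_R, Rabs_pos_eq by (auto; lra). field. lra. }
    assert (Ek : (k * Cser u)%C = Cmod (Cser u)) by (unfold k; field; exact E).
    rewrite <- (Cser_scal k u Hu) in Ek. apply (f_equal fst) in Ek.
    assert (Hf : fst (RtoC (Cmod (Cser u))) = Cmod (Cser u)) by reflexivity.
    rewrite <- Hf at 1. rewrite <- Ek. simpl.
    eapply Rle_trans; [apply Rle_abs|].
    assert (Hks : csummable (fun n => k * u n)%C) by (apply csummable_scal, Hu).
    eapply Rle_trans.
    + apply (Series_Rabs (fun n => fst (k * u n)%C)).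
      apply (ex_series_le (V := R_CompleteNormedModule) _ (fun n => Cmod (k * u n))); [|exact Hks].
      intros n. change (Rabs (Rabs (fst (k * u n)%C)) <= Cmod (k * u n)). rewrite Rabs_Rabsolu. apply abs_fst_le.
    + apply Series_le; [|exact Hu]. intros n. split; [apply Rabs_pos|].
      eapply Rle_trans; [apply abs_fst_le|]. rewrite Cmod_mult, Hk. lra.
Qed.

Section Cauchy.
Variable t : nat -> C.
Hypothesis t_neq0 : forall n, t n <> 0.
Hypothesis t_inf : forall M, exists N, forall n, (N <= n)%nat -> M < Cmod (t n).

Definition off (z : C) : Prop := forall n, z <> t n.

(* Uniformly for [w] near [z], apart from the index with [t n = z] (if any). *)
Lemma poles_separated (z : C) : exists X d, 0 <= X /\ 0 < d <= 1 /\
  forall w n, Cmod (w - z) < d -> t n <> z -> 1 + Cmod (t n) <= X * Cmod (w - t n).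
Proof.
  (* Poles with $|t_n|>2|z|+4$ satisfy the bound with constant 4; the finitely many others are
     collected by induction. *)
  destruct (t_inf (2 * Cmod z + 4)) as [N HN].
  assert (Hfin : forall N, exists X d, 0 <= X /\ 0 < d <= 1 /\ forall w n, (n < N)%nat ->
    Cmod (w - z) < d -> t n <> z -> 1 + Cmod (t n) <= X * Cmod (w - t n)).
  { clear N HN. induction N as [|N [X [d [HX [Hd H]]]]].
    - exists 0, 1. repeat split; try lra. intros; lia.
    - destruct (Ceq_dec (t N) z) as [E|E].
      + exists X, d. repeat split; try lra. intros w n Hn Hw Hne.
        apply H; auto. assert (n <> N) by congruence. lia.
      + set (r := Cmod (t N - z)).
        assert (Hr : 0 < r) by (apply Cmod_gt_0, Cminus_neq0, E).
        assert (Ht := Cmod_ge_0 (t N)).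
        exists (Rmax X (2 * (1 + Cmod (t N)) / r)), (Rmin d (r / 2)).
        split; [eapply Rle_trans; [apply HX | apply Rmax_l]|].
        split; [split; [apply Rmin_glb_lt; lra | eapply Rle_trans; [apply Rmin_l | lra]]|].
        intros w n Hn Hw Hne.
        destruct (Rmin_Rgt_l _ _ _ Hw) as [Hw1 Hw2].
        destruct (Nat.eq_dec n N) as [->|HnN].
        * assert (Hd2 : r / 2 <= Cmod (w - t N)).
          { assert (K := Cmod_triangle_minus (t N) w z). fold r in K.
            rewrite (Cmod_minus_sym (t N) w) in K. lra. }
          apply Rle_trans with (2 * (1 + Cmod (t N)) / r * (r / 2)); [right; field; lra|].
          apply Rmult_le_compat; try lra.
          -- left. apply Rdiv_lt_0_compat; lra.
          -- apply Rmax_r.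
        * eapply Rle_trans; [apply (H w n); auto; lia|].
          apply Rmult_le_compat_r; [apply Cmod_ge_0 | apply Rmax_l]. }
  destruct (Hfin N) as [X [d [HX [Hd H]]]].
  exists (Rmax X 4), d. split; [eapply Rle_trans; [apply HX | apply Rmax_l]|]. split; [exact Hd|].
  intros w n Hw Hne. destruct (Nat.lt_ge_cases n N) as [Hn|Hn].
  - eapply Rle_trans; [apply (H w n); auto|].
    apply Rmult_le_compat_r; [apply Cmod_ge_0 | apply Rmax_l].
  - specialize (HN n Hn). assert (Hz := Cmod_ge_0 z).
    assert (K1 := Cmod_triangle' (t n) w). rewrite Cmod_minus_sym in K1.
    assert (K2 := Cmod_triangle' w z).
    apply Rle_trans with (4 * Cmod (w - t n)); [lra|].
    apply Rmult_le_compat_r; [apply Cmod_ge_0 | apply Rmax_r].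
Qed.

Lemma poles_separated_off (z : C) : off z -> exists X, 0 <= X /\
  forall n, 1 + Cmod (t n) <= X * Cmod (z - t n).
Proof.
  intros Hz. destruct (poles_separated z) as [X [d [HX [Hd H]]]]. exists X. split; [exact HX|].
  intros n. apply H; [rewrite Cmod_self; lra|]. intros E. apply (Hz n). auto.
Qed.

Lemma off_minus_neq0 (z : C) (n : nat) : off z -> (z - t n)%C <> 0.
Proof. intros H. apply Cminus_neq0, H. Qed.

(** The form in which distance from the poles is stated below. Since [t n] is nonzero, it already
    excludes that [z] is a pole. *)
Lemma off_of_bound (z : C) (X : R) : (forall n, Cmod (t n) <= X * Cmod (z - t n)) -> off z.
Proof.
  intros H n E. specialize (H n). rewrite E, Cmod_self in H.
  generalize (proj1 (Cmod_gt_0 _) (t_neq0 n)). lra.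
Qed.

Section Transform.
Variable c : nat -> C.
Hypothesis c_sum : ex_series (fun n => Cmod (c n) / Cmod (t n)).

Definition simple_sum (z : C) : C := Cser (fun n => c n / (z - t n))%C.

Lemma simple_term_le (z : C) (X : R) (n : nat) : 0 <= X -> off z ->
  Cmod (t n) <= X * Cmod (z - t n) ->
  Cmod (c n / (z - t n)) <= X * (Cmod (c n) / Cmod (t n)).
Proof.
  intros HX Hz H. assert (Hn := off_minus_neq0 z n Hz).
  rewrite Cmod_div by exact Hn. apply Cmod_gt_0 in Hn.
  assert (Ht := proj1 (Cmod_gt_0 _) (t_neq0 n)).
  assert (Hi : / Cmod (z - t n) <= X / Cmod (t n)).
  { apply (Rmult_le_reg_r (Cmod (z - t n) * Cmod (t n))); [nra|].
    replace (/ Cmod (z - t n) * (Cmod (z - t n) * Cmod (t n))) with (Cmod (t n)) by (field; lra).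
    replace (X / Cmod (t n) * (Cmod (z - t n) * Cmod (t n))) with (X * Cmod (z - t n)) by (field; lra).
    exact H. }
  unfold Rdiv in *. apply Rle_trans with (Cmod (c n) * (X * / Cmod (t n))).
  - apply Rmult_le_compat_l; [apply Cmod_ge_0 | exact Hi].
  - right. ring.
Qed.

Lemma simple_summable (z : C) : off z -> csummable (fun n => c n / (z - t n))%C.
Proof.
  intros Hz. destruct (poles_separated_off z Hz) as [X [HX H]].
  apply csummable_le with (fun n => X * (Cmod (c n) / Cmod (t n))).
  - intros n. apply simple_term_le; auto. specialize (H n). lra.
  - apply (ex_series_scal X _ c_sum).
Qed.

Lemma simple_sum_bound (z : C) (X : R) : 0 <= X ->
  (forall n, Cmod (t n) <= X * Cmod (z - t n)) ->
  Cmod (simple_sum z) <= X * Series (fun n => Cmod (c n) / Cmod (t n)).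
Proof.
  intros HX H. assert (Hz := off_of_bound z X H).
  eapply Rle_trans; [apply Cmod_Cser_le, simple_summable, Hz|].
  rewrite <- Series_scal_l. apply Series_le; [|apply (ex_series_scal X _ c_sum)].
  intros n. split; [apply Cmod_ge_0 | apply simple_term_le; auto].
Qed.

(** The derivative is $-\sum c_n(z-t_n)^{-2}$, and the remainder is exactly $(w-z)^2\sum
    c_n(z-t_n)^{-2}(w-t_n)^{-1}$. The summand 1 in [poles_separated] bounds the extra factors
    $1/|z-t_n|$ by [X]. *)
Lemma cdiff_simple_sum (z : C) : off z -> cdiff simple_sum z.
Proof.
  intros Hz. destruct (poles_separated z) as [X [d [HX [Hd H]]]].
  assert (Hne : forall n, t n <> z) by (intros n E; apply (Hz n); auto).
  set (A := Series (fun n => Cmod (c n) / Cmod (t n))).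
  assert (Hsum2 : csummable (fun n => c n / (z - t n) ^ 2)%C).
  { apply csummable_le with (fun n => X * (X * (Cmod (c n) / Cmod (t n)))).
    2:{ apply (ex_series_scal X (fun n => X * (Cmod (c n) / Cmod (t n)))).
        apply (ex_series_scal X _ c_sum). }
    intros n. assert (Hn := off_minus_neq0 z n Hz).
    assert (Hzz : Cmod (z - z) < d) by (rewrite Cmod_self; lra).
    assert (H1 := H z n Hzz (Hne n)). assert (Ht := Cmod_ge_0 (t n)).
    replace (c n / (z - t n) ^ 2)%C with (/ (z - t n) * (c n / (z - t n)))%C by (simpl; field; exact Hn).
    rewrite Cmod_mult. apply Rmult_le_compat; try apply Cmod_ge_0.
    - rewrite Cmod_inv by exact Hn. apply Cmod_gt_0 in Hn.
      apply (Rmult_le_reg_r (Cmod (z - t n))); [exact Hn|]. rewrite Rinv_l; lra.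
    - apply simple_term_le; auto. lra. }
  apply (cdiff_of_eps _ z (- Cser (fun n => c n / (z - t n) ^ 2))%C).
  intros e He.
  set (Y := X * X * X * A).
  exists (Rmin d (e / (Rabs Y + 1))).
  assert (HYp := Rabs_pos Y).
  split; [apply Rmin_glb_lt; [lra | apply Rdiv_lt_0_compat; lra]|].
  intros w Hw.
  destruct (Rmin_Rgt_l _ _ _ Hw) as [Hw1 Hw2].
  assert (Hwo : off w).
  { intros n E. specialize (H w n Hw1 (Hne n)). rewrite E, Cmod_self in H.
    generalize (Cmod_ge_0 (t n)). lra. }
  assert (E : (simple_sum w - simple_sum z - - Cser (fun n => c n / (z - t n) ^ 2) * (w - z))%C =
    Cser (fun n => (w - z) ^ 2 * (c n / ((z - t n) ^ 2 * (w - t n))))%C).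
  { unfold simple_sum.
    replace (Cser (fun n => c n / (w - t n)) - Cser (fun n => c n / (z - t n)) -
      - Cser (fun n => c n / (z - t n) ^ 2) * (w - z))%C with
      (Cser (fun n => c n / (w - t n)) + (- (1)) * Cser (fun n => c n / (z - t n)) +
      (w - z) * Cser (fun n => c n / (z - t n) ^ 2))%C by ring.
    assert (S1 := simple_summable w Hwo). assert (S2 := simple_summable z Hz).
    rewrite <- (Cser_scal _ _ S2), <- (Cser_scal _ _ Hsum2).
    assert (S3 := csummable_scal (- (1)) _ S2). assert (S4 := csummable_scal (w - z) _ Hsum2).
    rewrite <- (Cser_plus _ _ S1 S3). rewrite <- (Cser_plus _ _ (csummable_plus _ _ S1 S3) S4).
    apply Cser_ext. intros n. simpl. field.
    split; apply off_minus_neq0; assumption. }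
  rewrite E.
  assert (Hterm : forall n, Cmod ((w - z) ^ 2 * (c n / ((z - t n) ^ 2 * (w - t n)))) <=
    (Cmod (w - z) ^ 2 * (X * X * X)) * (Cmod (c n) / Cmod (t n))).
  { intros n. assert (Hn1 := off_minus_neq0 z n Hz). assert (Hn2 := off_minus_neq0 w n Hwo).
    assert (Hzz : Cmod (z - z) < d) by (rewrite Cmod_self; lra).
    assert (H1 := H z n Hzz (Hne n)). assert (H2 := H w n Hw1 (Hne n)). assert (Ht := Cmod_ge_0 (t n)).
    replace ((w - z) ^ 2 * (c n / ((z - t n) ^ 2 * (w - t n))))%C with
      ((w - z) ^ 2 * (/ (z - t n) * (/ (z - t n) * (c n / (w - t n)))))%C
      by (simpl; field; auto).
    rewrite !Cmod_mult, Cmod_pow.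
    assert (Hi : Cmod (/ (z - t n)) <= X).
    { rewrite Cmod_inv by exact Hn1. apply Cmod_gt_0 in Hn1.
      apply (Rmult_le_reg_r (Cmod (z - t n))); [exact Hn1|]. rewrite Rinv_l; lra. }
    assert (Hi2 : Cmod (c n / (w - t n)) <= X * (Cmod (c n) / Cmod (t n)))
      by (apply simple_term_le; auto; lra).
    rewrite !Rmult_assoc. apply Rmult_le_compat_l; [apply pow2_ge_0|].
    assert (Hi0 := Cmod_ge_0 (/ (z - t n))). assert (Hi3 := Cmod_ge_0 (c n / (w - t n))).
    apply Rmult_le_compat; auto; [apply Rmult_le_pos; auto|].
    apply Rmult_le_compat; auto. }
  eapply Rle_trans.
  { apply Cmod_Cser_le. eapply csummable_le; [apply Hterm | apply (ex_series_scal _ _ c_sum)]. }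
  eapply Rle_trans.
  { apply Series_le; [intros n; split; [apply Cmod_ge_0 | apply Hterm] | apply (ex_series_scal _ _ c_sum)]. }
  rewrite Series_scal_l. fold A.
  replace (Cmod (w - z) ^ 2 * (X * X * X) * A) with (Cmod (w - z) * Y * Cmod (w - z)) by (unfold Y; ring).
  apply Rmult_le_compat_r; [apply Cmod_ge_0|].
  apply (Rmult_lt_compat_r (Rabs Y + 1)) in Hw2; [|lra].
  replace (e / (Rabs Y + 1) * (Rabs Y + 1)) with e in Hw2 by (field; lra).
  generalize (Rle_abs Y) (Cmod_ge_0 (w - z)). nra.
Qed.
End Transform.

Definition cauchy (a : nat -> C) (k : nat) (z : C) : C :=
  (z ^ k * simple_sum (fun n => a n / t n ^ k) z)%C.

Definition adm (a : nat -> C) (k : nat) : Prop :=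
  ex_series (fun n => Cmod (a n) / Cmod (t n) ^ S k).

Lemma adm_coef (a : nat -> C) (k : nat) : adm a k ->
  ex_series (fun n => Cmod (a n / t n ^ k) / Cmod (t n)).
Proof.
  apply ex_series_ext. intros n.
  assert (Hp : (t n ^ k)%C <> 0) by (apply Cpow_nz, t_neq0).
  assert (Ht := proj1 (Cmod_gt_0 _) (t_neq0 n)).
  rewrite Cmod_div, Cmod_pow by exact Hp. simpl. field. split; [apply pow_nonzero; lra | lra].
Qed.

Definition mass (a : nat -> C) (k : nat) : R :=
  Series (fun n => Cmod (a n / t n ^ k) / Cmod (t n)).

Lemma mass_nonneg (a : nat -> C) (k : nat) : adm a k -> 0 <= mass a k.
Proof.
  intros H. assert (E : Series (fun n => 0 * (Cmod (a n / t n ^ k) / Cmod (t n))) = 0)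
    by (rewrite Series_scal_l; ring).
  rewrite <- E. apply Series_le; [|apply adm_coef, H].
  intros n. assert (Ht := proj1 (Cmod_gt_0 _) (t_neq0 n)).
  assert (0 <= Cmod (a n / t n ^ k) / Cmod (t n)); [|lra].
  apply Rmult_le_pos; [apply Cmod_ge_0 | left; apply Rinv_0_lt_compat, Ht].
Qed.

Lemma cauchy_bound (a : nat -> C) (k : nat) (z : C) (X : R) : adm a k -> 0 <= X ->
  (forall n, Cmod (t n) <= X * Cmod (z - t n)) ->
  Cmod (cauchy a k z) <= Cmod z ^ k * (X * mass a k).
Proof.
  intros Ha HX H. unfold cauchy. rewrite Cmod_mult, Cmod_pow.
  apply Rmult_le_compat_l; [apply pow_le, Cmod_ge_0|].
  apply simple_sum_bound; auto. apply adm_coef, Ha.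
Qed.

Lemma cdiff_cauchy (a : nat -> C) (k : nat) (z : C) : adm a k -> off z -> cdiff (cauchy a k) z.
Proof.
  intros Ha Hz. unfold cauchy. apply cdiff_mult; [apply cdiff_pow, cdiff_id|].
  apply cdiff_simple_sum; [apply adm_coef, Ha | exact Hz].
Qed.

Hypothesis t_inj : forall n m, t n = t m -> n = m.

(** At a pole the transform is $O(1/|w-z|)$, a single term being singular as [t] is injective, and
    [Q] is $O(|w-z|)$; the product is $O(|w-z|^2)$, as [cdiff_flat] demands. At the pole itself the
    factor 0 gives the product the value 0, whatever [cauchy] is there. *)
Lemma cdiff_mult_cauchy (Q : C -> C) (a : nat -> C) (k : nat) (z : C) : adm a k ->
  (forall n, t n = z -> Q z = 0) -> cdiff Q z -> cdiff (fun w => Q w ^ 3 * cauchy a k w)%C z.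
Proof.
  intros Ha HQ0 HQ. destruct (classic (exists m, t m = z)) as [[m Hm]|Hno].
  2:{ apply cdiff_mult; [apply cdiff_pow, HQ|]. apply cdiff_cauchy; [exact Ha|].
      intros n E. apply Hno. exists n. auto. }
  specialize (HQ0 m Hm).
  destruct (cdiff_lipschitz Q z HQ) as [L [d1 [Hd1 [HL Hlip]]]].
  destruct (poles_separated z) as [X [d [HX [Hd H]]]].
  assert (HA := mass_nonneg a k Ha).
  set (Y := L ^ 3 * ((Cmod z + 1) ^ k * ((X + Cmod (t m)) * mass a k))).
  assert (Hd2 : 0 < Rmin d1 d) by (apply Rmin_glb_lt; lra).
  apply (cdiff_flat _ z Y (Rmin d1 d)); [exact Hd2 | rewrite HQ0; simpl; ring |].
  intros w Hw.
  destruct (Rmin_Rgt_l _ _ _ Hw) as [Hw1 Hw2].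
  destruct (Ceq_dec w z) as [->|Hne].
  { rewrite HQ0. replace (0 ^ 3 * cauchy a k z)%C with (RtoC 0) by (simpl; ring).
    rewrite Cmod_0, Cmod_self. simpl. lra. }
  assert (Hm0 := proj1 (Cmod_gt_0 _) (Cminus_neq0 w z Hne)).
  set (r := Cmod (w - z)) in *. assert (Htm := Cmod_ge_0 (t m)).
  assert (Hr1 : r < 1) by lra.
  assert (Hb : Cmod (cauchy a k w) <= Cmod w ^ k * ((X + Cmod (t m)) / r * mass a k)).
  { apply cauchy_bound; [exact Ha | apply Rmult_le_pos; [lra | left; apply Rinv_0_lt_compat, Hm0] |].
    intros n. destruct (Ceq_dec (t n) z) as [E|E].
    - assert (n = m) by (apply t_inj; congruence). subst n. rewrite E. fold r.
      replace ((X + Cmod z) / r * r) with (X + Cmod z) by (field; lra). lra.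
    - specialize (H w n Hw2 E). apply Rle_trans with (X * Cmod (w - t n)); [lra|].
      apply Rmult_le_compat_r; [apply Cmod_ge_0|].
      apply (Rmult_le_reg_r r); [exact Hm0|].
      replace ((X + Cmod (t m)) / r * r) with (X + Cmod (t m)) by (field; lra). nra. }
  rewrite Cmod_mult, Cmod_pow.
  specialize (Hlip w Hw1). rewrite HQ0 in Hlip. replace (Q w - 0)%C with (Q w) in Hlip by ring.
  fold r in Hlip.
  assert (Hwk : Cmod w ^ k <= (Cmod z + 1) ^ k).
  { apply pow_incr. split; [apply Cmod_ge_0|]. generalize (Cmod_triangle' w z). fold r. lra. }
  apply Rle_trans with ((L * r) ^ 3 * ((Cmod z + 1) ^ k * ((X + Cmod (t m)) / r * mass a k))).
  - apply Rmult_le_compat; [apply pow_le, Cmod_ge_0 | apply Cmod_ge_0 | |].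
    + apply pow_incr. split; [apply Cmod_ge_0 | exact Hlip].
    + eapply Rle_trans; [apply Hb|]. apply Rmult_le_compat_r; [|exact Hwk].
      apply Rmult_le_pos; [|exact HA]. apply Rmult_le_pos; [lra | left; apply Rinv_0_lt_compat, Hm0].
  - right. unfold Y. simpl. field. lra.
Qed.

(** * Entire quotients of Cauchy transforms *)

Variables (a b : nat -> C) (k m : nat) (F : C -> C).
Hypothesis a_adm : adm a k.
Hypothesis b_adm : adm b m.
Hypothesis F_entire : forall z, cdiff F z.
Hypothesis F_quot : forall z, off z -> cauchy a k z = (F z * cauchy b m z)%C.
Variable z0 : C.
Hypothesis z0_off : off z0.
Hypothesis z0_neq0 : cauchy b m z0 <> 0.

(** Where [Q z] is nonzero, [M / Cmod (Q z)] is a separation constant for [z]. One of the three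
    factors of the cube cancels its denominator; the others are bounded by [M]. *)
Lemma multiplied_bound (Q : C -> C) (c : nat -> C) (j : nat) (z : C) (M : R) : adm c j ->
  (forall n, t n = z -> Q z = 0) -> Cmod (Q z) <= M ->
  (forall n, Cmod (Q z) * Cmod (t n) <= M * Cmod (z - t n)) ->
  Cmod (Q z ^ 3 * cauchy c j z) <= M ^ 3 * (Cmod z ^ j * mass c j).
Proof.
  intros Hc HQ0 HQ HQt. assert (Hm := mass_nonneg c j Hc).
  assert (Hq := Cmod_ge_0 (Q z)).
  assert (Hpos : 0 <= Cmod z ^ j * mass c j) by (apply Rmult_le_pos; [apply pow_le, Cmod_ge_0 | exact Hm]).
  destruct (Ceq_dec (Q z) 0) as [E|E].
  - rewrite E. replace (0 ^ 3 * cauchy c j z)%C with (RtoC 0) by (simpl; ring). rewrite Cmod_0.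
    apply Rmult_le_pos; [apply pow_le; lra | exact Hpos].
  - assert (Hp := proj1 (Cmod_gt_0 _) E).
    assert (Hb : Cmod (cauchy c j z) <= Cmod z ^ j * (M / Cmod (Q z) * mass c j)).
    { apply cauchy_bound; auto.
      - apply Rmult_le_pos; [lra | left; apply Rinv_0_lt_compat, Hp].
      - intros n. apply (Rmult_le_reg_l (Cmod (Q z))); [exact Hp|].
        replace (Cmod (Q z) * (M / Cmod (Q z) * Cmod (z - t n))) with (M * Cmod (z - t n))
          by (field; lra). apply HQt. }
    rewrite Cmod_mult, Cmod_pow.
    apply Rle_trans with (Cmod (Q z) ^ 3 * (Cmod z ^ j * (M / Cmod (Q z) * mass c j))).
    + apply Rmult_le_compat_l; [apply pow_le, Hq | exact Hb].
    + replace (Cmod (Q z) ^ 3 * (Cmod z ^ j * (M / Cmod (Q z) * mass c j))) with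
        ((Cmod (Q z) * Cmod (Q z) * M) * (Cmod z ^ j * mass c j)) by (field; lra).
      apply Rmult_le_compat_r; [exact Hpos|]. simpl. rewrite Rmult_1_r.
      assert (Cmod (Q z) * Cmod (Q z) <= M * M) by (apply Rmult_le_compat; lra). nra.
Qed.

(** The division estimate on the disc of radius [2 * r] about [z0], with the denominator
    $Q^3\mathcal{C}_{b,m}/N$, where [N] bounds both multiplied transforms. For $|z-z_0|\le r$ the
    Harnack factor is at most $4\cdot2r/r=8$, and the cube makes it 24 in front of [ln M]. Since
    [C0] is chosen before [Q], [r] and [M], the multiplier may vary with the radius. *)
Lemma quotient_growth : exists C0, 0 <= C0 /\ forall (Q : C -> C) (r M : R), 0 < r ->
  (forall z, cdiff Q z) ->
  (forall z n, Cmod (z - z0) < 2 * r -> t n = z -> Q z = 0) -> Q z0 <> 0 ->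
  (forall z, Cmod (z - z0) < 2 * r -> Cmod (Q z) <= M /\
     forall n, Cmod (Q z) * Cmod (t n) <= M * Cmod (z - t n)) ->
  forall z, Cmod (z - z0) <= r ->
  Cmod (F z) <= exp (C0 * (1 + ln (1 + r)) + 24 * (ln M - ln (Cmod (Q z0)))).
Proof.
  assert (Ha := mass_nonneg a k a_adm). assert (Hb := mass_nonneg b m b_adm).
  set (A := 1 + mass a k + mass b m) in *.
  set (P := 2 * (1 + Cmod z0)).
  assert (HP : 2 <= P) by (unfold P; generalize (Cmod_ge_0 z0); lra).
  set (C1 := 8 * (INR (k + m) * ln P + ln A + Rabs (ln (Cmod (cauchy b m z0))))).
  set (C0 := C1 + 8 * INR (k + m)).
  assert (HA : 1 <= A) by (unfold A; lra).
  assert (HlnA := ln_nonneg A HA). assert (HlnP := ln_nonneg P ltac:(lra)).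
  assert (Hkm := pos_INR (k + m)).
  assert (HC1 : 0 <= C1).
  { unfold C1. generalize (Rabs_pos (ln (Cmod (cauchy b m z0)))).
    assert (0 <= INR (k + m) * ln P) by (apply Rmult_le_pos; lra). lra. }
  exists C0. split; [unfold C0; lra|].
  intros Q r M Hr HQ HQ0 HQz0 HQM z Hz.
  assert (Hz00 : Cmod (z0 - z0) < 2 * r) by (rewrite Cmod_self; lra).
  assert (HQp := proj1 (Cmod_gt_0 _) HQz0).
  assert (HM : 0 < M) by (generalize (proj1 (HQM z0 Hz00)); lra).
  set (W := P * (1 + r)).
  assert (HW : 1 <= W) by (unfold W; nra).
  set (N := M ^ 3 * (W ^ (k + m) * A)).
  assert (HN : 0 < N).
  { apply Rmult_lt_0_compat; [apply pow_lt, HM|]. apply Rmult_lt_0_compat; [apply pow_lt; lra | lra]. }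
  assert (Hmb : forall c j w, adm c j -> (j <= k + m)%nat -> mass c j <= A ->
    Cmod (w - z0) < 2 * r -> Cmod (Q w ^ 3 * cauchy c j w) <= N).
  { intros c j w Hc Hj Hmc Hw. destruct (HQM w Hw) as [H1 H2].
    eapply Rle_trans; [apply multiplied_bound with (M := M); auto|].
    - intros n. apply HQ0, Hw.
    - unfold N. apply Rmult_le_compat_l; [apply pow_le; lra|].
      apply Rmult_le_compat; [apply pow_le, Cmod_ge_0 | apply mass_nonneg; auto | | exact Hmc].
      apply Rle_trans with (W ^ j).
      + apply pow_incr. split; [apply Cmod_ge_0|].
        generalize (Cmod_triangle' w z0) (Cmod_ge_0 z0). unfold W, P. nra.
      + apply Rle_pow; [exact HW | exact Hj]. }
  set (B := fun w => (Q w ^ 3 * cauchy b m w / N)%C).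
  assert (HNC : RtoC N <> 0) by (intros E; apply RtoC_inj in E; lra).
  assert (HCN : Cmod N = N) by (rewrite Cmod_R; apply Rabs_pos_eq; lra).
  assert (HB1 : forall w, Cmod (w - z0) < 2 * r -> Cmod (B w) <= 1).
  { intros w Hw. unfold B. rewrite Cmod_div, HCN by exact HNC.
    apply (Rmult_le_reg_r N); [exact HN|]. unfold Rdiv. rewrite Rmult_assoc, Rinv_l by lra.
    rewrite Rmult_1_l, Rmult_1_r. apply Hmb; auto; [lia | unfold A; lra]. }
  assert (HBz0 : Cmod (B z0) = Cmod (Q z0) ^ 3 * Cmod (cauchy b m z0) / N).
  { unfold B. rewrite Cmod_div, HCN, Cmod_mult, Cmod_pow by exact HNC. reflexivity. }
  assert (Hcz := proj1 (Cmod_gt_0 _) z0_neq0).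
  assert (HBp : 0 < Cmod (B z0)).
  { rewrite HBz0. apply Rdiv_lt_0_compat; [|exact HN]. apply Rmult_lt_0_compat; [apply pow_lt, HQp | exact Hcz]. }
  eapply Rle_trans.
  { apply (division_bound F B z0 (2 * r)); try lra.
    - intros; apply F_entire.
    - intros w Hw. unfold B. apply cdiff_div; [|apply cdiff_const | exact HNC].
      apply cdiff_mult_cauchy; auto.
      intros n. apply HQ0, Hw.
    - exact HB1.
    - intros w Hw. unfold B. rewrite Cmod_div, HCN by exact HNC.
      rewrite <- (Rmult_1_r 1). apply (Rmult_le_reg_r N); [exact HN|].
      replace (Cmod (F w) * (Cmod (Q w ^ 3 * cauchy b m w) / N) * N) with
        (Cmod (F w) * Cmod (Q w ^ 3 * cauchy b m w)) by (field; lra).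
      rewrite Rmult_1_r, Rmult_1_l, <- Cmod_mult.
      destruct (classic (off w)) as [Ho|Ho].
      + replace (F w * (Q w ^ 3 * cauchy b m w))%C with (Q w ^ 3 * cauchy a k w)%C
          by (rewrite (F_quot w Ho); ring).
        apply Hmb; auto; [lia | unfold A; lra].
      + apply not_all_ex_not in Ho. destruct Ho as [n Hn]. apply NNPP in Hn.
        rewrite (HQ0 w n Hw (eq_sym Hn)).
        replace (F w * (0 ^ 3 * cauchy b m w))%C with (RtoC 0) by (simpl; ring).
        rewrite Cmod_0. lra.
    - apply Cmod_gt_0, HBp. }
  apply exp_mono.
  assert (HlnB := ln_nonpos _ (conj HBp (HB1 z0 Hz00))).
  assert (E : - ln (Cmod (B z0)) = 3 * (ln M - ln (Cmod (Q z0))) + INR (k + m) * (ln P + ln (1 + r)) +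
    ln A - ln (Cmod (cauchy b m z0))).
  { rewrite HBz0. unfold Rdiv. rewrite ln_mult, ln_Rinv, ln_mult.
    all: try solve [apply pow_lt; lra | lra | apply Rinv_0_lt_compat; lra
      | apply Rmult_lt_0_compat; [apply pow_lt; lra | lra]].
    unfold N. rewrite !ln_mult, !ln_pow.
    all: try solve [apply pow_lt; lra | lra | apply Rmult_lt_0_compat; [apply pow_lt; lra | lra]].
    unfold W. rewrite ln_mult by lra. simpl INR. ring. }
  apply Rle_trans with (8 * - ln (Cmod (B z0))).
  - apply Rmult_le_compat_r; [lra|]. assert (Hz' := Cmod_ge_0 (z - z0)).
    apply (Rmult_le_reg_r (2 * r - Cmod (z - z0))); [lra|].
    unfold Rdiv. rewrite Rmult_assoc, Rinv_l by lra. lra.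
  - rewrite E. unfold C0, C1. assert (Hr1 := ln_nonneg (1 + r) ltac:(lra)).
    generalize (Rabs_maj2 (ln (Cmod (cauchy b m z0)))) (Rabs_pos (ln (Cmod (cauchy b m z0)))).
    set (Y := Rabs (ln (Cmod (cauchy b m z0)))). intros HY HY0.
    assert (0 <= INR (k + m) * ln P) by (apply Rmult_le_pos; lra).
    assert (0 <= (INR (k + m) * ln P + ln A + Y) * ln (1 + r)) by (apply Rmult_le_pos; lra).
    nra.
Qed.

(** Case $\mathbf{Z}$, with the multiplier $G^3$: within distance 1/2 of $t_n$ the factor $|z-t_n|$
    is supplied by [cube_near_zero], and farther away the bound on [G] suffices. As [G] has zero
    type, [ln M] is an arbitrarily small multiple of [r] up to logarithms. *)
Lemma growth_condZ (G : C -> C) : (forall z, cdiff G z) ->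
  (forall eps, 0 < eps -> exists A, forall z, Cmod (G z) <= A * exp (eps * Cmod z)) ->
  (forall z, G z = 0 <-> exists n, z = t n) ->
  forall eps, 0 < eps -> exists A, forall z, Cmod (F z) <= exp (A + eps * Cmod z).
Proof.
  intros HG Hgrow Hzero eps Heps.
  destruct quotient_growth as [C0 [HC0 Hq]].
  assert (HGz0 : G z0 <> 0).
  { intros E. apply Hzero in E. destruct E as [n E]. exact (z0_off n E). }
  (* [M] contains [MG ^ 3], [ln MG] contains [dl * (2 * r)], and [ln M] carries the factor 24: the
     type of [G] enters as $144\,dl=\varepsilon/3$. The logarithms cost another $\varepsilon/6$
     through [d2]. *)
  set (dl := eps / 432).
  assert (Hdl : 0 < dl) by (unfold dl; lra).
  destruct (Hgrow dl Hdl) as [A0 HA0].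
  set (A := Rmax A0 1). assert (HA1 : 1 <= A) by apply Rmax_r.
  assert (HA : forall z, Cmod (G z) <= A * exp (dl * Cmod z)).
  { intros z. eapply Rle_trans; [apply HA0|]. apply Rmult_le_compat_r; [left; apply exp_pos | apply Rmax_l]. }
  set (d2 := eps / (6 * (C0 + 24))).
  assert (Hd2 : 0 < d2) by (apply Rdiv_lt_0_compat; lra).
  set (p := Cmod z0). assert (Hp : 0 <= p) by apply Cmod_ge_0.
  set (H0 := ln (Cmod (G z0))).
  set (cst := C0 + 24 * (ln (4 * (1 + p)) + 3 * (ln A + dl * (3 * p + 3)) - 3 * H0) +
     (C0 + 24) * (d2 * (2 + p) - ln d2)).
  exists cst. intros z.
  set (r := Cmod (z - z0) + 1).
  assert (Hr : 1 <= r) by (unfold r; generalize (Cmod_ge_0 (z - z0)); lra).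
  set (MG := A * exp (dl * (p + 2 * r + 1))).
  assert (HMG : 1 <= MG).
  { unfold MG. assert (1 <= exp (dl * (p + 2 * r + 1))); [|nra].
    apply exp_ge_1. nra. }
  (* The factor of [MG ^ 3] dominates $2(p+2r)+1$, twice the bound for $|t_n|$ when $t_n$ is within
     1/2 of the disc point; the 2 comes from [cube_near_zero]. *)
  set (M := 4 * (1 + p) * (1 + r) * MG ^ 3).
  assert (HMG3 : 1 <= MG ^ 3) by (apply pow_R1_Rle, HMG).
  assert (Hball : forall x w, Cmod (x - z0) < 2 * r -> Cmod (w - x) <= 1 -> Cmod (G w) <= MG).
  { intros x w Hx Hw. eapply Rle_trans; [apply HA|]. unfold MG.
    apply Rmult_le_compat_l; [lra|]. apply exp_mono. apply Rmult_le_compat_l; [lra|].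
    generalize (Cmod_triangle' w x) (Cmod_triangle' x z0). fold p. lra. }
  assert (HF := Hq (fun w => G w ^ 3)%C r M ltac:(lra)).
  eapply Rle_trans.
  { apply HF.
    - intros w. apply cdiff_pow, HG.
    - intros w n Hw E. assert (E0 : G w = 0) by (apply Hzero; exists n; auto). rewrite E0. simpl. ring.
    - apply Cpow_nz, HGz0.
    - intros w Hw. rewrite Cmod_pow.
      assert (Hw1 : Cmod (G w) <= MG) by (apply (Hball w w Hw); rewrite Cmod_self; lra).
      assert (Hw3 : Cmod (G w) ^ 3 <= MG ^ 3) by (apply pow_incr; split; [apply Cmod_ge_0 | exact Hw1]).
      assert (Hg0 : 0 <= Cmod (G w) ^ 3) by (apply pow_le, Cmod_ge_0).
      assert (Hwn : Cmod w <= p + 2 * r) by (generalize (Cmod_triangle' w z0); fold p; lra).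
      assert (Hc4 : 2 * (p + 2 * r) + 1 <= 4 * (1 + p) * (1 + r)) by nra.
      assert (HMM : (2 * (p + 2 * r) + 1) * MG ^ 3 <= M) by (unfold M; apply Rmult_le_compat_r; lra).
      split; [nra|].
      intros n. assert (Hwt := Cmod_ge_0 (w - t n)). assert (Ht := Cmod_ge_0 (t n)).
      assert (Htn : Cmod (t n) <= Cmod w + Cmod (w - t n)).
      { generalize (Cmod_triangle' (t n) w). rewrite (Cmod_minus_sym (t n)). lra. }
      destruct (Rle_dec (Cmod (w - t n)) (/ 2)) as [Hn|Hn].
      + assert (Hcn := cube_near_zero G w (t n) MG HG ltac:(apply Hzero; exists n; auto) Hn
          ltac:(intros x Hx; apply (Hball w x Hw Hx))).
        apply Rle_trans with ((2 * MG ^ 3 * Cmod (w - t n)) * (p + 2 * r + / 2)).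
        * apply Rmult_le_compat; lra.
        * replace (2 * MG ^ 3 * Cmod (w - t n) * (p + 2 * r + / 2)) with
            ((2 * (p + 2 * r) + 1) * MG ^ 3 * Cmod (w - t n)) by field.
          apply Rmult_le_compat_r; assumption.
      + apply Rle_trans with (MG ^ 3 * ((2 * (p + 2 * r) + 1) * Cmod (w - t n))).
        * apply Rmult_le_compat; try lra. assert (/ 2 < Cmod (w - t n)) by lra. nra.
        * replace (MG ^ 3 * ((2 * (p + 2 * r) + 1) * Cmod (w - t n))) with
            ((2 * (p + 2 * r) + 1) * MG ^ 3 * Cmod (w - t n)) by ring.
          apply Rmult_le_compat_r; assumption.
    - unfold r. lra. }
  apply exp_mono. rewrite Cmod_pow, ln_pow by (apply Cmod_gt_0, HGz0). fold H0.
  assert (ElnM : ln M = ln (4 * (1 + p)) + ln (1 + r) + 3 * (ln A + dl * (p + 2 * r + 1))).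
  { assert (ElnMG : ln MG = ln A + dl * (p + 2 * r + 1)).
    { unfold MG. rewrite ln_mult by (try apply exp_pos; lra). rewrite ln_exp. reflexivity. }
    unfold M. rewrite (ln_mult (4 * (1 + p) * (1 + r))), (ln_mult (4 * (1 + p))), ln_pow, ElnMG by nra.
    simpl INR. ring. }
  rewrite ElnM.
  assert (Hl := ln_le_eps (1 + r) d2 Hd2 ltac:(lra)).
  assert (Hrz : r <= Cmod z + p + 1).
  { unfold r, p. rewrite <- (Cmod_opp z0). generalize (Cmod_triangle z (- z0)). unfold Cminus. lra. }
  assert (Hz := Cmod_ge_0 z).
  assert (HL2 : (C0 + 24) * ln (1 + r) <= (C0 + 24) * (d2 * (2 + p) - ln d2) + eps / 6 * Cmod z).
  { replace (eps / 6) with ((C0 + 24) * d2) by (unfold d2; field; lra).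
    apply Rle_trans with ((C0 + 24) * (d2 * (1 + r) - ln d2)); [apply Rmult_le_compat_l; lra|].
    replace ((C0 + 24) * (d2 * (2 + p) - ln d2) + (C0 + 24) * d2 * Cmod z) with
      ((C0 + 24) * (d2 * (2 + p) - ln d2 + d2 * Cmod z)) by ring.
    apply Rmult_le_compat_l; [lra|]. nra. }
  assert (HL3 : 72 * (dl * (p + 2 * r + 1)) <= 72 * (dl * (3 * p + 3)) + eps / 3 * Cmod z).
  { replace (eps / 3) with (72 * (dl * 2)) by (unfold dl; field). nra. }
  simpl INR. unfold cst. nra.
Qed.

(** * Finite convergence exponent: finite order and base points *)

Variable K : R.
Hypothesis K_pos : 0 < K.
Hypothesis K_sum : ex_series (fun n => Rpower (Cmod (t n)) (- K)).

(* A polynomial with the zeros [t n], [|t n| <= 2 R], plays the role of the canonical product. *)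
Lemma exponent_multiplier :
  exists C1, 0 <= C1 /\ forall R, 1 <= R -> exists Q : C -> C, exists M,
    (forall z, cdiff Q z) /\ (forall n, Cmod (t n) <= 2 * R -> Q (t n) = 0) /\ Q z0 <> 0 /\
    (forall z, Cmod z <= R -> Cmod (Q z) <= M /\
      forall n, Cmod (Q z) * Cmod (t n) <= M * Cmod (z - t n)) /\
    ln M - ln (Cmod (Q z0)) <= C1 * Rpower R K.
Proof.
  assert (HK := K_pos). assert (Hser := K_sum). set (v := fun n => Rpower (Cmod (t n)) (- K)) in *.
  set (S0 := Series v).
  assert (Hv : forall n, 0 <= v n) by (intros n; left; apply exp_pos).
  assert (Hsum := fun n => Rsum_le_Series v n Hv Hser). fold S0 in Hsum.
  destruct (poles_separated_off z0 z0_off) as [X [HX Hsep]].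
  (* A factor with $|t_n|\le2R$ is at most $1+x$ with $x=R/|t_n|\ge1/2$, and then
     $\ln(1+x)\le\ln(3x)\le(3x)^K/K$. *)
  set (c1 := Rpower 3 K / K).
  assert (Hc1 : 0 < c1) by (apply Rdiv_lt_0_compat; [apply exp_pos | exact HK]).
  set (X1 := Rmax X 1). assert (HX1 : 1 <= X1) by apply Rmax_r.
  (* Each factor at [z0] is at least [/ X1]. Since $(2R/|t_n|)^K\ge1$ for the poles in question,
     their number is paid for by the sum of $(R/|t_n|)^K$. *)
  set (c2 := Rpower 2 K * ln X1).
  assert (Hc2 : 0 <= c2) by (apply Rmult_le_pos; [left; apply exp_pos | apply ln_nonneg, HX1]).
  exists (ln 2 + (c1 + c2) * S0).
  assert (HS0 : 0 <= S0) by (generalize (Hsum O); simpl; lra).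
  assert (Hl2 := ln_nonneg 2 ltac:(lra)).
  split; [apply Rplus_le_le_0_compat; [lra | apply Rmult_le_pos; lra]|].
  intros R HR.
  destruct (t_inf (2 * R)) as [N HN].
  (* Factors of poles beyond [2 * R] are replaced by 1, so that the moduli need not be ordered and
     any [N] past which all poles are far will do. *)
  set (fac := fun n (z : C) => if Rle_dec (Cmod (t n)) (2 * R) then (1 - z / t n)%C else RtoC 1).
  set (Q := fun n z => Cprod n (fun j => fac j z)).
  set (s := fun n => Rpower R K * v n).
  assert (Hs0 : forall n, 0 <= s n) by (intros n; apply Rmult_le_pos; [left; apply exp_pos | apply Hv]).
  assert (Hs : forall n, s n = Rpower (R / Cmod (t n)) K).
  { intros n. assert (Ht := proj1 (Cmod_gt_0 _) (t_neq0 n)). unfold s, v.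
    unfold Rdiv. rewrite <- Rpower_mult_distr by (try apply Rinv_0_lt_compat; lra).
    f_equal. unfold Rpower. rewrite ln_Rinv by exact Ht. f_equal. ring. }
  assert (Hup : forall n z, Cmod z <= R -> Cmod (fac n z) <= exp (c1 * s n)).
  { intros n z Hz. assert (Ht := proj1 (Cmod_gt_0 _) (t_neq0 n)). unfold fac.
    destruct (Rle_dec (Cmod (t n)) (2 * R)) as [Hle|Hle].
    - set (x := R / Cmod (t n)).
      assert (Hx : / 2 <= x).
      { apply (Rmult_le_reg_r (Cmod (t n))); [exact Ht|]. unfold x, Rdiv.
        rewrite Rmult_assoc, Rinv_l by lra. lra. }
      apply Rle_trans with (1 + x).
      + replace (1 - z / t n)%C with (1 + - (z / t n))%C by ring.
        eapply Rle_trans; [apply Cmod_triangle|]. rewrite Cmod_1, Cmod_opp, Cmod_div by apply t_neq0.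
        apply Rplus_le_compat_l. apply Rmult_le_compat_r; [left; apply Rinv_0_lt_compat, Ht | exact Hz].
      + rewrite <- (exp_ln (1 + x)) by lra. apply exp_mono.
        rewrite Hs. fold x. unfold c1.
        replace (Rpower 3 K / K * Rpower x K) with (Rpower (3 * x) K / K)
          by (rewrite <- Rpower_mult_distr by lra; field; lra).
        eapply Rle_trans; [|apply ln_le_Rpower; lra]. apply ln_le; lra.
    - rewrite Cmod_1. apply exp_ge_1. apply Rmult_le_pos; [lra | apply Hs0]. }
  assert (Hlow : forall n, exp (- (c2 * s n)) <= Cmod (fac n z0)).
  { intros n. assert (Ht := proj1 (Cmod_gt_0 _) (t_neq0 n)). unfold fac.
    destruct (Rle_dec (Cmod (t n)) (2 * R)) as [Hle|Hle].
    - assert (Hi : / X1 <= Cmod (1 - z0 / t n)).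
      { replace (1 - z0 / t n)%C with (- ((z0 - t n) / t n))%C by (field; apply t_neq0).
        rewrite Cmod_opp, Cmod_div by apply t_neq0.
        specialize (Hsep n). assert (Hxl : X <= X1) by apply Rmax_l.
        apply (Rmult_le_reg_r (X1 * Cmod (t n))); [nra|].
        replace (/ X1 * (X1 * Cmod (t n))) with (Cmod (t n)) by (field; lra).
        replace (Cmod (z0 - t n) / Cmod (t n) * (X1 * Cmod (t n))) with (X1 * Cmod (z0 - t n))
          by (field; lra).
        generalize (Cmod_ge_0 (z0 - t n)). nra. }
      eapply Rle_trans; [|apply Hi].
      rewrite <- (exp_ln (/ X1)) by (apply Rinv_0_lt_compat; lra). rewrite ln_Rinv by lra.
      apply exp_mono. apply Ropp_le_contravar. rewrite Hs. unfold c2.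
      assert (H1 : 1 <= Rpower 2 K * Rpower (R / Cmod (t n)) K).
      { rewrite Rpower_mult_distr; [|lra | apply Rdiv_lt_0_compat; lra].
        apply Rpower_ge_1; [lra|]. apply (Rmult_le_reg_r (Cmod (t n))); [exact Ht|].
        unfold Rdiv. rewrite !Rmult_assoc, Rinv_l by lra. lra. }
      generalize (ln_nonneg X1 HX1). nra.
    - rewrite Cmod_1, <- exp_0. apply exp_mono. specialize (Hs0 n). nra. }
  assert (Hss : forall c n, 0 <= c -> c * Rsum n s <= c * S0 * Rpower R K).
  { intros c n Hc.
    assert (E : Rsum n s = Rpower R K * Rsum n v).
    { clear. induction n as [|n IH]; simpl; [ring | rewrite IH; unfold s; ring]. }
    rewrite E. assert (Hrp : 0 < Rpower R K) by apply exp_pos.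
    replace (c * (Rpower R K * Rsum n v)) with ((c * Rpower R K) * Rsum n v) by ring.
    replace (c * S0 * Rpower R K) with ((c * Rpower R K) * S0) by ring.
    apply Rmult_le_compat_l; [nra | apply Hsum]. }
  assert (HsR : forall n, 0 <= Rsum n s).
  { intros n. induction n as [|n IH]; simpl; [lra | specialize (Hs0 n); lra]. }
  assert (HQup : forall n z, Cmod z <= R -> Cmod (Q n z) <= exp (c1 * Rsum n s)).
  { intros n z Hz. induction n as [|n IH]; unfold Q in *; simpl.
    - rewrite Cmod_1, Rmult_0_r, exp_0. lra.
    - rewrite Cmod_mult, Rmult_plus_distr_l, exp_plus.
      apply Rmult_le_compat; try apply Cmod_ge_0; auto. }
  assert (HQlow : forall n, exp (- (c2 * Rsum n s)) <= Cmod (Q n z0)).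
  { intros n. induction n as [|n IH]; unfold Q in *; simpl.
    - rewrite Cmod_1, Rmult_0_r, Ropp_0, exp_0. lra.
    - rewrite Cmod_mult, Rmult_plus_distr_l, Ropp_plus_distr, exp_plus.
      apply Rmult_le_compat; try (left; apply exp_pos); auto. }
  assert (HQt : forall n z j, Cmod z <= R -> (j < n)%nat -> Cmod (t j) <= 2 * R ->
    Cmod (Q n z) * Cmod (t j) <= exp (c1 * Rsum n s) * Cmod (z - t j)).
  { intros n z j Hz Hj Htj. induction n as [|n IH]; [lia|].
    unfold Q in *; simpl. rewrite Cmod_mult, Rmult_plus_distr_l, exp_plus.
    assert (Ht := proj1 (Cmod_gt_0 _) (t_neq0 j)).
    destruct (Nat.eq_dec j n) as [->|Hne].
    - assert (Ef : Cmod (fac n z) * Cmod (t n) = Cmod (z - t n)).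
      { unfold fac. destruct (Rle_dec (Cmod (t n)) (2 * R)) as [_|K1]; [|contradiction].
        rewrite <- Cmod_mult. replace ((1 - z / t n) * t n)%C with (- (z - t n))%C by (field; apply t_neq0).
        apply Cmod_opp. }
      rewrite Rmult_assoc, Ef. apply Rmult_le_compat_r; [apply Cmod_ge_0|].
      specialize (HQup n z Hz). unfold Q in HQup.
      assert (H1 : 1 <= exp (c1 * s n)).
      { apply exp_ge_1. apply Rmult_le_pos; [lra | apply Hs0]. }
      generalize (exp_pos (c1 * Rsum n s)). nra.
    - specialize (IH ltac:(lia)).
      replace (Cmod (Cprod n (fun j => fac j z)) * Cmod (fac n z) * Cmod (t j)) with
        ((Cmod (Cprod n (fun j => fac j z)) * Cmod (t j)) * Cmod (fac n z)) by ring.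
      replace (exp (c1 * Rsum n s) * exp (c1 * s n) * Cmod (z - t j)) with
        ((exp (c1 * Rsum n s) * Cmod (z - t j)) * exp (c1 * s n)) by ring.
      apply Rmult_le_compat; auto; [|apply Cmod_ge_0].
      apply Rmult_le_pos; apply Cmod_ge_0. }
  set (E := exp (c1 * Rsum N s)). assert (HE : 0 < E) by apply exp_pos.
  (* The 2 serves the poles beyond [2 * R], for which $|t_n|\le2|z-t_n|$ when $|z|\le R$. *)
  exists (Q N), (2 * E). split; [|split; [|split; [|split]]].
  - intros z. apply (cdiff_Cprod N fac). intros j _. unfold fac.
    destruct (Rle_dec (Cmod (t j)) (2 * R)); [|apply cdiff_const].
    apply cdiff_minus; [apply cdiff_const|]. apply cdiff_mult; [apply cdiff_id | apply cdiff_const].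
  - intros n Hn.
    assert (HnN : (n < N)%nat).
    { apply Nat.nle_gt. intros Hge. specialize (HN n Hge). lra. }
    unfold Q. revert HnN. clear - Hn t_neq0. induction N as [|N IH]; intros HnN; [lia|]. simpl.
    destruct (Nat.eq_dec n N) as [->|Hne].
    + assert (Ef : fac N (t N) = 0).
      { unfold fac. destruct (Rle_dec (Cmod (t N)) (2 * R)); [field; apply t_neq0 | contradiction]. }
      rewrite Ef. ring.
    + rewrite IH by lia. ring.
  - apply Cmod_gt_0. eapply Rlt_le_trans; [apply exp_pos | apply HQlow].
  - intros z Hz. specialize (HQup N z Hz). fold E in HQup. split; [lra|].
    intros n. assert (Hd := Cmod_ge_0 (z - t n)).
    destruct (Rle_dec (Cmod (t n)) (2 * R)) as [Hle|Hle].
    + assert (HnN : (n < N)%nat).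
      { apply Nat.nle_gt. intros Hge. specialize (HN n Hge). lra. }
      specialize (HQt N z n Hz HnN Hle). fold E in HQt. nra.
    + assert (K1 := Cmod_triangle' (t n) z). rewrite Cmod_minus_sym in K1.
      assert (K2 : Cmod (t n) <= 2 * Cmod (z - t n)) by lra.
      apply Rle_trans with (E * (2 * Cmod (z - t n))); [|right; ring].
      apply Rmult_le_compat; try apply Cmod_ge_0; assumption.
  - rewrite ln_mult by lra. unfold E. rewrite ln_exp.
    assert (HQl := HQlow N). apply ln_le in HQl; [|apply exp_pos]. rewrite ln_exp in HQl.
    assert (A1 := Hss c1 N ltac:(lra)). assert (A2 := Hss c2 N Hc2).
    assert (A3 := Rpower_ge_1 R K ltac:(lra) HR). nra.
Qed.

Lemma growth_finite_order :
  exists A, 0 <= A /\ forall z, Cmod (F z) <= exp (A * Rpower (1 + Cmod z) K).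
Proof.
  assert (HK := K_pos). destruct quotient_growth as [C0 [HC0 Hq]].
  destruct exponent_multiplier as [C1 [HC1 Hm]].
  set (p := Cmod z0). assert (Hp : 0 <= p) by apply Cmod_ge_0.
  (* Chosen so that the radius $R=p+2r$ needed at [z] is at most $c(1+|z|)$. *)
  set (c := 3 * p + 3).
  exists (C0 * (1 + Rpower c K / K) + 24 * (C1 * Rpower c K)).
  assert (Hc : 0 < Rpower c K) by apply exp_pos.
  split.
  { apply Rplus_le_le_0_compat.
    - apply Rmult_le_pos; [exact HC0|]. assert (0 < Rpower c K / K) by (apply Rdiv_lt_0_compat; lra). lra.
    - apply Rmult_le_pos; [lra | apply Rmult_le_pos; lra]. }
  intros z. set (r := Cmod (z - z0) + 1).
  assert (Hr : 1 <= r) by (unfold r; generalize (Cmod_ge_0 (z - z0)); lra).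
  assert (Hz := Cmod_ge_0 z).
  assert (Hrz : r <= Cmod z + p + 1).
  { unfold r, p. rewrite <- (Cmod_opp z0). generalize (Cmod_triangle z (- z0)). unfold Cminus. lra. }
  set (R := p + 2 * r).
  assert (HRz : R <= c * (1 + Cmod z)) by (unfold R, c; nra).
  destruct (Hm R ltac:(unfold R; lra)) as [Q [M (HQ & HQ0 & HQz0 & HQM & HQl)]].
  assert (Hin : forall w, Cmod (w - z0) < 2 * r -> Cmod w <= R).
  { intros w Hw. unfold R. generalize (Cmod_triangle' w z0). fold p. lra. }
  eapply Rle_trans.
  { apply (Hq Q r M); try lra; auto.
    - intros w n Hw E. rewrite <- E in *. apply HQ0. specialize (Hin _ Hw). unfold R in *. lra.
    - unfold r. lra. }
  apply exp_mono.
  assert (Hpow : Rpower R K <= Rpower c K * Rpower (1 + Cmod z) K).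
  { rewrite Rpower_mult_distr by (unfold c; lra). apply Rle_Rpower_l; [lra|]. unfold R in *. lra. }
  assert (Hln : ln (1 + r) <= Rpower c K / K * Rpower (1 + Cmod z) K).
  { replace (Rpower c K / K * Rpower (1 + Cmod z) K) with (Rpower c K * Rpower (1 + Cmod z) K / K) by (field; lra).
    eapply Rle_trans; [apply (ln_le_Rpower _ K); lra|].
    apply Rmult_le_compat_r; [left; apply Rinv_0_lt_compat, HK|].
    eapply Rle_trans; [|apply Hpow]. apply Rle_Rpower_l; [lra|]. unfold R. lra. }
  assert (H1 := Rpower_ge_1 (1 + Cmod z) K ltac:(lra) ltac:(lra)).
  set (Y := Rpower (1 + Cmod z) K) in *. set (D := Rpower c K) in *.
  replace ((C0 * (1 + D / K) + 24 * (C1 * D)) * Y) with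
    (C0 * (Y + D / K * Y) + 24 * (C1 * (D * Y))) by ring.
  apply Rplus_le_compat.
  - apply Rmult_le_compat_l; lra.
  - apply Rmult_le_compat_l; [lra|]. eapply Rle_trans; [apply HQl|]. apply Rmult_le_compat_l; assumption.
Qed.

(** If the transform vanished near [z1], then $Q^3\mathcal{C}_{b,m}$ would vanish on an arc of the
    circle through [z1] about [z0], hence at [z0] by [arc_bound] with [m = 0]. This provides a base
    point in a half plane or an angle that need not contain [z0]. *)
Lemma cauchy_nonzero_near (z1 : C) (d : R) : 0 < d ->
  (forall z, Cmod (z - z1) < d -> off z) ->
  exists z, Cmod (z - z1) < d /\ cauchy b m z <> 0.
Proof.
  intros Hd Hoff. apply NNPP. intros Hno.
  assert (Hzero : forall z, Cmod (z - z1) < d -> cauchy b m z = 0).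
  { intros z Hz. apply NNPP. intros Hn. apply Hno. exists z. auto. }
  set (r := Cmod (z1 - z0)).
  assert (Hr : 0 <= r) by apply Cmod_ge_0.
  destruct (exponent_multiplier) as [C1 [_ HQ]].
  set (R := 1 + Cmod z0 + r).
  assert (Hp := Cmod_ge_0 z0).
  destruct (HQ R ltac:(unfold R; lra)) as [Q [M (HQd & HQ0 & HQz0 & HQM & _)]].
  set (f := fun w => (Q w ^ 3 * cauchy b m w)%C).
  destruct (polar (z1 - z0)) as [x1 [_ Ex1]]. fold r in Ex1.
  assert (Hc : continuous (fun x => Cmod (z0 + r * cis x - z1)) x1).
  { apply (continuous_Cmod_cis (fun z => z0 + r * z - z1)%C).
    apply cdiff_minus; [apply cdiff_affine | apply cdiff_const]. }
  destruct (proj1 (continuous_eps _ _) Hc d Hd) as [d1 [Hd1 H1]].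
  assert (E0 : Cmod (z0 + r * cis x1 - z1) = 0).
  { rewrite <- Ex1. replace (z0 + (z1 - z0) - z1)%C with (RtoC 0) by ring. apply Cmod_0. }
  assert (HM := mass_nonneg b m b_adm).
  assert (Hnear : forall z, Cmod (z - z0) <= r -> Cmod z <= R).
  { intros z Hz. unfold R. generalize (Cmod_triangle' z z0). lra. }
  destruct (arc_bound f z0 r x1 d1 (M ^ 3 * (R ^ m * mass b m)) 0) as [n Hn]; try lra.
  - intros z Hz. apply cdiff_mult_cauchy; auto. intros n E. rewrite <- E in *.
    apply HQ0. specialize (Hnear _ Hz). generalize (Cmod_ge_0 (t n)). lra.
  - intros z Hz. assert (HzR := Hnear z (Req_le _ _ Hz)). destruct (HQM z HzR) as [K1 K2].
    eapply Rle_trans; [apply multiplied_bound with (M := M); auto|].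
    + intros n E. rewrite <- E in *. apply HQ0. generalize (Cmod_ge_0 (t n)). lra.
    + apply Rmult_le_compat_l; [apply pow_le; generalize (Cmod_ge_0 (Q z)); lra|].
      apply Rmult_le_compat_r; [exact HM|]. apply pow_incr. split; [apply Cmod_ge_0 | exact HzR].
  - intros x Hx. unfold f. rewrite Hzero.
    + rewrite Cmult_0_r, Cmod_0. lra.
    + assert (Hxx : Rabs (x - x1) < d1) by (apply Rabs_lt_between; lra).
      specialize (H1 x Hxx). rewrite E0, Rminus_0_r in H1. apply Rabs_lt_between in H1. lra.
  - rewrite Rmult_0_r in Hn.
    assert (Hf : 0 < Cmod (f z0)).
    { apply Cmod_gt_0. unfold f. apply Cmult_neq_0; [apply Cpow_nz, HQz0 | exact z0_neq0]. }
    assert (0 < Cmod (f z0) ^ S n) by (apply pow_lt, Hf). lra.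
Qed.

(** * Growth and the logarithmic integral on half planes *)

Lemma one_plus_mod (w : C) : 0 <= fst w -> (1 + Cmod w) / 2 <= Cmod (1 + w).
Proof.
  intros Hw.
  assert (H1 : 1 <= Cmod (1 + w)).
  { eapply Rle_trans; [|apply abs_fst_le]. simpl. rewrite Rabs_pos_eq; lra. }
  assert (H2 : Cmod w <= Cmod (1 + w)).
  { apply Rsqr_incr_0_var; [|lra]. unfold Rsqr.
    assert (K1 := Cmod2_alt (1 + w)). assert (K2 := Cmod2_alt w). unfold Re, Im in *. simpl in *. nra. }
  lra.
Qed.

(** $(1+w)^q$ is an analytic replacement for $(1+|w|)^q$: it has no zero in the closed right half
    plane and, by [one_plus_mod], is smaller by at most the factor $2^q$. *)
Lemma normalized_bound (c : nat -> C) (j q : nat) (psi : C -> C) (X : R) (w : C) : 0 <= fst w -> 0 < X ->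
  Cmod (cauchy c j (psi w)) <= X * (1 + Cmod w) ^ q ->
  Cmod (cauchy c j (psi w) / (RtoC (X * 2 ^ q) * (1 + w) ^ q)) <= 1.
Proof.
  intros Hw HX H.
  assert (H1 := one_plus_mod w Hw). assert (Hw0 := Cmod_ge_0 w).
  assert (H2 : 0 < 2 ^ q) by (apply pow_lt; lra).
  assert (Hn : (1 + w)%C <> 0) by (apply Cmod_gt_0; lra).
  assert (Hd : (RtoC (X * 2 ^ q) * (1 + w) ^ q)%C <> 0).
  { apply Cmult_neq_0; [intros E; apply RtoC_inj in E; nra | apply Cpow_nz, Hn]. }
  rewrite Cmod_div by exact Hd. rewrite Cmod_mult, Cmod_R, Cmod_pow, Rabs_pos_eq by nra.
  assert (H3 : X * (1 + Cmod w) ^ q <= X * 2 ^ q * Cmod (1 + w) ^ q).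
  { rewrite Rmult_assoc, <- Rpow_mult_distr. apply Rmult_le_compat_l; [lra|].
    apply pow_incr. lra. }
  assert (H4 : 0 < Cmod (1 + w) ^ q) by (apply pow_lt; lra).
  assert (H5 : 0 < X * 2 ^ q * Cmod (1 + w) ^ q) by (apply Rmult_lt_0_compat; nra).
  set (D := X * 2 ^ q * Cmod (1 + w) ^ q) in *.
  apply (Rmult_le_reg_r D); [exact H5|]. unfold Rdiv. rewrite Rmult_assoc, Rinv_l by lra. lra.
Qed.

Lemma cdiff_normalized (c : nat -> C) (j q : nat) (psi : C -> C) (X : R) (w : C) : adm c j ->
  (1 + w)%C <> 0 -> 0 < X ->
  cdiff psi w -> off (psi w) ->
  cdiff (fun w => cauchy c j (psi w) / (RtoC (X * 2 ^ q) * (1 + w) ^ q))%C w.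
Proof.
  intros Hc Hn HX Hpsi Hoff. apply cdiff_div.
  - apply (cdiff_comp (cauchy c j) psi); [exact Hpsi | apply cdiff_cauchy; auto].
  - apply cdiff_scal. apply cdiff_pow. apply cdiff_plus; [apply cdiff_const | apply cdiff_id].
  - apply Cmult_neq_0; [|apply Cpow_nz, Hn]. intros E. apply RtoC_inj in E.
    assert (0 < 2 ^ q) by (apply pow_lt; lra). nra.
Qed.

(** The division estimate on the unit disc, carried over by the Mobius map [cay] that sends 0 to the
    base point [w0]. The map [psi] is left general: it is affine for a half plane and a power for a
    wider angle. *)
Lemma growth_half_plane (psi : C -> C) (q : nat) (X : R) (w0 : C) : 0 < X ->
  (forall w, 0 < fst w -> cdiff psi w /\ off (psi w) /\
     Cmod (cauchy a k (psi w)) <= X * (1 + Cmod w) ^ q /\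
     Cmod (cauchy b m (psi w)) <= X * (1 + Cmod w) ^ q) ->
  0 < fst w0 -> cauchy b m (psi w0) <> 0 ->
  exists A, 0 <= A /\ forall w, 0 < fst w ->
    Cmod (F (psi w)) <= exp (A * ((1 + Cmod w) ^ 2 / fst w)).
Proof.
  intros HX Hpsi Hw0 Hb0.
  set (Nn := fun w : C => (RtoC (X * 2 ^ q) * (1 + w) ^ q)%C).
  set (cay := fun z : C => ((w0 + Cconj w0 * z) / (1 - z))%C).
  set (x0 := fst w0) in *.
  assert (Hcay : forall z, Cmod (z - 0) < 1 -> (1 - z)%C <> 0 /\ 0 < fst (cay z)).
  { intros z Hz. replace (z - 0)%C with z in Hz by ring.
    assert (Hn : (1 - z)%C <> 0).
    { intros E. replace z with (1 - (1 - z))%C in Hz by ring. rewrite E in Hz.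
      replace (1 - 0)%C with (RtoC 1) in Hz by ring. rewrite Cmod_1 in Hz. lra. }
    split; [exact Hn|].
    assert (Hn2 := proj1 (Cmod_gt_0 _) Hn). assert (K1 := Cmod2_alt (1 - z)). assert (K2 := Cmod2_alt z).
    assert (Hz0 := Cmod_ge_0 z). unfold cay.
    destruct z as [x y]. unfold Re, Im, x0 in *. destruct w0 as [u v]. simpl in *.
    assert (Hp : 0 < (1 + - x) * (1 + - x) + (0 + - y) * (0 + - y)) by nra.
    match goal with |- 0 < ?E => replace E with
      (u * (1 - (x * x + y * y)) / ((1 + - x) * (1 + - x) + (0 + - y) * (0 + - y))) by (field; nra) end.
    apply Rdiv_lt_0_compat; [|exact Hp]. apply Rmult_lt_0_compat; nra. }
  assert (Hcayd : forall z, Cmod (z - 0) < 1 -> cdiff cay z).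
  { intros z Hz. unfold cay. apply cdiff_div; [apply cdiff_affine | | apply Hcay, Hz].
    apply cdiff_minus; [apply cdiff_const | apply cdiff_id]. }
  assert (Hn1 : forall w, 0 < fst w -> (1 + w)%C <> 0).
  { intros w Hw E. apply (f_equal fst) in E. simpl in E. lra. }
  set (B := fun z => (cauchy b m (psi (cay z)) / Nn (cay z))%C).
  assert (Ecay0 : cay 0 = w0).
  { unfold cay. field. }
  assert (HB0 : B 0 <> 0).
  { unfold B. rewrite Ecay0. apply Cmult_neq_0; [exact Hb0|].
    apply Cmod_gt_0. rewrite Cmod_inv.
    - apply Rinv_0_lt_compat, Cmod_gt_0. unfold Nn. apply Cmult_neq_0; [|apply Cpow_nz, Hn1, Hw0].
      intros E. apply RtoC_inj in E. assert (0 < 2 ^ q) by (apply pow_lt; lra). nra.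
    - unfold Nn. apply Cmult_neq_0; [|apply Cpow_nz, Hn1, Hw0].
      intros E. apply RtoC_inj in E. assert (0 < 2 ^ q) by (apply pow_lt; lra). nra. }
  assert (HB1 : forall z, Cmod (z - 0) < 1 -> Cmod (B z) <= 1).
  { intros z Hz. destruct (Hcay z Hz) as [_ Hf]. destruct (Hpsi _ Hf) as (_ & _ & _ & H).
    apply normalized_bound; auto. lra. }
  set (L := - ln (Cmod (B 0))).
  assert (HL : 0 <= L).
  { assert (H00 : Cmod (0 - 0) < 1) by (rewrite Cmod_self; lra).
    assert (K1 := ln_nonpos _ (conj (proj1 (Cmod_gt_0 _) HB0) (HB1 0 H00))). unfold L. lra. }
  set (p := 1 + Cmod w0). assert (Hp : 1 <= p) by (unfold p; generalize (Cmod_ge_0 w0); lra).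
  exists (2 * p ^ 2 / x0 * L). split.
  { apply Rmult_le_pos; [|exact HL]. apply Rmult_le_pos; [|left; apply Rinv_0_lt_compat, Hw0].
    simpl. nra. }
  intros w Hw.
  set (z := ((w - w0) / (w + Cconj w0))%C).
  assert (Hden : (w + Cconj w0)%C <> 0).
  { intros E. apply (f_equal fst) in E. simpl in E. unfold x0 in Hw0. lra. }
  assert (Hdp := proj1 (Cmod_gt_0 _) Hden).
  set (D := Cmod (w + Cconj w0)) in *.
  (* This is $D^2(1-|z|^2)$; it makes the Harnack factor $4/(1-|z|)$ at most
     $2D^2/(x_0\,\mathrm{Re}\,w)$. *)
  assert (Hzm : D * D - Cmod (w - w0) * Cmod (w - w0) = 4 * fst w * x0).
  { assert (K1 := Cmod2_alt (w + Cconj w0)). assert (K2 := Cmod2_alt (w - w0)).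
    unfold Re, Im, D, x0 in *. simpl in *. lra. }
  assert (Hzmod : Cmod z = Cmod (w - w0) / D) by (unfold z; apply Cmod_div, Hden).
  set (nu := Cmod (w - w0)) in *. assert (Hnu : 0 <= nu) by apply Cmod_ge_0.
  assert (Hlt : nu < D).
  { apply Rsqr_incrst_0; unfold Rsqr; try lra. assert (0 < fst w * x0) by (apply Rmult_lt_0_compat; assumption). lra. }
  assert (Hz1 : Cmod (z - 0) < 1).
  { replace (z - 0)%C with z by ring. rewrite Hzmod. apply (Rmult_lt_reg_r D); [exact Hdp|].
    unfold Rdiv. rewrite Rmult_assoc, Rinv_l by lra. lra. }
  assert (Ecay : cay z = w).
  { assert (Hx : (w0 + Cconj w0)%C <> 0).
    { intros E. apply (f_equal fst) in E. simpl in E. unfold x0 in Hw0. lra. }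
    unfold cay, z. field. split; [exact Hden|].
    replace (w + Cconj w0 - (w - w0))%C with (w0 + Cconj w0)%C by ring. exact Hx. }
  assert (HF := division_bound (fun z => F (psi (cay z))) B 0 1 z Rlt_0_1).
  cbv beta in HF. rewrite Ecay in HF. eapply Rle_trans.
  { apply HF; auto.
    - intros y Hy. destruct (Hcay y Hy) as [_ Hf].
      apply (cdiff_comp F (fun z => psi (cay z))); [|apply F_entire].
      apply (cdiff_comp psi cay); [apply Hcayd, Hy | apply Hpsi, Hf].
    - intros y Hy. destruct (Hcay y Hy) as [_ Hf]. unfold B.
      apply (cdiff_comp (fun w => cauchy b m (psi w) / Nn w)%C cay); [apply Hcayd, Hy|].
      destruct (Hpsi _ Hf) as (H1 & H2 & _). apply cdiff_normalized; auto.
    - intros y Hy. destruct (Hcay y Hy) as [_ Hf]. destruct (Hpsi _ Hf) as (_ & H2 & H3 & _).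
      rewrite <- Cmod_mult. unfold B.
      replace (F (psi (cay y)) * (cauchy b m (psi (cay y)) / Nn (cay y)))%C with
        (cauchy a k (psi (cay y)) / Nn (cay y))%C by (rewrite (F_quot _ H2); unfold Cdiv; ring).
      apply normalized_bound; auto. lra. }
  apply exp_mono. fold L.
  replace (z - 0)%C with z by ring. rewrite Hzmod, Rmult_1_r.
  assert (HDle : D <= p * (1 + Cmod w)).
  { unfold D. eapply Rle_trans; [apply Cmod_triangle|]. rewrite Cmod_conj. unfold p.
    generalize (Cmod_ge_0 w) (Cmod_ge_0 w0). nra. }
  replace (2 * p ^ 2 / x0 * L * ((1 + Cmod w) ^ 2 / fst w)) with
    (2 * (p * (1 + Cmod w)) ^ 2 / (x0 * fst w) * L) by (field; lra).
  apply Rmult_le_compat_r; [exact HL|].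
  apply Rle_trans with (2 * D ^ 2 / (x0 * fst w)).
  - replace (4 / (1 - nu / D)) with (4 * D / (D - nu)) by (field; lra).
    apply (Rmult_le_reg_r ((D - nu) * (x0 * fst w))); [apply Rmult_lt_0_compat; nra|].
    replace (4 * D / (D - nu) * ((D - nu) * (x0 * fst w))) with (D * (4 * fst w * x0)) by (field; lra).
    replace (2 * D ^ 2 / (x0 * fst w) * ((D - nu) * (x0 * fst w))) with (2 * D * (D * (D - nu))) by (field; lra).
    rewrite <- Hzm. replace (D * D - nu * nu) with ((D + nu) * (D - nu)) by ring.
    assert ((D + nu) * (D - nu) <= 2 * (D * (D - nu))) by nra. nra.
  - unfold Rdiv. apply Rmult_le_compat_r; [left; apply Rinv_0_lt_compat; nra|].
    apply Rmult_le_compat_l; [lra|]. apply pow_incr. lra.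
Qed.

(** The margin 2 leaves room to move the base point to 1 in a half plane that extends to the left of
    the imaginary axis. *)
Lemma half_plane_base_point (c v : C) : Cmod v = 1 ->
  (forall w, 0 < fst w -> off (c + v * w)%C) ->
  exists w, 2 < fst w /\ cauchy b m (c + v * w)%C <> 0.
Proof.
  intros Hv Hoff. assert (Hv0 : v <> 0) by (apply Cmod_gt_0; lra).
  assert (Hw : forall z, Cmod (z - (c + v * 3)) < 1 -> 2 < fst ((z - c) / v)%C).
  { intros z Hz. set (w := ((z - c) / v)%C).
    assert (Hw : Cmod (w - 3) < 1).
    { replace (w - 3)%C with ((z - (c + v * 3)) / v)%C by (unfold w; field; exact Hv0).
      rewrite Cmod_div, Hv by exact Hv0. lra. }
    assert (Hf : Rabs (fst w - 3) <= Cmod (w - 3)) by apply (abs_fst_le (w - 3)).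
    apply Rabs_le_between in Hf. lra. }
  assert (Ez : forall z, (c + v * ((z - c) / v))%C = z) by (intros z; field; exact Hv0).
  destruct (cauchy_nonzero_near (c + v * 3)%C 1 Rlt_0_1) as [z1 [Hz1 Hb1]].
  { intros z Hz. rewrite <- (Ez z). apply Hoff. specialize (Hw z Hz). lra. }
  exists ((z1 - c) / v)%C. rewrite Ez. split; [apply Hw, Hz1 | exact Hb1].
Qed.

(** On the boundary line $|F||B|\le1$, so $\log^+|F|\le-\log|B|$. Under $x=\tan(\theta/2)$ the
    measure $dx/(1+x^2)$ becomes $d\theta/2$ on the circle, where [jensen_half_plane] bounds the
    integral. *)
Lemma log_integral_half_plane (c v : C) (q : nat) (X : R) : Cmod v = 1 -> 0 < X ->
  (forall w, 0 < fst w -> off (c + v * w)%C /\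
     Cmod (cauchy a k (c + v * w)%C) <= X * (1 + Cmod w) ^ q /\
     Cmod (cauchy b m (c + v * w)%C) <= X * (1 + Cmod w) ^ q) ->
  exists c' u M, Cmod u = 1 /\ forall A, 0 < A ->
    RInt (fun x => ln (Rmax (Cmod (F (u * RtoC x + c')%C)) 1) / (1 + x * x)) (- A) A <= M.
Proof.
  intros Hv HX Hpsi0.
  destruct (half_plane_base_point c v Hv) as [w1 [Hw1 Hb1]]; [apply Hpsi0|].
  (* The shift puts the base point at [w = 1], and [psi] maps even $\mathrm{Re}\,w>-1$ into the
     given half plane, so that the line of integration is interior. *)
  set (c' := (c + v * (w1 - 1))%C). set (psi := fun w => (c' + v * w)%C).
  set (p := 2 + Cmod w1). assert (Hp : 2 <= p) by (unfold p; generalize (Cmod_ge_0 w1); lra).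
  set (Y := X * p ^ q).
  assert (Hpq : 0 < p ^ q) by (apply pow_lt; lra).
  assert (HY : 0 < Y) by (apply Rmult_lt_0_compat; assumption).
  assert (Hpsi : forall w, -1 < fst w -> off (psi w) /\
     Cmod (cauchy a k (psi w)) <= Y * (1 + Cmod w) ^ q /\
     Cmod (cauchy b m (psi w)) <= Y * (1 + Cmod w) ^ q).
  { intros w Hw. unfold psi, c'.
    replace (c + v * (w1 - 1) + v * w)%C with (c + v * (w1 - 1 + w))%C by ring.
    destruct (Hpsi0 (w1 - 1 + w)%C) as (H1 & H2 & H3); [simpl; lra|].
    assert (Hm : (1 + Cmod (w1 - 1 + w)) ^ q <= p ^ q * (1 + Cmod w) ^ q).
    { rewrite <- Rpow_mult_distr. apply pow_incr. split; [generalize (Cmod_ge_0 (w1 - 1 + w)); lra|].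
      assert (K1 := Cmod_triangle (w1 - 1) w). assert (K2 := Cmod_triangle w1 (- (1))).
      rewrite Cmod_m1 in K2. unfold Cminus in *. unfold p.
      generalize (Cmod_ge_0 w) (Cmod_ge_0 w1). nra. }
    split; [exact H1|]. unfold Y. rewrite Rmult_assoc.
    split; (eapply Rle_trans; [eassumption|]; apply Rmult_le_compat_l; [lra | exact Hm]). }
  set (Nn := fun w : C => (RtoC (Y * 2 ^ q) * (1 + w) ^ q)%C).
  set (B := fun w => (cauchy b m (psi w) / Nn w)%C).
  assert (Hn1 : forall w, -1 < fst w -> (1 + w)%C <> 0).
  { intros w Hw E. apply (f_equal fst) in E. simpl in E. lra. }
  assert (HBd : forall w, -1 < fst w -> cdiff B w).
  { intros w Hw. apply cdiff_normalized; auto; [apply cdiff_affine | apply Hpsi, Hw]. }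
  assert (HB1 : forall w, 0 <= fst w -> Cmod (B w) <= 1).
  { intros w Hw. apply normalized_bound; auto. apply Hpsi. lra. }
  assert (HFB : forall w, 0 <= fst w -> Cmod (F (psi w)) * Cmod (B w) <= 1).
  { intros w Hw. rewrite <- Cmod_mult. unfold B. destruct (Hpsi w) as (H1 & H2 & _); [lra|].
    replace (F (psi w) * (cauchy b m (psi w) / Nn w))%C with (cauchy a k (psi w) / Nn w)%C
      by (rewrite (F_quot _ H1); unfold Cdiv; ring).
    apply normalized_bound; auto. }
  assert (HB0 : B 1 <> 0).
  { unfold B. assert (HN : Nn 1 <> 0).
    { unfold Nn. apply Cmult_neq_0; [|apply Cpow_nz, Hn1; simpl; lra].
      intros E. apply RtoC_inj in E. assert (0 < 2 ^ q) by (apply pow_lt; lra). nra. }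
    intros E. apply Hb1.
    replace (c + v * w1)%C with (psi 1) by (unfold psi, c'; ring).
    replace (cauchy b m (psi 1)) with (cauchy b m (psi 1) / Nn 1 * Nn 1)%C by (field; exact HN).
    rewrite E. ring. }
  set (u := (- Ci * v)%C).
  assert (Hu : Cmod u = 1) by (unfold u; rewrite Cmod_mult, Cmod_opp, Cmod_Ci, Hv; ring).
  exists c', u, (PI * (1 - ln (Cmod (B 1)))). split; [exact Hu|]. intros A HA.
  assert (Hpi := PI_RGT_0).
  set (tau := 2 * atan A).
  assert (Htau : 0 < tau < PI).
  { unfold tau. generalize (atan_bound A). assert (0 < atan A) by (rewrite <- atan_0; apply atan_increasing; lra). lra. }
  assert (Hpath : forall x : R, (u * x + c')%C = psi (0, - x)).
  { intros x. unfold psi, u. apply injective_projections; simpl; ring. }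
  assert (HFc : forall x : R, continuous (fun s : R => Cmod (F (u * s + c')%C)) x).
  { intros x. apply (continuous_Cmod_ccont (fun z => F (u * z + c')%C) (fun s => s) (fun _ => 0)).
    - apply cdiff_ccont. apply (cdiff_comp F (fun z => u * z + c')%C); [|apply F_entire].
      apply cdiff_plus; [apply cdiff_scal, cdiff_id | apply cdiff_const].
    - apply continuous_id.
    - apply continuous_const. }
  destruct (continuity_ab_maj (fun s : R => Cmod (F (u * s + c')%C)) (- A) A) as [xm [Hxm _]]; [lra| |].
  { intros x _. apply continuity_pt_filterlim, HFc. }
  set (Mx := Rmax (Cmod (F (u * xm + c')%C)) 1).
  assert (HMx : 1 <= Mx) by apply Rmax_r.
  assert (HFM : forall x, - A <= x <= A -> Cmod (F (u * RtoC x + c')%C) <= Mx)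
    by (intros x Hx; eapply Rle_trans; [apply (Hxm x Hx) | apply Rmax_l]).
  (* The truncation depends on [A], but the bound from Jensen's inequality depends neither on [e]
     nor on [tau]; this is why the final bound is uniform in [A]. *)
  set (e := / Mx).
  assert (He : 0 < e <= 1).
  { unfold e. split; [apply Rinv_0_lt_compat; lra|]. rewrite <- Rinv_1. apply Rinv_le_contravar; lra. }
  assert (HeM : e * Mx = 1) by (unfold e; field; lra).
  assert (J := jensen_half_plane B e tau He Htau HBd HB1 HB0).
  set (h := fun x => - ln (Rmax (Cmod (B ((1 - cis x) / (1 + cis x))%C)) e)) in *.
  assert (Hcay : forall x, ((1 - cis (2 * atan x)) / (1 + cis (2 * atan x)))%C = (0, - x)).
  { intros x. rewrite cis_2atan. assert (Hx : 0 < 1 + x * x) by nra.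
    set (zz := (((1 - x * x) / (1 + x * x), 2 * x / (1 + x * x)) : C)).
    assert (Hn : (1 + zz)%C <> 0).
    { intros E. apply (f_equal fst) in E. simpl in E.
      replace (1 + (1 - x * x) / (1 + x * x)) with (2 / (1 + x * x)) in E by (field; lra).
      assert (0 < 2 / (1 + x * x)) by (apply Rdiv_lt_0_compat; lra). lra. }
    assert (E : (1 - zz)%C = ((0%R, (- x)%R) * (1 + zz))%C).
    { unfold zz. apply injective_projections; simpl; field; lra. }
    rewrite E. field. exact Hn. }
  assert (Hh : forall x, h (2 * atan x) = - ln (Rmax (Cmod (B (0, - x))) e)).
  { intros x. unfold h. rewrite Hcay. reflexivity. }
  assert (Hle : forall x, - A <= x <= A -> ln (Rmax (Cmod (F (u * RtoC x + c')%C)) 1) <= h (2 * atan x)).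
  { intros x Hx. rewrite Hh. rewrite Hpath.
    assert (Hb := HB1 (0, - x) (Rle_refl 0)). assert (Hfb := HFB (0, - x) (Rle_refl 0)).
    assert (HfM := HFM x Hx). rewrite Hpath in HfM.
    set (f1 := Cmod (F (psi (0, - x)))) in *. set (b1 := Cmod (B (0, - x))) in *.
    assert (Hb10 : 0 <= b1) by apply Cmod_ge_0. assert (Hf10 : 0 <= f1) by apply Cmod_ge_0.
    assert (Hmx : 0 < Rmax b1 e) by (eapply Rlt_le_trans; [apply (proj1 He) | apply Rmax_r]).
    rewrite <- ln_Rinv by exact Hmx. apply ln_le.
    - eapply Rlt_le_trans; [apply Rlt_0_1 | apply Rmax_r].
    - apply (Rmult_le_reg_r (Rmax b1 e)); [exact Hmx|]. rewrite Rinv_l by lra.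
      unfold Rmax. destruct (Rle_dec f1 1), (Rle_dec b1 e); nra. }
  assert (Hx2 : forall x : R, 0 < 1 + x * x) by (intros; nra).
  assert (HhC : forall x, - A <= x <= A -> continuous h (2 * atan x)).
  { intros x Hx. unfold h.
    apply (continuous_opp (fun x => ln (Rmax (Cmod (B ((1 - cis x) / (1 + cis x))%C)) e))).
    apply continuous_ln_max; [lra|].
    apply (continuous_Cmod_cis (fun z => B ((1 - z) / (1 + z))%C)).
    apply (cdiff_comp B (fun z => (1 - z) / (1 + z))%C).
    - apply cdiff_div; [apply cdiff_minus; [apply cdiff_const | apply cdiff_id] |
        apply cdiff_plus; [apply cdiff_const | apply cdiff_id] |].
      intros E. apply (f_equal fst) in E. rewrite cis_2atan in E. simpl in E.
      specialize (Hx2 x).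
      replace (1 + (1 - x * x) / (1 + x * x)) with (2 / (1 + x * x)) in E by (field; lra).
      assert (0 < 2 / (1 + x * x)) by (apply Rdiv_lt_0_compat; lra). lra.
    - rewrite Hcay. apply HBd. simpl. lra. }
  assert (Hd : forall x, is_derive (fun x => 2 * atan x) x (2 / (1 + x * x))).
  { intros x. auto_derive; [exact I|]. specialize (Hx2 x). field. nra. }
  assert (Hdc : forall x, continuous (fun x => 2 / (1 + x * x)) x).
  { intros x. apply (ex_derive_continuous (K := R_AbsRing) (V := R_NormedModule)).
    auto_derive. specialize (Hx2 x). lra. }
  assert (Hsub : RInt (fun x => 2 / (1 + x * x) * h (2 * atan x)) (- A) A = RInt h (- tau) tau).
  { assert (E := RInt_comp h (fun x => 2 * atan x) (fun x => 2 / (1 + x * x)) (- A) A).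
    cbv beta in E. rewrite atan_opp in E. replace (2 * - atan A) with (- tau) in E by (unfold tau; ring).
    fold tau in E. apply E.
    - rewrite Rmin_left, Rmax_right by lra. exact HhC.
    - intros; split; [apply Hd | apply Hdc]. }
  assert (Hprodc : forall x, - A <= x <= A -> continuous (fun x => 2 / (1 + x * x) * h (2 * atan x)) x).
  { intros x Hx. apply (continuous_mult (fun x => 2 / (1 + x * x)) (fun x => h (2 * atan x))); [apply Hdc|].
    apply (continuous_comp (fun x => 2 * atan x) h); [|apply HhC, Hx].
    apply (ex_derive_continuous (K := R_AbsRing) (V := R_NormedModule)). eexists. apply Hd. }
  assert (Hex3 := ex_RInt_cont _ (- A) A ltac:(lra) Hprodc).
  apply Rle_trans with (RInt (fun x => / 2 * (2 / (1 + x * x) * h (2 * atan x))) (- A) A).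
  - apply RInt_le; [lra | | apply (ex_RInt_scal (V := R_NormedModule)); exact Hex3 |].
    + apply ex_RInt_cont; [lra|]. intros x Hx.
      apply (continuous_mult (fun x : R => ln (Rmax (Cmod (F (u * x + c')%C)) 1)) (fun x => / (1 + x * x))).
      * apply continuous_ln_max; [lra | apply HFc].
      * apply (ex_derive_continuous (K := R_AbsRing) (V := R_NormedModule)). auto_derive. specialize (Hx2 x). lra.
    + intros x Hx. specialize (Hle x ltac:(lra)). specialize (Hx2 x).
      replace (/ 2 * (2 / (1 + x * x) * h (2 * atan x))) with (h (2 * atan x) / (1 + x * x)) by (field; lra).
      apply Rmult_le_compat_r; [left; apply Rinv_0_lt_compat, Hx2 | exact Hle].
  - assert (E := RInt_scal (fun x => 2 / (1 + x * x) * h (2 * atan x)) (- A) A (/ 2) Hex3).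
    apply Rle_trans with (/ 2 * RInt h (- tau) tau).
    + right. rewrite <- Hsub. apply E.
    + lra.
Qed.

Let S := 1 + mass a k + mass b m.

Lemma S_ge_1 : 1 <= S.
Proof.
  unfold S. generalize (mass_nonneg a k a_adm) (mass_nonneg b m b_adm). lra.
Qed.

Lemma transforms_bound (z : C) (X : R) : 0 <= X ->
  (forall n, Cmod (t n) <= X * Cmod (z - t n)) ->
  off z /\ Cmod (cauchy a k z) <= X * S * (1 + Cmod z) ^ (k + m) /\
  Cmod (cauchy b m z) <= X * S * (1 + Cmod z) ^ (k + m).
Proof.
  intros HX H. split; [apply (off_of_bound z X H)|].
  assert (Hgen : forall c j, adm c j -> (j <= k + m)%nat -> mass c j <= S ->
    Cmod (cauchy c j z) <= X * S * (1 + Cmod z) ^ (k + m)).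
  { intros c j Hc Hj Hm. assert (Hmn := mass_nonneg c j Hc). assert (Hz := Cmod_ge_0 z).
    eapply Rle_trans; [apply (cauchy_bound c j z X Hc HX H)|].
    rewrite Rmult_comm. apply Rmult_le_compat.
    - apply Rmult_le_pos; assumption.
    - apply pow_le, Hz.
    - apply Rmult_le_compat_l; assumption.
    - apply Rle_trans with ((1 + Cmod z) ^ j); [apply pow_incr; lra | apply Rle_pow; [lra | exact Hj]]. }
  assert (Ha := mass_nonneg a k a_adm). assert (Hb := mass_nonneg b m b_adm).
  split; apply Hgen; auto; unfold S; lia || lra.
Qed.

(** * Case $\mathbf{\Pi}$: poles in a strip *)

Section Strip.
Variables (p u : C) (h : R).
Hypothesis u_mod : Cmod u = 1.
Hypothesis h_pos : 0 < h.
Hypothesis t_strip : forall n, Rabs (snd (Cconj u * (t n - p))%C) <= h.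

(** Beyond distance [y0] from the axis the distance to every pole exceeds 2, so [1 + Cmod z] can
    serve as separation constant; it accounts for the extra 1 in [q]. [X] absorbs the translation of
    the half plane. *)
Let y0 := h + 2.
Let q := (k + m + 1)%nat.
Let X := S * (1 + Cmod p + y0) ^ q.

Lemma strip_X_pos : 0 < X.
Proof.
  generalize S_ge_1 (Cmod_ge_0 p). intros. unfold X, y0.
  apply Rmult_lt_0_compat; [lra | apply pow_lt; lra].
Qed.

Lemma strip_half_plane (e w : C) : e = Ci \/ e = (- Ci)%C -> 0 < fst w ->
  off (p + u * e * RtoC y0 + u * e * w)%C /\
  Cmod (cauchy a k (p + u * e * RtoC y0 + u * e * w)%C) <= X * (1 + Cmod w) ^ q /\
  Cmod (cauchy b m (p + u * e * RtoC y0 + u * e * w)%C) <= X * (1 + Cmod w) ^ q.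
Proof.
  intros He Hw. set (z := (p + u * e * RtoC y0 + u * e * w)%C).
  assert (Hz := Cmod_ge_0 z). assert (Hw0 := Cmod_ge_0 w). assert (Hp := Cmod_ge_0 p).
  assert (HS := S_ge_1).
  assert (Heu : Cmod (u * e) = 1).
  { rewrite Cmod_mult, u_mod. destruct He as [-> | ->]; rewrite ?Cmod_opp, Cmod_Ci; ring. }
  assert (Hsep : forall n, 1 <= Cmod (z - t n)).
  { intros n. specialize (t_strip n). apply Rabs_le_between in t_strip.
    replace (Cmod (z - t n)) with (Cmod (Cconj u * (z - t n))) by (rewrite Cmod_mult, Cmod_conj, u_mod; ring).
    eapply Rle_trans; [|apply abs_snd_le].
    assert (E : (Cconj u * (z - t n))%C = (e * (RtoC y0 + w) - Cconj u * (t n - p))%C).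
    { assert (Euu : (Cconj u * u)%C = 1).
      { generalize (Cmod2_conj u). rewrite u_mod. intros E2. rewrite Cmult_comm, <- E2.
        apply injective_projections; simpl; ring. }
      replace (Cconj u * (z - t n))%C with ((Cconj u * u) * (e * (RtoC y0 + w)) - Cconj u * (t n - p))%C
        by (unfold z; ring).
      rewrite Euu. ring. }
    rewrite E. set (v := (Cconj u * (t n - p))%C) in *. clearbody v.
    destruct He as [-> | ->]; simpl.
    - rewrite Rabs_pos_eq; unfold y0; lra.
    - rewrite Rabs_left; unfold y0; lra. }
  destruct (transforms_bound z (1 + Cmod z)) as (H1 & H2 & H3); [lra| |].
  { intros n. specialize (Hsep n). assert (K1 := Cmod_triangle' (t n) z).
    rewrite Cmod_minus_sym in K1. nra. }
  assert (Hle : (1 + Cmod z) * S * (1 + Cmod z) ^ (k + m) <= X * (1 + Cmod w) ^ q).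
  { replace ((1 + Cmod z) * S * (1 + Cmod z) ^ (k + m)) with (S * (1 + Cmod z) ^ q)
      by (unfold q; rewrite pow_add; simpl; ring).
    unfold X. rewrite Rmult_assoc. apply Rmult_le_compat_l; [lra|].
    rewrite <- Rpow_mult_distr. apply pow_incr. split; [lra|].
    assert (Hzle : Cmod z <= Cmod p + y0 + Cmod w).
    { unfold z. eapply Rle_trans; [apply Cmod_triangle|].
      eapply Rle_trans; [apply Rplus_le_compat_r, Cmod_triangle|].
      rewrite (Cmod_mult (u * e) (RtoC y0)), (Cmod_mult (u * e) w), Heu, Cmod_R.
      rewrite Rabs_pos_eq; unfold y0; lra. }
    unfold y0 in *. nra. }
  split; [exact H1|]. split; eapply Rle_trans; eassumption.
Qed.

(** On these rays the real part of [w] is at least $rs_0/2$ for large [r], so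
    $(1+|w|)^2/\mathrm{Re}\,w$ is $O(r)$. The bounded radii are covered by the finite order
    bound. *)
Lemma strip_ray (e : C) (s0 : R) : e = Ci \/ e = (- Ci)%C -> 0 < s0 ->
  exists A, 0 <= A /\ forall r phi, 0 < r -> s0 <= cos phi ->
    Cmod (F (p + u * e * (r * cis phi))%C) <= exp (A * (1 + r)).
Proof.
  intros He Hs0. set (c := (p + u * e * RtoC y0)%C).
  assert (Heu : Cmod (u * e) = 1).
  { rewrite Cmod_mult, u_mod. destruct He as [-> | ->]; rewrite ?Cmod_opp, Cmod_Ci; ring. }
  destruct (half_plane_base_point c (u * e)%C Heu) as [w1 [Hw1 Hb1]].
  { intros w Hw. apply (strip_half_plane e w He Hw). }
  destruct (growth_half_plane (fun w => c + u * e * w)%C q X w1 strip_X_pos) as [A [HA Hgr]]; [ | lra | exact Hb1 |].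
  { intros w Hw. split; [apply cdiff_affine | apply (strip_half_plane e w He Hw)]. }
  destruct growth_finite_order as [A2 [HA2 Hord]].
  assert (Hy0 : 2 < y0) by (unfold y0; lra).
  (* From [r2] on, the shift [y0] is at most half of $r\cos\varphi$. *)
  set (r2 := Rmax (2 * y0 / s0) 1).
  assert (Hr2 : 1 <= r2) by apply Rmax_r.
  assert (Hp := Cmod_ge_0 p).
  set (C2 := A2 * Rpower (1 + Cmod p + r2) K).
  assert (HC2 : 0 <= C2) by (apply Rmult_le_pos; [exact HA2 | left; apply exp_pos]).
  set (C1 := A * (2 * (2 + y0) ^ 2 / s0)).
  assert (HC1 : 0 <= C1).
  { apply Rmult_le_pos; [exact HA|]. apply Rmult_le_pos; [|left; apply Rinv_0_lt_compat, Hs0].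
    generalize (pow2_ge_0 (2 + y0)). lra. }
  exists (C1 + C2). split; [lra|]. intros r phi Hr Hphi.
  assert (Hrm : Cmod (r * cis phi) = r) by (apply Cmod_scaled_cis; lra).
  destruct (Rle_dec r2 r) as [Hbig|Hsmall].
  - set (w := (r * cis phi - RtoC y0)%C).
    assert (Hfw : r * s0 / 2 <= fst w).
    { assert (E : fst w = r * cos phi - y0) by (unfold w; simpl; ring). rewrite E.
      assert (K1 : 2 * y0 / s0 <= r) by (eapply Rle_trans; [apply Rmax_l | apply Hbig]).
      apply (Rmult_le_compat_r s0) in K1; [|lra].
      replace (2 * y0 / s0 * s0) with (2 * y0) in K1 by (field; lra). nra. }
    assert (Hfw0 : 0 < fst w) by nra.
    assert (Hwm : Cmod w <= r + y0).
    { unfold w. eapply Rle_trans; [apply Cmod_triangle|]. rewrite Cmod_opp, Hrm, Cmod_R, Rabs_pos_eq; lra. }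
    specialize (Hgr w Hfw0). cbv beta in Hgr.
    replace (c + u * e * w)%C with (p + u * e * (r * cis phi))%C in Hgr by (unfold c, w; ring).
    eapply Rle_trans; [apply Hgr|]. apply exp_mono.
    apply Rle_trans with (C1 * r); [|nra]. unfold C1. rewrite Rmult_assoc.
    apply Rmult_le_compat_l; [exact HA|].
    apply (Rmult_le_reg_r (fst w)); [exact Hfw0|].
    unfold Rdiv at 1. rewrite Rmult_assoc, Rinv_l, Rmult_1_r by lra.
    apply Rle_trans with (((2 + y0) * r) ^ 2).
    + apply pow_incr. generalize (Cmod_ge_0 w). nra.
    + apply Rle_trans with (2 * (2 + y0) ^ 2 / s0 * r * (r * s0 / 2)).
      * right. field. lra.
      * apply Rmult_le_compat_l; [|exact Hfw]. apply Rmult_le_pos; [|lra].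
        apply Rmult_le_pos; [|left; apply Rinv_0_lt_compat, Hs0]. generalize (pow2_ge_0 (2 + y0)). lra.
  - eapply Rle_trans; [apply Hord|]. apply exp_mono.
    apply Rle_trans with C2; [|nra]. unfold C2. apply Rmult_le_compat_l; [exact HA2|].
    apply Rle_Rpower_l; [lra|]. split; [generalize (Cmod_ge_0 (p + u * e * (r * cis phi))); lra|].
    assert (K1 := Cmod_triangle p (u * e * (r * cis phi))).
    rewrite (Cmod_mult (u * e)), Heu, Hrm in K1. lra.
Qed.

Lemma strip_transverse_growth (s0 : R) : 0 < s0 ->
  exists A, 0 <= A /\ forall r x, 0 < r -> s0 <= Rabs (sin x) ->
    Cmod (F (p + u * (r * cis x))%C) <= exp (A * (1 + r)).
Proof.
  intros Hs0.
  destruct (strip_ray Ci s0 (or_introl eq_refl) Hs0) as [A1 [HA1 H1]].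
  destruct (strip_ray (- Ci)%C s0 (or_intror eq_refl) Hs0) as [A2 [HA2 H2]].
  exists (A1 + A2). split; [lra|]. intros r x Hr Hx.
  destruct (Rle_dec 0 (sin x)) as [Hs|Hs].
  - rewrite Rabs_pos_eq in Hx by exact Hs.
    replace (u * (r * cis x))%C with (u * Ci * (r * cis (x - PI / 2)))%C.
    + eapply Rle_trans; [apply H1; [exact Hr|]|].
      * replace (x - PI / 2) with (- (PI / 2 - x)) by ring. rewrite cos_neg, cos_shift. exact Hx.
      * apply exp_mono. nra.
    + rewrite <- cis_PI2. replace (cis x) with (cis (PI / 2) * cis (x - PI / 2))%C.
      * ring.
      * rewrite <- cis_plus. f_equal. ring.
  - rewrite Rabs_left in Hx by lra.
    replace (u * (r * cis x))%C with (u * - Ci * (r * cis (x + PI / 2)))%C.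
    + eapply Rle_trans; [apply H2; [exact Hr|]|].
      * rewrite cos_plus, cos_PI2, sin_PI2. lra.
      * apply exp_mono. nra.
    + rewrite cis_plus, cis_PI2.
      replace (u * - Ci * (r * (cis x * Ci)))%C with (u * (r * cis x) * (- (Ci * Ci)))%C by ring.
      replace (- (Ci * Ci))%C with (RtoC 1) by (apply injective_projections; simpl; ring). ring.
Qed.

(** Only the directions within [al] of the axis remain. They form two angles bounded by rays of
    transverse growth, with [al] small enough for the order [K']. *)
Lemma strip_exp_type : exists A, 0 <= A /\ forall z, Cmod (F z) <= exp (A * (1 + Cmod z)).
Proof.
  assert (Hpi := PI_RGT_0).
  (* At least 1, so that [al] is also admissible for the exponent 1 of the bound to be proved. *)
  set (K' := Rmax K 1). assert (HK' : 1 <= K') by apply Rmax_r. assert (HKK : K <= K') by apply Rmax_l.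
  set (al := PI / (4 * K')).
  assert (Hal0 : 0 < al) by (apply Rdiv_lt_0_compat; lra).
  assert (HKal : K' * al = PI / 4) by (unfold al; field; lra).
  assert (Hal : al <= PI / 4) by nra.
  destruct growth_finite_order as [A1 [HA1 Hord]].
  assert (Hord' : forall z, Cmod (F z) <= exp (A1 * Rpower (1 + Cmod z) K')).
  { intros z. eapply Rle_trans; [apply Hord|]. apply exp_mono, Rmult_le_compat_l; [exact HA1|].
    apply Rle_Rpower; [generalize (Cmod_ge_0 z); lra | exact HKK]. }
  assert (Hs0 : 0 < sin al) by (apply sin_gt_0; lra).
  destruct (strip_transverse_growth (sin al) Hs0) as [A2 [HA2 Htr]].
  assert (HP1 : forall r, 0 < r -> Rpower r 1 = r) by (intros; apply Rpower_1; assumption).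
  assert (Habs : forall phi, Rabs phi = al -> Rabs (sin phi) = sin al).
  { intros phi Hphi. unfold Rabs in Hphi. destruct (Rcase_abs phi).
    - replace phi with (- al) by lra. rewrite sin_neg, Rabs_Ropp. apply Rabs_pos_eq. lra.
    - rewrite Hphi. apply Rabs_pos_eq. lra. }
  assert (Hshift : forall r x, (- u * (RtoC r * cis x))%C = (u * (RtoC r * cis (x + PI)))%C).
  { intros r x. rewrite cis_plus, cis_PI. ring. }
  destruct (sector_phragmen_lindelof F A1 K' p u al 1 A2) as [C1 [HC1 HS1]]; try assumption; try lra.
  { intros r phi Hr Hphi. rewrite HP1 by exact Hr. apply Htr; [exact Hr|]. rewrite Habs; lra. }
  destruct (sector_phragmen_lindelof F A1 K' p (- u)%C al 1 A2) as [C2 [HC2 HS2]]; try assumption; try lra.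
  { rewrite Cmod_opp. exact u_mod. }
  { intros r phi Hr Hphi. rewrite HP1, Hshift by exact Hr. apply Htr; [exact Hr|].
    rewrite neg_sin, Rabs_Ropp, Habs; lra. }
  destruct (growth_of_polar_growth F p u 1 (A2 + C1 + C2)) as [A [HA H]]; try lra; try assumption.
  - intros r phi Hr Hphi. rewrite HP1 by exact Hr.
    assert (Hmon : forall c, 0 <= c <= A2 + C1 + C2 ->
      Cmod (F (p + u * (r * cis phi))%C) <= exp (c * (1 + r)) ->
      Cmod (F (p + u * (r * cis phi))%C) <= exp ((A2 + C1 + C2) * (1 + r))).
    { intros c Hc Hle. eapply Rle_trans; [apply Hle|]. apply exp_mono. nra. }
    assert (Hopp : forall psi, (u * (RtoC r * cis (psi + PI)))%C = (u * (RtoC r * cis phi))%C -> Rabs psi <= al ->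
      Cmod (F (p + u * (r * cis phi))%C) <= exp ((A2 + C1 + C2) * (1 + r))).
    { intros psi E Hpsi. apply (Hmon C2); [lra|]. specialize (HS2 r psi Hr Hpsi).
      rewrite Hshift, E, HP1 in HS2 by exact Hr. exact HS2. }
    destruct (Rle_dec (Rabs phi) al) as [Hs|Hs].
    + apply (Hmon C1); [lra|]. specialize (HS1 r phi Hr Hs). rewrite HP1 in HS1 by exact Hr. exact HS1.
    + destruct (Rle_dec (PI - al) phi) as [Hs2|Hs2].
      { apply (Hopp (phi - PI)); [do 3 f_equal; ring | apply Rabs_le; lra]. }
      destruct (Rle_dec phi (- PI + al)) as [Hs3|Hs3].
      { apply (Hopp (phi + PI)); [|apply Rabs_le; lra].
        replace (phi + PI + PI) with (phi + 2 * PI) by ring. rewrite cis_period. reflexivity. }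
      apply (Hmon A2); [lra|]. apply Htr; [exact Hr|].
      unfold Rabs at 1 in Hs. destruct (Rcase_abs phi).
      * rewrite <- Rabs_Ropp, <- sin_neg. eapply Rle_trans; [|apply Rle_abs]. apply sin_ge_on; lra.
      * eapply Rle_trans; [|apply Rle_abs]. apply sin_ge_on; lra.
  - exists A. split; [exact HA|]. intros z. specialize (H z).
    rewrite Rpower_1 in H by (generalize (Cmod_ge_0 z); lra). exact H.
Qed.

Lemma strip_log_integral : exists c' u' M, Cmod u' = 1 /\ forall A, 0 < A ->
  RInt (fun x => ln (Rmax (Cmod (F (u' * RtoC x + c')%C)) 1) / (1 + x * x)) (- A) A <= M.
Proof.
  apply (log_integral_half_plane (p + u * Ci * RtoC y0)%C (u * Ci)%C q X).
  - rewrite Cmod_mult, u_mod, Cmod_Ci. ring.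
  - apply strip_X_pos.
  - intros w Hw. apply (strip_half_plane Ci w (or_introl eq_refl) Hw).
Qed.
End Strip.

(** * Case $\mathbf{A_\gamma}$: poles in an angle *)

Section Sector.
Variables (gamma : R) (e1 : C).
Hypothesis gamma_bound : 0 < gamma < 1.
Hypothesis K_gamma : K < / gamma.
Hypothesis e1_mod : Cmod e1 = 1.
Hypothesis t_sector : forall n, exists phi, Rabs phi < PI * gamma / 2 /\
  t n = (Cmod (t n) * (e1 * cis phi))%C.

(** Directions at most $\pi-\pi\gamma_2/2$ from [- e1] make an angle of at least [d] with every
    pole, [d] being half the difference of the two openings; hence $X=1/\sin d$. *)
Lemma sector_X (gamma2 : R) : gamma < gamma2 < 1 -> exists X, 0 < X /\
  forall r phi, 0 <= r -> Rabs phi <= PI - PI * gamma2 / 2 ->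
  forall n, Cmod (t n) <= X * Cmod (- e1 * (r * cis phi) - t n).
Proof.
  intros Hg2. assert (Hpi := PI_RGT_0). set (d := PI * gamma2 / 2 - PI * gamma / 2).
  assert (Hd : 0 < d < PI) by (unfold d; nra).
  assert (Hsd : 0 < sin d) by (apply sin_gt_0; lra).
  exists (/ sin d). split; [apply Rinv_0_lt_compat, Hsd|].
  intros r phi Hr Hphi n. destruct (t_sector n) as [x [Hx Et]].
  assert (Hcos : cos (phi + PI - x) <= cos d).
  { replace (phi + PI - x) with ((phi - x) + PI) by ring. rewrite neg_cos.
    assert (K1 : cos (PI - d) <= cos (phi - x)).
    { apply cos_ge_on; [|lra]. apply Rabs_lt_between in Hx. apply Rabs_le_between in Hphi.
      apply Rabs_le. unfold d. lra. }
    replace (PI - d) with (- (d - PI)) in K1 by ring. rewrite cos_neg in K1.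
    replace (d - PI) with (d + PI - 2 * PI) in K1 by ring.
    assert (E : cos (d + PI - 2 * PI) = - cos d).
    { rewrite cos_minus, cos_2PI, sin_2PI, neg_cos. ring. }
    lra. }
  assert (H := sector_separation r (Cmod (t n)) (phi + PI) x d Hr (Cmod_ge_0 _) Hd Hcos).
  replace (Cmod (- e1 * (r * cis phi) - t n)) with (Cmod (r * cis (phi + PI) - Cmod (t n) * cis x)); [exact H|].
  rewrite <- (Rmult_1_l (Cmod (r * cis (phi + PI) - Cmod (t n) * cis x))), <- e1_mod, <- Cmod_mult.
  f_equal. rewrite Et at 2. rewrite cis_plus, cis_PI. ring.
Qed.

Lemma sector_log_integral : exists c' u' M, Cmod u' = 1 /\ forall A, 0 < A ->
  RInt (fun x => ln (Rmax (Cmod (F (u' * RtoC x + c')%C)) 1) / (1 + x * x)) (- A) A <= M.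
Proof.
  assert (Hpi := PI_RGT_0).
  (* Any opening strictly between $\pi\gamma$ and $\pi$ would do: its complement contains the half
     plane opposite to the poles. *)
  destruct (sector_X ((gamma + 1) / 2)) as [X [HX Hsep]]; [lra|].
  assert (HS := S_ge_1).
  apply (log_integral_half_plane 0 (- e1)%C (k + m) (X * S)).
  - rewrite Cmod_opp. exact e1_mod.
  - nra.
  - intros w Hw. replace (0 + - e1 * w)%C with (- e1 * w)%C by ring.
    assert (Ew := cexp_clog w Hw). rewrite cexp_cis in Ew.
    set (x := snd (clog w)) in *.
    assert (Hx : - PI / 2 < x < PI / 2) by (unfold x, clog; simpl; apply atan_bound).
    destruct (transforms_bound (- e1 * w) X) as (H1 & H2 & H3); [lra| |].
    + intros n. rewrite <- Ew. apply Hsep; [left; apply exp_pos|]. apply Rabs_le. nra.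
    + rewrite Cmod_mult, Cmod_opp, e1_mod, Rmult_1_l in H2, H3. auto.
Qed.

(* The map [psi w = - e1 w^s] sends the right half plane onto a pole-free angle of opening
   [s PI > PI], which turns the half plane bound [|w|] into [|z|^(1/s)]. *)
Lemma sector_order_lt_1 : exists sigma A, 0 < sigma < 1 /\ 0 <= A /\
  forall z, Cmod (F z) <= exp (A * Rpower (1 + Cmod z) sigma).
Proof.
  assert (Hpi := PI_RGT_0).
  set (m0 := Rmin 1 (/ K)).
  assert (Hm0 : gamma < m0).
  { apply Rmin_glb_lt; [lra|]. rewrite <- (Rinv_inv gamma). apply Rinv_lt_contravar; [|exact K_gamma].
    apply Rmult_lt_0_compat; [exact K_pos | apply Rinv_0_lt_compat; lra]. }
  assert (Hm1 : m0 <= 1) by apply Rmin_l. assert (HmK : m0 <= / K) by apply Rmin_r.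
  (* Two intermediate openings. The half plane is mapped onto the complement of the angle of opening
     [PI * g2], which keeps it away from the poles. Phragmen-Lindelof is applied in the larger angle
     of opening [PI * g1], whose sides are therefore interior rays of that complement and which
     still satisfies [K * g1 < 1]. *)
  set (g1 := (gamma + 2 * m0) / 3). set (g2 := (2 * gamma + m0) / 3).
  assert (Hg : gamma < g2 < g1 /\ g1 < m0) by (unfold g1, g2; lra).
  assert (HKg : K * g1 < 1).
  { apply Rlt_le_trans with (K * / K); [apply Rmult_lt_compat_l; lra | right; field; lra]. }
  set (s := 2 - g2). set (sigma := / s).
  assert (Hs : 1 < s < 2) by (unfold s; lra).
  assert (Hsig : 0 < sigma < 1).
  { unfold sigma. split; [apply Rinv_0_lt_compat; lra|]. rewrite <- Rinv_1. apply Rinv_lt_contravar; lra. }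
  assert (Hss : s * sigma = 1) by (unfold sigma; field; lra).
  set (al1 := PI * g1 / 2).
  assert (Hal1 : 0 < al1 < PI / 2) by (unfold al1; nra).
  destruct (sector_X g2) as [X [HX Hsep]]; [lra|].
  assert (HS := S_ge_1).
  set (psi := fun w => (- e1 * cexp (RtoC s * clog w))%C).
  assert (Hpsi_eq : forall w, 0 < fst w -> psi w = (- e1 * (Rpower (Cmod w) s * cis (s * snd (clog w))))%C).
  { intros w Hw. unfold psi. f_equal. rewrite cexp_cis. unfold clog. simpl fst. simpl snd.
    replace (s * ln (Cmod w) - 0 * atan (snd w / fst w)) with (s * ln (Cmod w)) by ring.
    replace (s * atan (snd w / fst w) + 0 * ln (Cmod w)) with (s * atan (snd w / fst w)) by ring.
    reflexivity. }
  assert (Hwpos : forall w : C, 0 < fst w -> 0 < Cmod w).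
  { intros w Hw. apply Cmod_gt_0. intros E. apply (f_equal fst) in E. simpl in E. lra. }
  assert (Hpsi_sep : forall w, 0 < fst w -> forall n, Cmod (t n) <= X * Cmod (psi w - t n)).
  { intros w Hw. rewrite (Hpsi_eq w Hw). apply Hsep; [left; apply exp_pos|].
    assert (Hx := atan_bound (snd w / fst w)). unfold clog. simpl snd.
    rewrite Rabs_mult, Rabs_pos_eq by lra.
    assert (Ha : Rabs (atan (snd w / fst w)) <= PI / 2) by (apply Rabs_le; lra).
    replace (PI - PI * g2 / 2) with (s * (PI / 2)) by (unfold s; field).
    apply Rmult_le_compat_l; lra. }
  assert (Hpsi_mod : forall w, 0 < fst w -> Cmod (psi w) = Rpower (Cmod w) s).
  { intros w Hw. rewrite (Hpsi_eq w Hw), !Cmod_mult, Cmod_opp, e1_mod, Cmod_cis, Cmod_R.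
    rewrite Rabs_pos_eq by (left; apply exp_pos). ring. }
  (* Twice the degree, since $|\psi(w)|=|w|^s\le(1+|w|)^2$ with $s<2$. *)
  set (q := (2 * (k + m))%nat).
  set (Y := X * S * 2 ^ (k + m)).
  assert (H2km : 0 < 2 ^ (k + m)) by (apply pow_lt; lra).
  assert (HY : 0 < Y) by (apply Rmult_lt_0_compat; nra).
  assert (Hpsi : forall w, 0 < fst w -> cdiff psi w /\ off (psi w) /\
     Cmod (cauchy a k (psi w)) <= Y * (1 + Cmod w) ^ q /\
     Cmod (cauchy b m (psi w)) <= Y * (1 + Cmod w) ^ q).
  { intros w Hw. split.
    { apply cdiff_scal. apply (cdiff_comp cexp); [|apply cdiff_cexp].
      apply cdiff_scal, cdiff_clog, Hw. }
    destruct (transforms_bound (psi w) X) as (H1 & H2 & H3); [lra | apply Hpsi_sep, Hw |].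
    split; [exact H1|].
    assert (Hle : X * S * (1 + Cmod (psi w)) ^ (k + m) <= Y * (1 + Cmod w) ^ q).
    { unfold Y, q. rewrite pow_mult, Rmult_assoc, Rmult_assoc, Rmult_assoc. apply Rmult_le_compat_l; [lra|].
      apply Rmult_le_compat_l; [lra|]. rewrite <- Rpow_mult_distr. apply pow_incr.
      rewrite (Hpsi_mod w Hw). specialize (Hwpos w Hw).
      assert (Hp := exp_pos (s * ln (Cmod w))). rewrite Rpower_exp in Hp by exact Hwpos.
      split; [lra|].
      assert (Hp2 : Rpower (Cmod w) s <= (1 + Cmod w) ^ 2).
      { apply Rle_trans with (Rpower (1 + Cmod w) s); [apply Rle_Rpower_l; lra|].
        rewrite <- (Rpower_pow 2) by lra. apply Rle_Rpower; simpl; lra. }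
      simpl in *. nra. }
    split; eapply Rle_trans; eassumption. }
  assert (He10 : e1 <> 0) by (apply Cmod_gt_0; lra).
  (* A neighbourhood of $-e_1$ lies in the range of [psi]; the preimage is taken with the power
     [sigma], the inverse of [s]. This moves a point where the denominator does not vanish into the
     half plane. *)
  assert (Hnear : forall z, Cmod (z - - e1) < / 2 -> exists w, 0 < fst w /\ psi w = z).
  { intros z Hz. set (z' := (- z / e1)%C).
    assert (Hz' : Cmod (z' - 1) < / 2).
    { replace (z' - 1)%C with (- (z - - e1) / e1)%C by (unfold z'; field; exact He10).
      rewrite Cmod_div, Cmod_opp, e1_mod by exact He10. lra. }
    assert (Hf : 0 < fst z').
    { assert (K1 : Rabs (fst z' - 1) <= Cmod (z' - 1)) by apply (abs_fst_le (z' - 1)).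
      apply Rabs_le_between in K1. lra. }
    set (th := sigma * snd (clog z')).
    assert (Hx : - PI / 2 < snd (clog z') < PI / 2) by (unfold clog; simpl; apply atan_bound).
    assert (Hth : - (PI / 2) < th < PI / 2) by (unfold th; nra).
    exists (Rpower (Cmod z') sigma * cis th)%C.
    assert (Hrho : 0 < Rpower (Cmod z') sigma) by apply exp_pos.
    split.
    { simpl. assert (0 < cos th) by (apply cos_gt_0; lra).
      assert (0 < Rpower (Cmod z') sigma * cos th) by (apply Rmult_lt_0_compat; assumption). lra. }
    unfold psi. rewrite clog_cis by assumption.
    replace (RtoC s * (ln (Rpower (Cmod z') sigma), th))%C with (clog z').
    - rewrite cexp_clog by exact Hf. unfold z'. field. exact He10.
    - assert (Hpair : forall x y : R, (RtoC s * (x, y))%C = (s * x, s * y)).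
      { intros x y. apply injective_projections; simpl; ring. }
      assert (Hsl : forall L, s * (sigma * L) = L) by (intros L; rewrite <- Rmult_assoc, Hss; ring).
      rewrite Hpair, ln_Rpower. unfold th. rewrite !Hsl. reflexivity. }
  destruct (cauchy_nonzero_near (- e1)%C (/ 2)) as [z1 [Hz1 Hb1]]; [lra| |].
  { intros z Hz. destruct (Hnear z Hz) as [w [Hw <-]]. apply Hpsi, Hw. }
  destruct (Hnear z1 Hz1) as [w0 [Hw0 Ew0]]. rewrite <- Ew0 in Hb1.
  destruct (growth_half_plane psi q Y w0 HY Hpsi Hw0 Hb1) as [A [HA Hgr]].
  destruct growth_finite_order as [A2 [HA2 Hord]].
  set (c1 := cos ((PI - al1) * sigma)).
  assert (Hang : (PI - al1) * sigma < PI / 2).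
  { apply (Rmult_lt_reg_r s); [lra|].
    replace ((PI - al1) * sigma * s) with ((PI - al1) * (s * sigma)) by ring. rewrite Hss.
    unfold al1, s. nra. }
  assert (Hc1 : 0 < c1) by (apply cos_gt_0; [nra | exact Hang]).
  set (C1 := A * (4 / c1)). set (C2 := A2 * Rpower 2 K).
  assert (HC1 : 0 <= C1).
  { apply Rmult_le_pos; [exact HA|]. left. apply Rdiv_lt_0_compat; lra. }
  assert (HC2 : 0 <= C2) by (apply Rmult_le_pos; [exact HA2 | left; apply exp_pos]).
  assert (Hout : forall r phi, 0 < r -> Rabs phi <= PI - al1 ->
    Cmod (F (- e1 * (r * cis phi))%C) <= exp ((C1 + C2) * (1 + Rpower r sigma))).
  { intros r phi Hr Hphi. assert (Hrs : 0 < Rpower r sigma) by apply exp_pos.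
    destruct (Rle_dec 1 r) as [Hr1|Hr1].
    - set (rho := Rpower r sigma) in *. set (th := sigma * phi).
      assert (Hrho1 : 1 <= rho) by (apply Rpower_ge_1; lra).
      assert (Habs : Rabs th <= (PI - al1) * sigma).
      { unfold th. rewrite Rabs_mult, Rabs_pos_eq by lra. rewrite Rmult_comm. apply Rmult_le_compat_r; lra. }
      assert (Hth : - (PI / 2) < th < PI / 2) by (apply Rabs_le_between in Habs; lra).
      assert (Hcth : c1 <= cos th) by (apply cos_ge_on; [exact Habs | lra]).
      set (w := (rho * cis th)%C).
      assert (Hfw : fst w = rho * cos th) by (unfold w; simpl; ring).
      assert (Hfw0 : 0 < fst w) by (rewrite Hfw; nra).
      assert (Hwm : Cmod w = rho) by (unfold w; apply Cmod_scaled_cis; lra).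
      assert (Epsi : psi w = (- e1 * (r * cis phi))%C).
      { rewrite (Hpsi_eq w Hfw0), Hwm. unfold w at 1. rewrite clog_cis by assumption. simpl snd.
        unfold rho. rewrite Rpower_mult, (Rmult_comm sigma), Hss, Rpower_1 by exact Hr.
        unfold th. replace (s * (sigma * phi)) with ((s * sigma) * phi) by ring. rewrite Hss, Rmult_1_l. reflexivity. }
      rewrite <- Epsi. eapply Rle_trans; [apply Hgr, Hfw0|]. apply exp_mono. rewrite Hwm, Hfw.
      apply Rle_trans with (C1 * rho); [|nra]. unfold C1. rewrite Rmult_assoc.
      apply Rmult_le_compat_l; [exact HA|].
      apply (Rmult_le_reg_r (rho * cos th)); [nra|].
      unfold Rdiv at 1. rewrite Rmult_assoc, Rinv_l, Rmult_1_r by nra.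
      apply Rle_trans with (4 / c1 * rho * (rho * c1)).
      + replace (4 / c1 * rho * (rho * c1)) with ((2 * rho) ^ 2) by (field; lra).
        apply pow_incr. lra.
      + apply Rmult_le_compat_l; [|nra]. apply Rmult_le_pos; [|lra]. left. apply Rdiv_lt_0_compat; lra.
    - eapply Rle_trans; [apply Hord|]. apply exp_mono.
      apply Rle_trans with C2; [|nra]. unfold C2. apply Rmult_le_compat_l; [exact HA2|].
      rewrite !Cmod_mult, Cmod_opp, e1_mod, Cmod_cis, Cmod_R, Rabs_pos_eq by lra.
      apply Rle_Rpower_l; lra. }
  assert (Hflip : forall r phi, (e1 * (RtoC r * cis phi))%C = (- e1 * (RtoC r * cis (phi - PI)))%C).
  { intros r phi. replace (cis phi) with (cis (phi - PI) * cis PI)%C.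
    - rewrite cis_PI. ring.
    - rewrite <- cis_plus. f_equal. ring. }
  assert (Hflip2 : forall r phi, (e1 * (RtoC r * cis phi))%C = (- e1 * (RtoC r * cis (phi + PI)))%C).
  { intros r phi. rewrite Hflip. do 2 f_equal. rewrite <- (cis_period (phi - PI)). f_equal. ring. }
  assert (Hout2 : forall r phi, 0 < r -> al1 <= Rabs phi <= PI ->
    Cmod (F (e1 * (r * cis phi))%C) <= exp ((C1 + C2) * (1 + Rpower r sigma))).
  { intros r phi Hr Hphi. unfold Rabs in Hphi. destruct (Rcase_abs phi).
    - rewrite Hflip2. apply Hout; [exact Hr | apply Rabs_le; lra].
    - rewrite Hflip. apply Hout; [exact Hr | apply Rabs_le; lra]. }
  destruct (sector_phragmen_lindelof F A2 K 0 e1 al1 sigma (C1 + C2)) as [C3 [HC3 HS3]];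
    try assumption; try lra.
  { nra. }
  { unfold al1. nra. }
  { intros r phi Hr Hphi. rewrite Cplus_0_l. apply Hout2; [exact Hr | lra]. }
  destruct (growth_of_polar_growth F 0 e1 sigma (C1 + C2 + C3)) as [A3 [HA3 H]]; try lra; try assumption.
  - intros r phi Hr Hphi. assert (Hrs : 0 < Rpower r sigma) by apply exp_pos.
    destruct (Rle_dec (Rabs phi) al1) as [Hs1|Hs1].
    + eapply Rle_trans; [apply HS3; assumption|]. apply exp_mono. nra.
    + rewrite Cplus_0_l. eapply Rle_trans; [apply Hout2; [exact Hr|]|].
      * split; [lra | apply Rabs_le; lra].
      * apply exp_mono. nra.
  - exists sigma, A3. auto.
Qed.

Lemma sector_zero_type (eps : R) : 0 < eps ->
  exists A, forall z, Cmod (F z) <= exp (A + eps * Cmod z).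
Proof.
  intros He. destruct sector_order_lt_1 as [sigma [A [Hs [HA H]]]].
  destruct (sublinear_Rpower sigma (eps / (A + 1)) Hs) as [B HB]; [apply Rdiv_lt_0_compat; lra|].
  exists (A * B + eps). intros z. assert (Hz := Cmod_ge_0 z).
  eapply Rle_trans; [apply H|]. apply exp_mono.
  specialize (HB (1 + Cmod z) ltac:(lra)).
  apply (Rmult_le_compat_l A) in HB; [|exact HA].
  assert (Hfrac : A * (eps / (A + 1)) <= eps).
  { apply (Rmult_le_reg_r (A + 1)); [lra|].
    replace (A * (eps / (A + 1)) * (A + 1)) with (A * eps) by (field; lra). nra. }
  nra.
Qed.
End Sector.
End Cauchy.

(** * Translation of the definitions *)

Lemma Cabs_Cmod (z : Cplx) : Cabs z = Cmod z.
Proof. unfold Cabs, Cnorm2, Cmod. f_equal. ring. Qed.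

Lemma Defs_Cdiv (z w : C) : Defs.Cdiv z w = (z / w)%C.
Proof.
  unfold Defs.Cdiv, Complex.Cdiv, Defs.Cinv, Complex.Cinv, Cnorm2, Cmul.
  replace (fst w ^ 2 + snd w ^ 2) with (fst w * fst w + snd w * snd w) by ring. reflexivity.
Qed.

Lemma Defs_Cpow (z : Cplx) (n : nat) : Defs.Cpow z n = (z ^ n)%C.
Proof. induction n as [|n IH]; [reflexivity|]. simpl. rewrite IH. reflexivity. Qed.

Lemma entire_cdiff (f : C -> C) : entire f <-> forall z, cdiff f z.
Proof.
  split; intros H z.
  - destruct (H z) as [l Hl]. apply (cdiff_of_eps f z l). intros e He.
    destruct (Hl e He) as [d [Hd Hd']]. exists d. split; [exact Hd|]. intros w Hw.
    destruct (Ceq_dec w z) as [->|Hne].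
    { rewrite Cmod_self. replace (f z - f z - l * (z - z))%C with (RtoC 0) by ring. rewrite Cmod_0. lra. }
    assert (Hn := Cminus_neq0 w z Hne). assert (Hp := proj1 (Cmod_gt_0 _) Hn).
    specialize (Hd' (w - z)%C). rewrite !Cabs_Cmod, Defs_Cdiv in Hd'.
    specialize (Hd' (conj Hp Hw)).
    change (Cmod ((f (z + (w - z))%C - f z) / (w - z) - l)%C < e) in Hd'.
    replace (z + (w - z))%C with w in Hd' by ring.
    replace (f w - f z - l * (w - z))%C with (((f w - f z) / (w - z) - l) * (w - z))%C by (field; exact Hn).
    rewrite Cmod_mult. apply Rmult_le_compat_r; lra.
  - destruct (cdiff_eps f z (H z)) as [l Hl]. exists l. intros e He.
    destruct (Hl (e / 2)) as [d [Hd Hd']]; [lra|]. exists d. split; [exact Hd|].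
    intros h. rewrite !Cabs_Cmod, Defs_Cdiv. intros Hh. change Cplx with C in *.
    change (Cmod ((f (z + h)%C - f z) / h - l)%C < e).
    assert (Hn : h <> RtoC 0) by (apply Cmod_gt_0; lra).
    specialize (Hd' (z + h)%C). replace (z + h - z)%C with h in Hd' by ring.
    specialize (Hd' (proj2 Hh)).
    replace ((f (z + h) - f z) / h - l)%C with ((f (z + h) - f z - l * h) / h)%C by (field; exact Hn).
    rewrite Cmod_div by exact Hn. apply (Rmult_lt_reg_r (Cmod h)); [lra|].
    unfold Rdiv. rewrite Rmult_assoc, Rinv_l by lra. nra.
Qed.

Lemma Rseries_ex_series (u : nat -> R) : Rseries_converges u -> ex_series u.
Proof. intros [l Hl]. exists l. apply is_series_Reals. exact Hl. Qed.

Lemma off_in_T (t : nat -> Cplx) (z : Cplx) : off t z <-> ~ in_T t z.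
Proof.
  split.
  - intros H [n E]. exact (H n E).
  - intros H n E. apply H. exists n. exact E.
Qed.

(** [cauchy_cv] speaks of limits of partial sums, whereas [cauchy] is a total function; absolute
    convergence off the poles makes them agree. *)
Lemma cauchy_cv_unique (t a : nat -> C) (k : nat) (z w : C) : (forall n, t n <> RtoC 0) ->
  (forall M, exists N, forall n, (N <= n)%nat -> M < Cmod (t n)) ->
  adm t a k -> off t z -> cauchy_cv t a k z w -> w = cauchy t a k z.
Proof.
  intros Ht Hinf Ha Hz [H1 H2]. unfold cauchy, simple_sum.
  assert (Hs := simple_summable t Ht Hinf _ (adm_coef t Ht a k Ha) z Hz).
  rewrite <- (Cser_scal _ _ Hs).
  set (u := fun n => Defs.Cdiv (Cmul (a n) (Defs.Cpow z k)) (Cmul (Defs.Cpow (t n) k) (Csub z (t n)))) in *.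
  assert (Eu : forall n, u n = (z ^ k * (a n / t n ^ k / (z - t n)))%C).
  { intros n. unfold u. rewrite Defs_Cdiv, !Defs_Cpow.
    change ((a n * z ^ k) / (t n ^ k * (z - t n)) = z ^ k * (a n / t n ^ k / (z - t n)))%C.
    field. split; [apply Cpow_nz, Ht | apply Cminus_neq0, Hz]. }
  rewrite <- (Cser_ext u _ Eu). unfold Cser. apply injective_projections; simpl; symmetry;
    apply is_series_unique, is_series_Reals; assumption.
Qed.

Lemma logplus_ln_Rmax (y : R) : 0 <= y -> logplus y = ln (Rmax y 1).
Proof.
  intros Hy. unfold logplus. destruct (Rle_dec y 1) as [H|H].
  - rewrite (Rmax_right y 1), ln_1 by exact H. apply Rmax_left.
    destruct (Rlt_dec 0 y) as [Hp|Hp]; [apply ln_nonpos; lra|].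
    (* For [y = 0] the convention that [ln] is 0 at nonpositive arguments makes both sides 0. *)
    unfold ln. destruct (Rlt_dec 0 y); [contradiction | lra].
  - rewrite (Rmax_left y 1) by lra. apply Rmax_right, ln_nonneg. lra.
Qed.

Lemma finite_exp_type_of_bound (f : C -> C) (A B : R) :
  (forall z, Cmod (f z) <= exp (A + B * Cmod z)) -> finite_exp_type f.
Proof.
  intros H. exists (exp A), B. intros z. rewrite !Cabs_Cmod, <- exp_plus. apply H.
Qed.

Lemma zero_exp_type_of_bound (f : C -> C) :
  (forall eps, 0 < eps -> exists A, forall z, Cmod (f z) <= exp (A + eps * Cmod z)) ->
  zero_exp_type f.
Proof.
  intros H eps He. destruct (H eps He) as [A HA]. exists (exp A). intros z.
  rewrite !Cabs_Cmod, <- exp_plus. apply HA.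
Qed.

Lemma cartwright_of_bounds (F : C -> C) (A B : R) (c u : C) (M : R) :
  (forall z, cdiff F z) -> 0 <= B -> (forall z, Cmod (F z) <= exp (A + B * Cmod z)) ->
  Cmod u = 1 ->
  (forall L, 0 < L ->
    RInt (fun x => ln (Rmax (Cmod (F (u * RtoC x + c)%C)) 1) / (1 + x * x)) (- L) L <= M) ->
  cartwright (fun z => F (Cadd (Cmul u z) c)).
Proof.
  intros HF HB Hexp Hu HM.
  assert (Haff : forall z, cdiff (fun z => F (u * z + c)%C) z).
  { intros z. apply (cdiff_comp F (fun z => u * z + c)%C); [|apply HF].
    apply cdiff_plus; [apply cdiff_scal, cdiff_id | apply cdiff_const]. }
  split; [|split].
  - apply entire_cdiff. exact Haff.
  - apply (finite_exp_type_of_bound _ (A + B * Cmod c) B). intros z.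
    eapply Rle_trans; [apply Hexp|]. apply exp_mono.
    assert (K : Cmod (u * z + c) <= Cmod z + Cmod c).
    { eapply Rle_trans; [apply Cmod_triangle|]. rewrite Cmod_mult, Hu. lra. }
    change (Cadd (Cmul u z) c) with (u * z + c)%C. nra.
  - exists M. intros L HL.
    set (g := fun x => logplus (Cabs (F (Cadd (Cmul u (Defs.RtoC x)) c))) / (1 + x * x)).
    set (g' := fun x => ln (Rmax (Cmod (F (u * RtoC x + c)%C)) 1) / (1 + x * x)).
    assert (Eg : forall x, g' x = g x).
    { intros x. unfold g, g'. rewrite Cabs_Cmod, logplus_ln_Rmax by apply Cmod_ge_0. reflexivity. }
    assert (Hex : ex_RInt g (- L) L).
    { apply (ex_RInt_ext g'); [intros; apply Eg|]. apply ex_RInt_cont; [lra|]. intros x _.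
      assert (Hx : 1 + x * x <> 0) by nra.
      apply (continuous_mult (fun x : R => ln (Rmax (Cmod (F (u * x + c)%C)) 1)) (fun x => / (1 + x * x))).
      - apply continuous_ln_max; [lra|].
        apply (continuous_Cmod_ccont (fun z => F (u * z + c)%C) (fun s => s) (fun _ => 0)).
        + apply cdiff_ccont, Haff.
        + apply continuous_id.
        + apply continuous_const.
      - apply (ex_derive_continuous (K := R_AbsRing) (V := R_NormedModule)). auto_derive. exact Hx. }
    exists (ex_RInt_Reals_0 _ _ _ Hex). rewrite <- RInt_Reals.
    rewrite (RInt_ext _ g') by (intros; symmetry; apply Eg). apply HM, HL.
Qed.

Theorem theorem1p1 (t : nat -> Cplx) (a b : nat -> Cplx) (k m : nat) (F : Cplx -> Cplx) :
  standing t ->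
  (condZ t \/ condPi t \/ exists gamma, condA gamma t) ->
  admissible t a k ->
  admissible t b m ->
  entire F ->
  (* C_{b,m} is not identically zero *)
  (exists z, ~ in_T t z /\ exists wb, cauchy_cv t b m z wb /\ wb <> (0, 0)) ->
  (* F = C_{a,k} / C_{b,m}, i.e. C_{a,k} = F * C_{b,m} off T *)
  (forall z, ~ in_T t z ->
     exists wa wb, cauchy_cv t a k z wa /\ cauchy_cv t b m z wb /\
                   wa = Cmul (F z) wb) ->
  finite_exp_type F /\
  ((condZ t \/ exists gamma, condA gamma t) -> zero_exp_type F) /\
  ((condPi t \/ exists gamma, condA gamma t) ->
     exists c u : Cplx, Cabs u = 1 /\ cartwright (fun z => F (Cadd (Cmul u z) c))).
Proof.
  intros [t_inj [t_neq0 t_inf0]] Hcases Ha Hb HF [z0 [Hz0 [w0 [Hw0 Hw0n]]]] Hquot.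
  assert (t_inf : forall M, exists N, forall n, (N <= n)%nat -> M < Cmod (t n)).
  { intros M. destruct (t_inf0 M) as [N HN]. exists N. intros n Hn. rewrite <- Cabs_Cmod. auto. }
  assert (Hadm : forall c j, admissible t c j -> adm t c j).
  { intros c j Hc. apply Rseries_ex_series in Hc. revert Hc. apply ex_series_ext. intros n.
    rewrite !Cabs_Cmod. reflexivity. }
  apply Hadm in Ha. apply Hadm in Hb. assert (F_entire := proj1 (entire_cdiff F) HF).
  apply off_in_T in Hz0.
  assert (Hb0 : cauchy t b m z0 <> RtoC 0).
  { rewrite <- (cauchy_cv_unique t b m z0 w0 t_neq0 t_inf Hb Hz0 Hw0). exact Hw0n. }
  assert (F_quot : forall z, off t z -> cauchy t a k z = (F z * cauchy t b m z)%C).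
  { intros z Hz. destruct (Hquot z (proj1 (off_in_T t z) Hz)) as [wa [wb [H1 [H2 H3]]]].
    rewrite <- (cauchy_cv_unique t a k z wa t_neq0 t_inf Ha Hz H1).
    rewrite <- (cauchy_cv_unique t b m z wb t_neq0 t_inf Hb Hz H2). exact H3. }
  assert (HZ : condZ t -> forall eps, 0 < eps -> exists A, forall z, Cmod (F z) <= exp (A + eps * Cmod z)).
  { intros [G [HG [HGz HG0]]].
    apply (growth_condZ t t_neq0 t_inf t_inj a b k m F Ha Hb F_entire F_quot z0 Hz0 Hb0 G).
    - apply entire_cdiff, HG.
    - intros eps He. destruct (HGz eps He) as [A HA]. exists A. intros z.
      specialize (HA z). rewrite !Cabs_Cmod in HA. exact HA.
    - exact HG0. }
  assert (Hwit : forall K, conv_exp_witness t K -> 0 < K /\ ex_series (fun n => Rpower (Cmod (t n)) (- K))).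
  { intros K [HK Hs]. split; [exact HK|]. apply Rseries_ex_series in Hs. revert Hs.
    apply ex_series_ext. intros n. rewrite Cabs_Cmod. reflexivity. }
  assert (HPi : condPi t -> exists A c u M, 0 <= A /\ Cmod u = 1 /\
    (forall z, Cmod (F z) <= exp (A + A * Cmod z)) /\
    forall L, 0 < L ->
      RInt (fun x => ln (Rmax (Cmod (F (u * RtoC x + c)%C)) 1) / (1 + x * x)) (- L) L <= M).
  { intros [[p [u [h [Hu [Hh Hstrip]]]]] [K HK]]. apply Hwit in HK. destruct HK as [HK HKs].
    rewrite Cabs_Cmod in Hu.
    destruct (strip_exp_type t t_neq0 t_inf t_inj a b k m F Ha Hb F_entire F_quot z0 Hz0 Hb0 K HK HKs
      p u h Hu Hh Hstrip) as [A [HA HFA]].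
    destruct (strip_log_integral t t_neq0 t_inf t_inj a b k m F Ha Hb F_entire F_quot z0 Hz0 Hb0 K HK HKs
      p u h Hu Hh Hstrip) as [c [u' [M [Hu' HM]]]].
    exists A, c, u', M. repeat split; try assumption.
    intros z. eapply Rle_trans; [apply HFA|]. right. f_equal. ring. }
  assert (HA : (exists gamma, condA gamma t) ->
    (forall eps, 0 < eps -> exists A, forall z, Cmod (F z) <= exp (A + eps * Cmod z)) /\
    exists c u M, Cmod u = 1 /\ forall L, 0 < L ->
      RInt (fun x => ln (Rmax (Cmod (F (u * RtoC x + c)%C)) 1) / (1 + x * x)) (- L) L <= M).
  { intros [gamma [Hg [[theta0 Hth] [K [HKg HK]]]]]. apply Hwit in HK. destruct HK as [HK HKs].
    (* The direction of the bisector: measured from it, the angle becomes symmetric, as the sector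
       argument expects. *)
    set (th1 := theta0 + PI * gamma / 2).
    assert (Hsec : forall n, exists phi, Rabs phi < PI * gamma / 2 /\
      t n = (Cmod (t n) * (cis th1 * cis phi))%C).
    { intros n. destruct (Hth n) as [phi [Hphi E]]. exists (phi - th1). split.
      - apply Rabs_lt_between. unfold th1. lra.
      - rewrite <- cis_plus. replace (th1 + (phi - th1)) with phi by ring.
        rewrite Cabs_Cmod in E. rewrite E at 1. unfold cis. apply injective_projections; simpl; ring. }
    split.
    - apply (sector_zero_type t t_neq0 t_inf t_inj a b k m F Ha Hb F_entire F_quot z0 Hz0 Hb0 K HK HKs
        gamma (cis th1) Hg HKg (Cmod_cis th1) Hsec).
    - apply (sector_log_integral t t_neq0 t_inf t_inj a b k m F Ha Hb F_entire F_quot z0 Hz0 Hb0 K HK HKs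
        gamma (cis th1) Hg (Cmod_cis th1) Hsec). }
  split; [|split].
  - destruct Hcases as [H|[H|H]].
    + destruct (HZ H 1 Rlt_0_1) as [A HA1]. exact (finite_exp_type_of_bound F A 1 HA1).
    + destruct (HPi H) as [A [c [u [M (_ & _ & HA1 & _)]]]]. exact (finite_exp_type_of_bound F A A HA1).
    + destruct (proj1 (HA H) 1 Rlt_0_1) as [A HA1]. exact (finite_exp_type_of_bound F A 1 HA1).
  - intros [H|H]; apply zero_exp_type_of_bound; [apply HZ, H | apply HA, H].
  - intros [H|H].
    + destruct (HPi H) as [A [c [u [M (HA0 & Hu & HA1 & HM)]]]]. exists c, u.
      rewrite Cabs_Cmod. split; [exact Hu|].
      apply (cartwright_of_bounds F A A c u M); assumption.
    + destruct (HA H) as [H1 [c [u [M [Hu HM]]]]]. destruct (H1 1 Rlt_0_1) as [A HA1]. exists c, u.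
      rewrite Cabs_Cmod. split; [exact Hu|].
      apply (cartwright_of_bounds F A 1 c u M); try assumption. lra.
Qed.
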